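(* Suppose $q\in\mathbb{C}[z,w]$ is a $\mathbb{T}^2$-symmetric polynomial of degree $(n,m)$ with no zeros on $\mathbb{D}^2$, and let $a,b\ge 0$ be real numbers, not both zero. Then there exist a $\mathbb{C}^n$-valued polynomial $\vec{A}(z,w)$ of degree at most $(n-1,m)$ and a $\mathbb{C}^m$-valued polynomial $\vec{B}(z,w)$ of degree at most $(n,m-1)$ such that for all $(z,w)\in\mathbb{C}^2$ \[ (an+bm)|q(z,w)|^2-2\,\mathrm{Re}\big((azq_z(z,w)+bwq_w(z,w))\overline{q(z,w)}\big)=(1-|z|^2)|\vec{A}(z,w)|^2+(1-|w|^2)|\vec{B}(z,w)|^2 . \] Furthermore, if $q$ is a product of distinct irreducible factors, then $\vec{A}$ and $\vec{B}$ have at most finitely many common zeros on $Z_q=\{(z,w)\in\mathbb{C}^2: q(z,w)=0\}$.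
   Context: $\mathbb{D}$ is the open unit disk in $\mathbb{C}$, $\mathbb{D}^2=\mathbb{D}\times\mathbb{D}$, and $\mathbb{T}$ is the unit circle. A polynomial in $\mathbb{C}[z,w]$ has degree $(n,m)$ if it has degree $n$ in $z$ and degree $m$ in $w$; it has degree at most $(n,m)$ if its degree in $z$ is at most $n$ and its degree in $w$ is at most $m$. A vector-valued polynomial has degree at most $(j,k)$ if each component does. $q_z,q_w$ are the partial derivatives of $q$. The reflection of $q$ at the degree $(n,m)$ is $\tilde q(z,w)=z^nw^m\overline{q(1/\bar z,1/\bar w)}$; $q$ (of degree $(n,m)$) is $\mathbb{T}^2$-symmetric if $q=\tilde q$. $|\cdot|$ of a vector denotes its Euclidean length.
   Formalization: The ''Furthermore'' claim is proved with the added condition that q has no nonconstant factor in z alone if a=0, and none in w alone if b=0; without it the claim fails, e.g. q=(z-1)(w-1), a=1, b=0, where A=c(w-1), |c|=1, and B=0 vanish on the whole line w=1. *)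

(* Defs.v *)
From mathcomp Require Import all_boot all_order all_algebra.
From mathcomp Require Import classical_sets cardinality reals.
From mathcomp Require Import complex.

Set Implicit Arguments.
Unset Strict Implicit.
Unset Printing Implicit Defensive.

Import Order.TTheory GRing.Theory Num.Theory.

Local Open Scope ring_scope.

(** A polynomial in C[z, w] is an element of [{poly {poly C}}]. As in [polyXY],
    the outer variable is z and the inner one is w, so that [q.[z, w]] is
    evaluation, [size q] is 1 + deg_z q and [sizeY q] is 1 + deg_w q (q != 0). *)

Section Bivariate.
Variable C : numClosedFieldType.
Implicit Types (q : {poly {poly C}}) (z w : C).

Definition has_degree q (n m : nat) : Prop :=
  size q = n.+1 /\ sizeY q = m.+1.

Definition deriv_z q : {poly {poly C}} := q^`().
Definition deriv_w q : {poly {poly C}} := map_poly (fun p : {poly C} => p^`()) q.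

Definition nonvanishing_on_bidisk q : Prop :=
  forall z w, `|z| < 1 -> `|w| < 1 -> q.[z, w] != 0.

(* Meaningful only for z, w != 0, since 0^-1 = 0 here. *)
Definition reflection (n m : nat) q z w : C :=
  z ^+ n * w ^+ m * (q.[(z^*)^-1, (w^*)^-1])^*.

(* Two polynomials agreeing wherever z, w != 0 are equal. *)
Definition T2_symmetric (n m : nat) q : Prop :=
  forall z w, z != 0 -> w != 0 -> q.[z, w] = reflection n m q z w.

(* The next two conditions matter only when one of the weights a, b is zero. For
   instance a = 1, b = 0 and q = (z - 1)(w - 1) give the form
   (1 - |z|^2) |w - 1|^2, which forces B = 0 and A = c (w - 1), and these vanish
   on the whole component w = 1 of Z_q. *)

(* No nonconstant polynomial in z alone divides q. *)
Definition no_factor_in_z_only q : Prop :=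
  forall (r : {poly C}) (u : {poly {poly C}}), q = r^:P * u -> (size r <= 1)%N.

(* No nonconstant polynomial in w alone divides q. *)
Definition no_factor_in_w_only q : Prop :=
  forall (r : {poly C}) (u : {poly {poly C}}), q = r%:P * u -> (size r <= 1)%N.

End Bivariate.

Section Factorization.
Variable D : idomainType.
Implicit Types p q : D.

(* [irreducible_poly] of [polydiv] is about field coefficients, hence unsuitable
   for [{poly {poly C}}]. *)
Definition irreducible_elt p : Prop :=
  [/\ p != 0, p \isn't a GRing.unit &
      forall u v, p = u * v -> u \is a GRing.unit \/ v \is a GRing.unit].

Definition associated p q : Prop :=
  exists2 u, u \is a GRing.unit & p = u * q.

(* Distinctness is up to units; the unit [c] lets constants be empty products. *)
Definition product_of_distinct_irreducibles q : Prop :=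
  exists (c : D) (s : seq D),
    [/\ c \is a GRing.unit,
        forall p, p \in s -> irreducible_elt p,
        uniq s,
        forall p r, p \in s -> r \in s -> associated p r -> p = r &
        q = c * \prod_(p <- s) p].

End Factorization.

(* Main.v *)
(* Put c = a n + b m and g = a z q_z + b w q_w. The left-hand side equals
   |P|^2 - |P~|^2 for P = (1 + c) / 2 q - g, whose reflection is
   P~ = (1 - c) / 2 q + g, and P has no zeros on the bidisk because
   2 Re (g / q) <= c there. So the identity is the sums of squares formula of Cole
   and Wermer for P; by dilation and compactness P may be assumed to have no
   zeros on the closed bidisk.

   Choose hermitian forms G0, Q0 with
     |P|^2 - |P~|^2 = (1 - |z|^2) G0 + (1 - |w|^2) Q0.
   The other choices are G0 - (1 - |w|^2) X and Q0 + (1 - |z|^2) X. On |w| = 1 the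
   form G0 is positive by the Schur-Cohn criterion, so the Riccati recursion
   converges to the largest X that makes the first form positive, and this form
   is then a sum of n squares. Extending arrays along the stable recurrences given
   by these squares and by P~ shows that the second form is positive too.
   Exchanging the roles of z and w, the largest X that makes the second form a sum
   of m squares makes the first one positive. Hence both extremal X agree.

   At a common zero of A, B and q the polarized identity gives g = 0. An
   irreducible factor p of q that divides g divides a z p_z + b w p_w; comparing
   degrees and constant terms, the latter is 0, which the hypotheses exclude. So q
   and g have no common factor and only finitely many common zeros. *)

Require Import Defs.
From mathcomp Require Import all_boot all_order all_algebra.
From mathcomp Require Import classical_sets cardinality reals.
From mathcomp Require Import complex.
From mathcomp Require Import all_classical interval_inference topology normedtype sequences.
From mathcomp Require Import separable cyclotomic cyclic.
From mathcomp Require Import zify ring lra.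

Set Implicit Arguments.
Unset Strict Implicit.
Unset Printing Implicit Defensive.

Import Order.TTheory GRing.Theory Num.Theory numFieldNormedType.Exports.

Local Open Scope classical_set_scope.
Local Open Scope ring_scope.

(** * Limits along an ultrafilter *)

(** The polynomial P comes from asking that P + P~ = q and P - P~ = c q - 2 g: then |P|^2 - |P~|^2,
    the real part of (P - P~) conj(P + P~), is the left-hand side. The two requests are compatible
    because the reflection of g is c q - g.

    The obstacle is the exact number of squares. A positive form in n (m + 1) coordinates is a
    priori a sum of that many squares. It becomes a sum of n squares when eliminating the n entries
    of one column leaves no remainder, which happens at an extremal X; the same X must also reduce
    the other form to m squares, hence the two extremal problems.

    Forms act on arbitrary arrays, not only on monomials, because positivity is tested on solutions
    of recurrences. These recurrences decay, and the minimizations behind them are solvable, thanks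
    to a uniform positive lower bound; this is why zeros on the boundary of the bidisk are removed
    first and restored by a limit. *)

Section UltraLimit.
Variable R : realType.
Local Notation C := R[i].

(** One ultrafilter finer than the filter of tails: along it every bounded sequence converges, so
    that many limits are taken simultaneously without extracting subsequences. *)
Definition ultra_nat : set_system nat :=
  projT1 (cid (ultraFilterLemma (@eventually_filter))).

Lemma ultra_natP : UltraFilter ultra_nat /\ \oo `<=` ultra_nat.
Proof. by rewrite /ultra_nat; case: cid. Qed.

Local Notation U := ultra_nat.

Global Instance ultra_nat_ultra : UltraFilter U.
Proof. by case: ultra_natP. Qed.

Global Instance ultra_nat_proper : ProperFilter U.
Proof. by case: ultra_natP => -[]. Qed.

Lemma ultra_bounded_cvg (u : nat -> R) (M : R) :
  (forall k, `|u k| <= M) -> exists l : R, u @ U --> l.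
Proof.
move=> uM.
have cM := @segment_compact R (- M) M.
have [|p [pM pcl]] := cM (u @ U) _.
  apply: (filterS _ (@filterT _ U _)) => k _ /=.
  by rewrite in_itv /= -ler_norml.
exists p => A pA.
(* The ultrafilter contains the preimage of the neighbourhood [A] or that of its complement; the
   latter contradicts that [p] is a cluster point. *)
have [//|UAC] := in_ultra_setVsetC (u @^-1` A) ultra_nat_ultra.
have [|x [/=]] := pcl (~` A) A _ pA => //.
Qed.

Definition ucv (u : nat -> C) (l : C) : Prop :=
  (fun k => complex.Re (u k)) @ U --> complex.Re l /\
  (fun k => complex.Im (u k)) @ U --> complex.Im l.

Lemma ucv_cst (c : C) : ucv (fun=> c) c.
Proof. by split; exact: cvg_cst. Qed.

Lemma ucvD u v a b : ucv u a -> ucv v b -> ucv (fun k => u k + v k) (a + b).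
Proof.
move=> [u1 u2] [v1 v2]; split; rewrite raddfD /=.
  by under eq_fun do rewrite raddfD; exact: cvgD.
by under eq_fun do rewrite raddfD; exact: cvgD.
Qed.

Lemma ucvM u v a b : ucv u a -> ucv v b -> ucv (fun k => u k * v k) (a * b).
Proof.
have ReM (x y : C) : complex.Re (x * y) =
  complex.Re x * complex.Re y - complex.Im x * complex.Im y by case: x; case: y.
have ImM (x y : C) : complex.Im (x * y) =
  complex.Re x * complex.Im y + complex.Im x * complex.Re y by case: x; case: y.
move=> [u1 u2] [v1 v2]; split; rewrite ?ReM ?ImM.
  by under eq_fun do rewrite ReM; apply: cvgB; exact: cvgM.
by under eq_fun do rewrite ImM; apply: cvgD; exact: cvgM.
Qed.

Lemma ucvJ u a : ucv u a -> ucv (fun k => (u k)^*) a^*.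
Proof.
have ReJ (x : C) : complex.Re x^* = complex.Re x by case: x.
have ImJ (x : C) : complex.Im x^* = - complex.Im x by case: x.
move=> [u1 u2]; split; rewrite ?ReJ ?ImJ.
  by under eq_fun do rewrite ReJ.
by under eq_fun do rewrite ImJ; exact: cvgN.
Qed.

Lemma ucv_sum (T : Type) (s : seq T) (P : pred T) (u : T -> nat -> C) (a : T -> C) :
  (forall t, P t -> ucv (u t) (a t)) ->
  ucv (fun k => \sum_(t <- s | P t) u t k) (\sum_(t <- s | P t) a t).
Proof.
move=> ua; elim: s => [|t s IH].
  by under eq_fun do rewrite big_nil; rewrite big_nil; exact: ucv_cst.
under eq_fun do rewrite big_cons; rewrite big_cons.
by case: (boolP (P t)) => // Pt; apply: ucvD IH; exact: ua.
Qed.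

Lemma ucvX u a n : ucv u a -> ucv (fun k => u k ^+ n) (a ^+ n).
Proof.
move=> ua; elim: n => [|n IH].
  by under eq_fun do rewrite expr0; rewrite expr0; exact: ucv_cst.
by under eq_fun do rewrite exprS; rewrite exprS; exact: ucvM.
Qed.

Lemma ucvN u a : ucv u a -> ucv (fun k => - u k) (- a).
Proof.
move=> ua; rewrite -mulN1r; under eq_fun do rewrite -mulN1r.
by apply: ucvM => //; exact: ucv_cst.
Qed.

Lemma ucvB u v a b : ucv u a -> ucv v b -> ucv (fun k => u k - v k) (a - b).
Proof. by move=> ua vb; apply: ucvD => //; exact: ucvN. Qed.

Lemma ucv_unique u a b : ucv u a -> ucv u b -> a = b.
Proof.
move=> [u1 u2] [v1 v2]; apply/eqP; rewrite eq_complex.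
by apply/andP; split; apply/eqP;
  [exact: (cvg_unique _ u1 v1)|exact: (cvg_unique _ u2 v2)].
Qed.

Lemma eq_ucv u v a : (forall k, u k = v k) -> ucv u a -> ucv v a.
Proof. by move=> /funext ->. Qed.

Lemma ucv_ex (u : nat -> C) (M : C) : (forall k, `|u k| <= M) -> exists l, ucv u l.
Proof.
move=> uM.
have MR : (complex.Re M)%:C%C = M.
  by apply: RRe_real; apply: ger0_real; apply: le_trans (uM 0%N).
have RM k : `|complex.Re (u k)| <= complex.Re M.
  by rewrite -lecR MR; apply: le_trans (normc_ge_Re _) (uM k).
have IM k : `|complex.Im (u k)| <= complex.Re M.
  rewrite -lecR MR; apply: le_trans (uM k).
  have -> : complex.Im (u k) = complex.Re (- 'i%C * u k).
    by case: (u k) => a b /=; rewrite oppr0 mul0r sub0r mulNr opprK mul1r.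
  apply: le_trans (normc_ge_Re _) _.
  by rewrite normrM normrN normCi mul1r.
have [a ua] := ultra_bounded_cvg RM; have [b ub] := ultra_bounded_cvg IM.
by exists (a +i* b)%C.
Qed.

Lemma ucv_real (u : nat -> R) (l : C) :
  ucv (fun k => (u k)%:C%C) l -> l = (complex.Re l)%:C%C /\ u @ U --> complex.Re l.
Proof.
move=> [u1 u2]; split=> //; apply/eqP; rewrite eq_complex /= eqxx /=; apply/eqP.
apply: (@cvg_unique _ (@norm_hausdorff _ _) _ _ _ _ u2); exact: cvg_cst.
Qed.

Lemma ucv_le (u : nat -> R) (l M : R) N : ucv (fun k => (u k)%:C%C) l%:C%C ->
  (forall k, (N <= k)%N -> u k <= M) -> l <= M.
Proof.
move=> [ul _] uM.
have -> : l = lim (u @ U) by apply/esym/cvg_lim => //; exact: norm_hausdorff.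
apply: limr_le; first by apply/cvg_ex; exists l.
by apply: (ultra_natP.2); exists N.
Qed.

Lemma ucv_ge (u : nat -> R) (l M : R) : ucv (fun k => (u k)%:C%C) l%:C%C ->
  (forall k, M <= u k) -> M <= l.
Proof.
move=> ul uM; rewrite -lerN2; apply: (@ucv_le (fun k => - u k) _ _ 0%N).
  by rewrite rmorphN; apply: eq_ucv (ucvN ul) => k; rewrite rmorphN.
by move=> k _; rewrite lerN2.
Qed.

Lemma ucv_tail (u : nat -> C) : 
  (forall e : C, 0 < e -> exists N, forall k, (N <= k)%N -> `|u k| < e) -> ucv u 0.
Proof.
move=> uc.
have H (f : C -> R) : (forall z, `|f z|%:C%C <= `|z|) -> (fun k => f (u k)) @ U --> (0 : R).
  move=> fz; apply/cvgrPdist_lt => e e0.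
  have [|N uN] := uc e%:C%C; first by rewrite ltcR.
  apply: (ultra_natP.2); exists N => // k /= Nk.
  by rewrite sub0r normrN -ltcR; apply: le_lt_trans (fz _) (uN _ Nk).
split=> /=; first by apply: H => z; exact: normc_ge_Re.
apply: (H (@complex.Im R)) => z.
have -> : complex.Im z = complex.Re (- 'i%C * z).
  by case: z => a b /=; rewrite oppr0 mul0r sub0r mulNr opprK mul1r.
apply: le_trans (normc_ge_Re _) _.
by rewrite normrM normrN normCi mul1r.
Qed.

End UltraLimit.

(** * Hermitian forms *)

Section Forms.
Variable R : realType.
Local Notation C := R[i].
Local Notation I := (nat * nat)%type.
Implicit Types (x y : I -> C) (S : pred I) (l : (I -> C) -> C) (F : (I -> C) -> R).

(** The squared modulus is kept in the real field, where forms are compared and [lra] and [nra]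
    apply. *)
Definition nsq (z : C) : R := complex.Re z ^+ 2 + complex.Im z ^+ 2.

Lemma nsqE z : (nsq z)%:C%C = z * z^*.
Proof. by rewrite /nsq add_Re2_Im2 normCK. Qed.

Lemma nsq_ge0 z : 0 <= nsq z.
Proof. by rewrite addr_ge0 ?sqr_ge0. Qed.

Lemma nsq_norm z : (nsq z)%:C%C = `|z| ^+ 2.
Proof. by rewrite nsqE normCK. Qed.

Lemma nsq_eq0 z : (nsq z == 0) = (z == 0).
Proof. by rewrite -(inj_eq (@complexI R)) nsqE -normCK sqrf_eq0 normr_eq0. Qed.

Lemma nsq_gt0 z : (0 < nsq z) = (z != 0).
Proof. by rewrite lt_def nsq_ge0 andbT nsq_eq0. Qed.

Lemma nsq0 : nsq 0 = 0.
Proof. by apply/eqP; rewrite nsq_eq0. Qed.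

Lemma nsqM z1 z2 : nsq (z1 * z2) = nsq z1 * nsq z2.
Proof. by apply: (@complexI R); rewrite rmorphM /= !nsqE rmorphM /= mulrACA. Qed.

Lemma nsqJ z : nsq z^* = nsq z.
Proof. by apply: (@complexI R); rewrite !nsqE conjCK mulrC. Qed.

(* An array [x] stands for the monomials [z^i w^j], so that a kernel identity in
   [z, w] and their conjugates becomes an identity between forms in [x]. *)
Definition lin S l := exists L : seq (C * I),
  (forall a, a \in L -> S a.2) /\ forall x, l x = \sum_(a <- L) a.1 * x a.2.

(** Hermitian symmetry of the coefficients is not imposed: it is forced by the real values of [F]
    and recovered when needed. *)
Definition herm S F := exists L : seq (C * I * I),
  (forall a, a \in L -> S a.1.2 /\ S a.2) /\
  forall x, (F x)%:C%C = \sum_(a <- L) a.1.1 * x a.1.2 * (x a.2)^*.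

Lemma lin_ext S l x y : lin S l -> (forall p, S p -> x p = y p) -> l x = l y.
Proof.
move=> [L [LS lE]] xy; rewrite !lE big_seq [RHS]big_seq.
by apply: eq_bigr => a /LS Sa; rewrite xy.
Qed.

Lemma herm_ext S F x y : herm S F -> (forall p, S p -> x p = y p) -> F x = F y.
Proof.
move=> [L [LS FE]] xy; apply: (@complexI R); rewrite !FE big_seq [RHS]big_seq.
by apply: eq_bigr => a /LS [S1 S2]; rewrite !xy.
Qed.

Lemma eq_lin S l l' : (forall x, l x = l' x) -> lin S l -> lin S l'.
Proof. by move=> /funext ->. Qed.

Lemma eq_herm S F F' : (forall x, F x = F' x) -> herm S F -> herm S F'.
Proof. by move=> /funext ->. Qed.

Lemma lin_sub S S' l : {subset S <= S'} -> lin S l -> lin S' l.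
Proof. by move=> SS [L [LS lE]]; exists L; split=> // a /LS /SS. Qed.

Lemma herm_sub S S' F : {subset S <= S'} -> herm S F -> herm S' F.
Proof.
by move=> SS [L [LS lE]]; exists L; split=> // a /LS [? ?]; split; apply: SS.
Qed.

Lemma lin0 S : lin S (fun=> 0).
Proof. by exists [::]; split=> // x; rewrite big_nil. Qed.

Lemma lin_coord S p : S p -> lin S (fun x => x p).
Proof.
move=> Sp; exists [:: (1, p)]; split=> [a|x]; first by rewrite inE => /eqP ->.
by rewrite big_seq1 mul1r.
Qed.

Lemma linD S l l' : lin S l -> lin S l' -> lin S (fun x => l x + l' x).
Proof.
move=> [L [LS lE]] [L' [LS' lE']]; exists (L ++ L'); split=> [a|x].
  by rewrite mem_cat => /orP[/LS|/LS'].
by rewrite big_cat /= lE lE'.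
Qed.

Lemma linZ S l (c : C) : lin S l -> lin S (fun x => c * l x).
Proof.
move=> [L [LS lE]]; exists [seq (c * a.1, a.2) | a <- L]; split=> [a|x].
  by case/mapP => b /LS Sb ->.
rewrite big_map lE big_distrr /=; apply: eq_bigr => a _; exact: mulrA.
Qed.

Lemma lin_sum S (T : Type) (s : seq T) (P : pred T) (l : T -> (I -> C) -> C) :
  (forall t, P t -> lin S (l t)) -> lin S (fun x => \sum_(t <- s | P t) l t x).
Proof.
move=> ls; elim: s => [|t s IH].
  by apply: (eq_lin _ (lin0 S)) => x; rewrite big_nil.
apply: (@eq_lin _ (fun x => (if P t then l t x else 0) + \sum_(t <- s | P t) l t x)).
  by move=> x; rewrite big_cons; case: (P t); rewrite ?add0r.
apply: linD IH; case: (boolP (P t)) => [Pt|_]; [exact: ls|exact: lin0].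
Qed.

Lemma lin_compJ S S' l (g : I -> I) : {in S, forall p, S' (g p)} ->
  lin S l -> lin S' (fun x => (l (fun p => (x (g p))^*))^*).
Proof.
move=> Sg [L [LS lE]]; exists [seq (a.1^*, g a.2) | a <- L]; split=> [a|x].
  by case/mapP => b /LS Sb -> /=; apply: Sg.
rewrite big_map lE rmorph_sum; apply: eq_bigr => a _.
by rewrite rmorphM /= conjCK.
Qed.

Lemma lin_add S l c x y : lin S l -> l (fun p => x p + c * y p) = l x + c * l y.
Proof.
move=> [L [LS lE]]; rewrite !lE big_distrr -big_split /=; apply: eq_bigr => a _.
by rewrite mulrDr mulrCA.
Qed.

Lemma lin_scale S l c x : lin S l -> l (fun p => c * x p) = c * l x.
Proof.
by move=> [L [LS lE]]; rewrite !lE big_distrr; apply: eq_bigr => a _; rewrite mulrCA.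
Qed.

Lemma herm0 S : herm S (fun=> 0).
Proof. by exists [::]; split=> // x; rewrite big_nil. Qed.

Lemma hermD S F F' : herm S F -> herm S F' -> herm S (fun x => F x + F' x).
Proof.
move=> [L [LS lE]] [L' [LS' lE']]; exists (L ++ L'); split=> [a|x].
  by rewrite mem_cat => /orP[/LS|/LS'].
by rewrite big_cat /= rmorphD /= lE lE'.
Qed.

Lemma hermZ S F (c : R) : herm S F -> herm S (fun x => c * F x).
Proof.
move=> [L [LS lE]]; exists [seq (c%:C%C * a.1.1, a.1.2, a.2) | a <- L]; split=> [a|x].
  by case/mapP => b /LS Sb ->.
rewrite big_map rmorphM /= lE big_distrr /=; apply: eq_bigr => a _.
by rewrite !mulrA.
Qed.

Lemma hermN S F : herm S F -> herm S (fun x => - F x).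
Proof. by move=> /(hermZ (-1)); apply: eq_herm => x; rewrite mulN1r. Qed.

Lemma hermB S F F' : herm S F -> herm S F' -> herm S (fun x => F x - F' x).
Proof. by move=> hF /hermN; exact: hermD. Qed.

Lemma herm_sum S (T : Type) (s : seq T) (P : pred T) (F : T -> (I -> C) -> R) :
  (forall t, P t -> herm S (F t)) -> herm S (fun x => \sum_(t <- s | P t) F t x).
Proof.
move=> Fs; elim: s => [|t s IH].
  by apply: (eq_herm _ (herm0 S)) => x; rewrite big_nil.
apply: (@eq_herm _ (fun x => (if P t then F t x else 0) + \sum_(t <- s | P t) F t x)).
  by move=> x; rewrite big_cons; case: (P t); rewrite ?add0r.
apply: hermD IH; case: (boolP (P t)) => [Pt|_]; [exact: Fs|exact: herm0].
Qed.

Lemma herm_comp S S' F (g : I -> I) : {in S, forall p, S' (g p)} ->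
  herm S F -> herm S' (fun x => F (fun p => x (g p))).
Proof.
move=> Sg [L [LS lE]]; exists [seq (a.1.1, g a.1.2, g a.2) | a <- L]; split=> [a|x].
  by case/mapP => b /LS [S1 S2] -> /=; split; apply: Sg.
by rewrite big_map lE.
Qed.

Lemma herm_mask S S' F (g : I -> I) (b : pred I) :
  {in S, forall p, b p -> S' (g p)} -> herm S F ->
  herm S' (fun x => F (fun p => if b p then x (g p) else 0)).
Proof.
move=> Sg [L [LS lE]].
exists [seq (a.1.1, g a.1.2, g a.2) | a <- L & b a.1.2 && b a.2]; split=> [a|x].
  case/mapP => a'; rewrite mem_filter => /andP[/andP[b1 b2] /LS [S1 S2]] -> /=.
  by split; apply: Sg.
rewrite lE big_map big_filter [RHS]big_mkcond; apply: eq_bigr => a _ /=.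
by case: (b a.1.2); case: (b a.2); rewrite /= ?rmorph0 ?mulr0 ?mul0r.
Qed.

Lemma herm_at0 S F : herm S F -> F (fun=> 0) = 0.
Proof.
by move=> [L [_ FE]]; apply: (@complexI R); rewrite FE big1 // => a _; rewrite mulr0 mul0r.
Qed.

Lemma herm_compJ S S' F (g : I -> I) : {in S, forall p, S' (g p)} ->
  herm S F -> herm S' (fun x => F (fun p => (x (g p))^*)).
Proof.
move=> Sg [L [LS lE]]; exists [seq (a.1.1, g a.2, g a.1.2) | a <- L]; split=> [a|x].
  by case/mapP => b /LS [S1 S2] -> /=; split; apply: Sg.
by rewrite big_map lE; apply: eq_bigr => a _ /=; rewrite conjCK mulrAC.
Qed.

Lemma herm_nsq S l : lin S l -> herm S (fun x => nsq (l x)).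
Proof.
move=> [L [LS lE]].
exists [seq (a.1 * b.1^*, a.2, b.2) | a <- L, b <- L]; split=> [a|x].
  by case/allpairsP => -[b c] /= [/LS ? /LS ? ->].
rewrite nsqE lE rmorph_sum big_allpairs_dep big_distrl; apply: eq_bigr => a _ /=.
rewrite big_distrr; apply: eq_bigr => b _ /=.
by rewrite rmorphM /= mulrACA mulrA.
Qed.

Lemma herm_scale S F c x : herm S F -> F (fun p => c * x p) = nsq c * F x.
Proof.
move=> [L [LS FE]]; apply: (@complexI R); rewrite rmorphM /= !FE nsqE big_distrr /=.
by apply: eq_bigr => a _; rewrite rmorphM /=; ring.
Qed.

(** Completion of the square in the coordinate [p]; [F'] is the Schur complement of the positive
    pivot. The last clause says that the minimum over the entry at [p] is attained. *)
Lemma herm_pivot S F p : ~~ S p -> herm (predU1 p S) F ->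
  0 < F (fun r => (r == p)%:R) ->
  exists F' l, [/\ herm S F', lin (predU1 p S) l,
    forall x, F x = F' x + nsq (l x) &
    forall x, exists c, l (fun r => if r == p then c else x r) = 0].
Proof.
move=> nSp [L [LS FE]] Fp.
pose L1 := [seq a <- L | (a.1.2 == p) && (a.2 == p)].
pose L2 := [seq a <- L | (a.1.2 == p) && (a.2 != p)].
pose L3 := [seq a <- L | (a.1.2 != p) && (a.2 == p)].
pose L4 := [seq a <- L | (a.1.2 != p) && (a.2 != p)].
pose d := \sum_(a <- L1) a.1.1.
pose e x := \sum_(a <- L2) a.1.1 * (x a.2)^*.
pose b x := \sum_(a <- L3) a.1.1 * x a.1.2.
pose f x := \sum_(a <- L4) a.1.1 * x a.1.2 * (x a.2)^*.
have FE' x : (F x)%:C%C = d * (x p * (x p)^*) + x p * e x + b x * (x p)^* + f x.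
  rewrite FE (bigID (fun a : C * I * I => a.1.2 == p)) /=.
  rewrite (bigID (fun a : C * I * I => a.2 == p)) /= -!addrA; congr (_ + _).
    rewrite /d /L1 big_filter big_distrl; apply: eq_bigr => a /andP[/eqP -> /eqP ->].
    by rewrite /= mulrA.
  congr (_ + _).
    rewrite /e /L2 big_filter big_distrr; apply: eq_bigr => a /andP[/eqP -> _].
    by rewrite /= mulrAC mulrC.
  rewrite (bigID (fun a : C * I * I => a.2 == p)) /=; congr (_ + _).
    rewrite /b /L3 big_filter big_distrl; apply: eq_bigr => a /andP[_ /eqP ->].
    by [].
  by rewrite /f /L4 big_filter.
have LS' a : a \in L -> (a.1.2 != p -> S a.1.2) /\ (a.2 != p -> S a.2).
  move=> /LS [/= S1 S2]; split=> /negbTE N.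
    by move: S1; rewrite N.
  by move: S2; rewrite N.
pose ep r := ((r == p)%:R : C).
pose x0 x r : C := if r == p then 0 else x r.
have eS x y : (forall r, S r -> x r = y r) -> e x = e y.
  move=> xy; rewrite /e big_seq [RHS]big_seq; apply: eq_bigr => a.
  by rewrite mem_filter => /andP[/andP[_ ap] /LS' [_ /(_ ap) Sa]]; rewrite xy.
have bS x y : (forall r, S r -> x r = y r) -> b x = b y.
  move=> xy; rewrite /b big_seq [RHS]big_seq; apply: eq_bigr => a.
  by rewrite mem_filter => /andP[/andP[ap _] /LS' [/(_ ap) Sa _]]; rewrite xy.
have fS x y : (forall r, S r -> x r = y r) -> f x = f y.
  move=> xy; rewrite /f big_seq [RHS]big_seq; apply: eq_bigr => a.
  rewrite mem_filter => /andP[/andP[ap ap'] /LS' [/(_ ap) Sa /(_ ap') Sb]].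
  by rewrite !xy.
have b0 : b (fun=> 0) = 0 by rewrite /b big1 // => a _; rewrite mulr0.
have e0 : e (fun=> 0) = 0 by rewrite /e big1 // => a _; rewrite rmorph0 mulr0.
have f0 : f (fun=> 0) = 0 by rewrite /f big1 // => a _; rewrite mulr0 mul0r.
have ep0 r : S r -> ep r = 0.
  by rewrite /ep; case: eqP => // -> /(negP nSp).
have dE : d = (F ep)%:C%C.
  rewrite FE' (eS _ _ ep0) (bS _ _ ep0) (fS _ _ ep0) b0 e0 f0.
  by rewrite /ep eqxx mulr1n rmorph1 !mulr1 mulr0 !addr0.
have setp x c r : S r -> (if r == p then c else x r) = x r.
  by case: eqP => // -> /(negP nSp).
have fR x : f x = (F (x0 x))%:C%C.
  rewrite FE' /x0 eqxx rmorph0 !mul0r !mulr0 !add0r.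
  by apply: fS => r Sr; rewrite setp.
(* The cross terms are conjugate because [F] is real; the entries 1 and i at [p] suffice to see
   it. *)
have eb x : e x = (b x)^*.
  have H c : exists r : R, c * e x + b x * c^* = r%:C%C.
    exists (F (fun r => if r == p then c else x r)
            - F ep * nsq c - F (x0 x)).
    rewrite !rmorphB rmorphM /= FE' eqxx -fR -dE nsqE.
    rewrite (eS _ x (setp x c)) (bS _ x (setp x c)) (fS _ x (setp x c)).
    by ring.
  have [r1] := H 1; have [r2] := H 'i%C.
  move: (e x) (b x) => [e1 e2] [b1 b2] /(congr1 (@complex.Im R)) /= E2.
  move=> /(congr1 (@complex.Im R)) /= E1.
  by apply/eqP; rewrite eq_complex /=; apply/andP; split; apply/eqP; lra.
have FeS : (F ep)%:C%C != 0 by rewrite (inj_eq (@complexI R) _ 0) gt_eqF.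
pose s := Num.sqrt (F ep).
have ss : s%:C%C * s%:C%C = (F ep)%:C%C.
  by rewrite -rmorphM /= -expr2 sqr_sqrtr // ltW.
have s0 : s%:C%C != 0 :> C by apply: contraNneq FeS => s0; rewrite -ss s0 mul0r.
have blin : lin S b.
  exists [seq (a.1.1, a.1.2) | a <- L3]; split=> [a|x].
    case/mapP => c; rewrite mem_filter => /andP[/andP[cp _] /LS' [/(_ cp) Sc _]] -> //.
  by rewrite big_map.
have sJ : (s%:C%C : C)^* = s%:C%C by exact: conjc_real.
(* With d = [F ep]: d |x_p|^2 + 2 Re (b conj(x_p)) = |sqrt d x_p + b / sqrt d|^2 - |b|^2 / d. *)
exists (fun x => F (x0 x) - (F ep)^-1 * nsq (b x)).
exists (fun x => s%:C%C * x p + s%:C%C^-1 * b x); split.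
- apply: hermB; last by apply: hermZ; exact: herm_nsq.
  exists L4; split=> [a|x]; last by rewrite -fR.
  by rewrite mem_filter => /andP[/andP[ap ap'] /LS' [/(_ ap) Sa /(_ ap') Sb]].
- apply: linD; apply: linZ; first by apply: lin_coord; rewrite /= eqxx.
  by apply: lin_sub blin => r Sr; rewrite !inE; apply/orP; right.
- move=> x; apply: (@complexI R).
  rewrite FE' rmorphD rmorphB rmorphM /= -fR fmorphV /= !nsqE eb dE -ss.
  rewrite rmorphD !rmorphM fmorphV /= sJ.
  by field.
- move=> x; exists (- (s%:C%C^-1 * s%:C%C^-1 * b x)).
  rewrite eqxx (bS _ x (setp x _)).
  by field.
Qed.

(** Block Schur complement, one pivot at a time. The equations [l i = 0] form a triangular system,
    solved by back substitution. *)
Lemma herm_elim S F (s : seq I) k : size s = k -> uniq s ->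
  (forall p, p \in s -> ~~ S p) -> herm [pred p | S p || (p \in s)] F ->
  (forall x, (forall p, p \notin s -> x p = 0) -> (exists2 p, p \in s & x p != 0) ->
     0 < F x) ->
  exists F' (l : 'I_k -> (I -> C) -> C),
   [/\ herm S F', forall i, lin [pred p | S p || (p \in s)] (l i),
      forall x, F x = F' x + \sum_(i < k) nsq (l i x) &
      forall x, exists x', (forall p, p \notin s -> x' p = x p) /\
        forall i, l i x' = 0].
Proof.
elim: s k F => [|p s IH] k F /=.
  move=> <- _ _ hF _; exists F, (fun _ _ => 0); split.
  - by apply: herm_sub hF => p; rewrite !inE orbF.
  - by move=> i; exact: lin0.
  - by move=> x; rewrite big_ord0 addr0.
  - by move=> x; exists x; split=> // -[].
case: k => // k [sk] /andP[ps us] sS hF Fpos.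
have pS : ~~ [pred p | S p || (p \in s)] p.
  by rewrite /= negb_or ps andbT; apply: sS; rewrite mem_head.
have hF2 : herm (predU1 p [pred p | S p || (p \in s)]) F.
  by apply: herm_sub hF => r; rewrite !inE orbCA.
have [|F1 [l1 [hF1 hl1 FE1 z1]]] := herm_pivot pS hF2.
  apply: Fpos => [r|]; first by rewrite inE negb_or => /andP[/negbTE -> _].
  by exists p; rewrite ?mem_head // eqxx oner_neq0.
have [r rs||x xs [r rs xr]|F' [l [hF' hl FE' z]]] := IH k F1 sk us.
- by apply: sS; rewrite inE rs orbT.
- exact: hF1.
(* The remaining pivots stay positive: with the entry at [p] chosen so that [l1] vanishes, [F1 x] is
   a value of [F]. *)
- have [c l1c] := z1 x.
  have -> : F1 x = F (fun r => if r == p then c else x r).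
    rewrite FE1 l1c nsq0 addr0; apply: (herm_ext hF1) => q /= Sq.
    by case: eqP => // qp; case/negP: pS; rewrite -qp.
  apply: Fpos => [q|].
    by rewrite inE negb_or => /andP[/negbTE -> /xs].
  exists r; first by rewrite inE rs orbT.
  by case: (r =P p) => // rp; rewrite -rp rs in ps.
exists F', (fun i => if unlift ord0 i is Some j then l j else l1); split=> //.
- move=> i; case: unliftP => [j _|_].
    by apply: lin_sub (hl j) => q; rewrite !inE => /orP[->//|->]; rewrite !orbT.
  by apply: lin_sub hl1 => q; rewrite !inE orbCA.
- move=> x; rewrite FE1 FE' big_ord_recl unlift_none -addrA; congr (_ + _).
  rewrite addrC; congr (_ + _).
  by apply: eq_bigr => i _; rewrite liftK.
- move=> x; have [y [yx ly]] := z x; have [c l1c] := z1 y.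
  exists (fun r => if r == p then c else y r); split=> [q|i].
    by rewrite inE negb_or => /andP[/negbTE -> /yx].
  case: unliftP => [j _|//].
  rewrite -(ly j); apply: (lin_ext (hl j)) => q /= Sq.
  by case: eqP => // qp; case/negP: pS; rewrite -qp.
Qed.

Definition unitv (p : I) : I -> C := fun r => (r == p)%:R.

Lemma lin_unitv (s : seq I) l x : uniq s -> lin (mem s) l ->
  l x = \sum_(p <- s) l (unitv p) * x p.
Proof.
move=> us [L [LS lE]].
under [RHS]eq_bigr => p _ do rewrite lE big_distrl.
rewrite lE exchange_big /= big_seq [RHS]big_seq; apply: eq_bigr => a /LS /= as_.
rewrite (bigD1_seq a.2) //= /unitv eqxx mulr1 big1 ?addr0 // => q qa.
by rewrite eq_sym (negbTE qa) mulr0 mul0r.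
Qed.

(** Polarization: this combination of values is the total coefficient of x_p conj(x_r) in [F]. *)
Definition polar_coef F (p r : I) : C :=
  2^-1 * ((F (fun t => unitv p t + unitv r t))%:C%C
            - (F (unitv p))%:C%C - (F (unitv r))%:C%C
   + 'i * ((F (fun t => unitv p t + 'i * unitv r t))%:C%C
            - (F (unitv p))%:C%C - (F (unitv r))%:C%C)).

Lemma polar_coefE S F : herm S F -> exists L : seq (C * I * I),
  [/\ (forall a, a \in L -> S a.1.2 /\ S a.2),
    (forall x, (F x)%:C%C = \sum_(a <- L) a.1.1 * x a.1.2 * (x a.2)^*) &
    forall p r, polar_coef F p r = \sum_(a <- L) a.1.1 * unitv p a.1.2 * unitv r a.2].
Proof.
have uJ q t : (unitv q t)^* = unitv q t :> C by rewrite rmorph_nat.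
move=> [L [LS FE]]; exists L; split=> // p r.
rewrite /polar_coef !FE -!sumrB big_distrr -big_split /= big_distrr /=; apply: eq_bigr => a _.
rewrite !rmorphD /= rmorphM /= conjCi !uJ.
have ii : 'i * 'i = -1 :> C by rewrite -expr2 sqrCi.
set u := unitv p _; set v := unitv r _; set u' := unitv p _; set v' := unitv r _.
set c := a.1.1.
have -> : 'i * (c * (u + 'i * v) * (u' + - 'i * v') - c * u * u' - c * v * v')
   = - ('i * 'i) * c * u * v' + ('i * 'i) * c * v * u' - ('i * ('i * 'i) + 'i) * c * v * v'.
  by ring.
by rewrite ii; field.
Qed.

Lemma herm_polar (s : seq I) F x : uniq s -> herm (mem s) F ->
  (F x)%:C%C = \sum_(p <- s) \sum_(r <- s) polar_coef F p r * x p * (x r)^*.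
Proof.
move=> us hF; have [L [LS FE kE]] := polar_coefE hF.
under eq_bigr => p _ do under eq_bigr => r _ do rewrite kE big_distrl /= big_distrl /=.
under eq_bigr => p _ do rewrite exchange_big /=.
rewrite FE exchange_big /= big_seq [RHS]big_seq; apply: eq_bigr => a /LS /= [a1 a2].
rewrite (bigD1_seq a.1.2) //= (bigD1_seq a.2) //= /unitv !eqxx !mulr1.
rewrite !big1 ?addr0 // => [q qa|q qa].
  by rewrite big1 // => t _; rewrite eq_sym (negbTE qa) !(mulr0, mul0r).
by rewrite eq_sym (negbTE qa) !(mulr0, mul0r).
Qed.

(* By polarization a Hermitian form on finitely many coordinates is a fixed
   combination of its values, so that pointwise limits are again such forms. *)
Lemma herm_ucv (s : seq I) (Fk : nat -> (I -> C) -> R) F : uniq s ->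
  (forall k, herm (mem s) (Fk k)) ->
  (forall x, ucv (fun k => (Fk k x)%:C%C) (F x)%:C%C) -> herm (mem s) F.
Proof.
move=> us hF FF.
exists [seq (polar_coef F pr.1 pr.2, pr.1, pr.2) | pr <- [seq (p, r) | p <- s, r <- s]].
split=> [a|x].
  by case/mapP => -[p r] /allpairsP [[p' r'] /= [ps rs [-> ->]]] ->.
rewrite big_map big_allpairs_dep /=; apply: ucv_unique (FF x) _.
apply: (eq_ucv (fun k => esym (herm_polar x us (hF k)))).
apply: ucv_sum => p _; apply: ucv_sum => r _; apply: ucvM; last exact: ucv_cst.
apply: ucvM; last exact: ucv_cst.
apply: ucvM; first exact: ucv_cst.
apply: ucvD; first by apply: ucvB; [apply: ucvB|]; exact: FF.
apply: ucvM; first exact: ucv_cst.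
by apply: ucvB; [apply: ucvB|]; exact: FF.
Qed.

End Forms.

(** * Decaying sequences and recurrences *)

Section Decay.
Variable R : realType.
Local Notation C := R[i].
Local Notation I := (nat * nat)%type.
Implicit Types (u v z y : nat -> C) (p q : {poly C}).

Definition cv0 u := forall e : C, 0 < e -> exists N, forall k, (N <= k)%N -> `|u k| < e.

Lemma cv0_0 : cv0 (fun=> 0).
Proof. by move=> e e0; exists 0%N => k _; rewrite normr0. Qed.

Lemma eq_cv0 u v : (forall k, u k = v k) -> cv0 u -> cv0 v.
Proof. by move=> /funext ->. Qed.

Lemma cv0D u v : cv0 u -> cv0 v -> cv0 (fun k => u k + v k).
Proof.
move=> uc vc e e0; have e20 : 0 < e / 2 by rewrite divr_gt0.
have [N1 uN] := uc _ e20; have [N2 vN] := vc _ e20.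
exists (maxn N1 N2) => k; rewrite geq_max => /andP[/uN ue /vN ve].
by apply: le_lt_trans (ler_normD _ _) _; rewrite [e]splitr ltrD.
Qed.

Lemma cv0Z (c : C) u : cv0 u -> cv0 (fun k => c * u k).
Proof.
have [->|c0] := eqVneq c 0.
  by move=> _; apply: (eq_cv0 _ cv0_0) => k; rewrite mul0r.
move=> uc e e0; have [|N uN] := uc (e / `|c|).
  by rewrite divr_gt0 ?normr_gt0.
by exists N => k /uN; rewrite ltr_pdivlMr ?normr_gt0 // normrM mulrC.
Qed.

Lemma cv0_sum (T : Type) (s : seq T) (P : pred T) (f : T -> nat -> C) :
  (forall t, P t -> cv0 (f t)) -> cv0 (fun k => \sum_(t <- s | P t) f t k).
Proof.
move=> fc; elim: s => [|t s IH].
  by apply: (eq_cv0 _ cv0_0) => k; rewrite big_nil.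
have [Pt|Pt] := boolP (P t).
  by apply: (eq_cv0 _ (cv0D (fc t Pt) IH)) => k; rewrite big_cons Pt.
by apply: (eq_cv0 _ IH) => k; rewrite big_cons (negbTE Pt).
Qed.

Lemma cv0M u v : cv0 u -> cv0 v -> cv0 (fun k => u k * v k).
Proof.
move=> uc vc e e0; have [N1 uN] := uc _ e0; have [N2 vN] := vc _ ltr01.
exists (maxn N1 N2) => k; rewrite geq_max => /andP[/uN ue /vN ve].
rewrite normrM -[e]mulr1; apply: le_lt_trans (_ : `|u k| * 1 < _).
  by rewrite ler_wpM2l // ltW.
by rewrite !mulr1.
Qed.

Lemma cv0J u : cv0 u -> cv0 (fun k => (u k)^*).
Proof. by move=> uc e /uc [N uN]; exists N => k /uN; rewrite norm_conjC. Qed.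

Lemma cv0_shift u m : cv0 u -> cv0 (fun k => u (m + k)%N).
Proof.
by move=> uc e /uc [N uN]; exists N => k Nk; apply: uN; rewrite (leq_trans Nk) ?leq_addl.
Qed.

Lemma cv0_unshift u m : cv0 (fun k => u (m + k)%N) -> cv0 u.
Proof.
move=> uc e /uc [N uN]; exists (m + N)%N => k Nk.
by have := uN (k - m)%N; rewrite subnKC; [apply; lia|lia].
Qed.

Lemma cv0_expr (r : C) : `|r| < 1 -> cv0 (fun k => r ^+ k).
Proof.
move=> r1 e e0; set a := complex.Re `|r|; set b := complex.Re e.
have aE : a%:C%C = `|r| by apply: RRe_real; apply: normr_real.
have bE : b%:C%C = e by apply: RRe_real; apply: gtr0_real.
have a0 : 0 <= a by rewrite -lecR aE normr_ge0.
have a1 : `|a| < 1 by rewrite ger0_norm // -ltcR aE.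
have b0 : 0 < b by rewrite -ltcR bE.
have /cvgrPdist_lt /(_ b b0) [N _ HN] := cvg_expr a1.
exists N => k Nk; have := HN k Nk; rewrite /= sub0r normrN ger0_norm; last first.
  exact: exprn_ge0.
by rewrite -ltcR bE rmorphXn /= aE normrX.
Qed.

Lemma cv0_rec (r : C) z : `|r| < 1 ->
  cv0 (fun k => z k.+1 - r * z k) -> cv0 z.
Proof.
move=> r1 zc e e0.
have r10 : 0 < 1 - `|r| by rewrite subr_gt0.
(* The number e / 2 is the fixed point of t -> |r| t + e / 2 (1 - |r|), so a bound by |r|^j |z_N| +
   e / 2 propagates. *)
have [|N zN] := zc (e / 2 * (1 - `|r|)); first by rewrite mulr_gt0 ?divr_gt0.
have H j : `|z (N + j)%N| <= `|r| ^+ j * `|z N| + e / 2.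
  elim: j => [|j IH]; first by rewrite addn0 expr0 mul1r lerDl ltW ?divr_gt0.
  rewrite addnS -[z _](subrK (r * z (N + j)%N)).
  apply: le_trans (ler_normD _ _) _.
  apply: le_trans (lerD (ltW (zN _ (leq_addr _ _))) (_ : _ <= `|r| * (`|r| ^+ j * `|z N| + e / 2))) _.
    by rewrite normrM ler_wpM2l.
  rewrite exprS le_eqVlt; apply/orP; left; apply/eqP; ring.
have [|M rM] := cv0Z `|z N| (cv0_expr r1) (e := e / 2); first by rewrite divr_gt0.
exists (N + M)%N => k Nk; have -> : k = (N + (k - N))%N by lia.
apply: le_lt_trans (H _) _; rewrite [ltRHS]splitr ltr_leD //.
have := rM (k - N)%N; rewrite normrM normrX !normr_id mulrC; apply; lia.
Qed.

(** The polynomial [p] in the shift operator, applied to [y]. Factorizations and Bezout identities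
    thus act on linear recurrences. *)
Definition pact y p (s : nat) : C := \sum_(i < size p) p`_i * y (s + i)%N.

Lemma pactE y p s N : (size p <= N)%N -> pact y p s = \sum_(i < N) p`_i * y (s + i)%N.
Proof.
move=> pN; rewrite /pact (big_ord_widen N (fun i => p`_i * y (s + i)%N) pN).
rewrite big_mkcond; apply: eq_bigr => i _.
by case: ltnP => // si; rewrite nth_default // mul0r.
Qed.

Lemma pactD y p q s : pact y (p + q) s = pact y p s + pact y q s.
Proof.
set N := maxn (size p) (size q).
rewrite !(@pactE y _ s N) ?leq_maxl ?leq_maxr ?(size_polyD p q) //.
by rewrite -big_split; apply: eq_bigr => i _; rewrite coefD mulrDl.
Qed.

Lemma pactZ y c p s : pact y (c *: p) s = c * pact y p s.
Proof.
rewrite (@pactE _ _ _ (size p)) ?size_scale_leq // big_distrr.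
by apply: eq_bigr => i _; rewrite /= coefZ mulrA.
Qed.

Lemma pactX y p s : pact y ('X * p) s = pact y p s.+1.
Proof.
rewrite (@pactE _ _ _ (size p).+1); last first.
  by apply: leq_trans (size_polyMleq _ _) _; rewrite size_polyX.
rewrite big_ord_recl coefXM mul0r add0r; apply: eq_bigr => i _.
by rewrite coefXM /= addnS addSn.
Qed.

Lemma pact1 y s : pact y 1 s = y s.
Proof. by rewrite /pact size_poly1 big_ord1 coef1 mul1r addn0. Qed.

Lemma pact_decay y p : p != 0 -> (forall c : C, root p c -> `|c| < 1) ->
  cv0 (pact y p) -> cv0 y.
Proof.
move=> p0 rp; have [rs pE] := closed_field_poly_normal p.
have lp : lead_coef p != 0 by rewrite lead_coef_eq0.
have {}rp (z : C) : z \in rs -> `|z| < 1.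
  by move=> zr; apply: rp; rewrite pE rootZ // root_prod_XsubC.
move=> yc; have {yc} : cv0 (pact y (\prod_(c <- rs) ('X - c%:P))).
  apply: (eq_cv0 _ (cv0Z (lead_coef p)^-1 yc)) => k.
  by rewrite {2}pE pactZ mulKf.
elim: rs rp {pE} => [|r rs IH] rp.
  by rewrite big_nil; apply: eq_cv0 => k; rewrite pact1.
rewrite big_cons mulrBl mul_polyC => yc; apply: IH.
  by move=> z zr; apply: rp; rewrite inE zr orbT.
apply: (@cv0_rec r); first by apply: rp; rewrite mem_head.
by apply: (eq_cv0 _ yc) => k; rewrite -scaleNr pactD pactX pactZ mulNr.
Qed.

Lemma pact_coprime y p q : coprimep p q ->
  (forall s, pact y p s = 0) -> (forall s, pact y q s = 0) -> forall s, y s = 0.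
Proof.
move=> /Bezout_eq1_coprimepP [[u v] /= uv] yp yq s.
have H (r t : {poly C}) : (forall s, pact y r s = 0) -> forall s, pact y (t * r) s = 0.
  move=> yr; elim/poly_ind: t => [|t c IH] {}s.
    by rewrite mul0r /pact size_poly0 big_ord0.
  by rewrite mulrDl mulrAC mulrC pactD pactX IH mul_polyC pactZ yr mulr0 addr0.
by rewrite -pact1 -uv pactD !H // addr0.
Qed.

Definition tw (t : nat) (x : I -> C) : I -> C := fun r => x (r.1, r.2 + t)%N.

End Decay.

Section Trajectory.
Variable R : realType.
Local Notation C := R[i].
Local Notation I := (nat * nat)%type.

(* [Phi] constrains the columns [0 .. m] and is solved successively for the last
   of them. *)
Lemma trajectory m (Phi : (I -> C) -> Prop) :
  (forall x x', (forall p, (p.2 <= m)%N -> x p = x' p) -> Phi x -> Phi x') ->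
  (forall x, exists x', (forall p, p.2 != m -> x' p = x p) /\ Phi x') ->
  forall x, exists x', (forall p, (p.2 < m)%N -> x' p = x p) /\
    forall t, Phi (tw t x').
Proof.
move=> loc step x.
have /choice [f Hf] := step.
(* [G t] applies the solver to the window starting at column [t] and changes only column [m + t].
   Column [j] is therefore constant in [X s] for s > j, and the diagonal of the stages is the
   trajectory. *)
pose G t X p := if (p.2 < t)%N then X p else f (tw t X) (p.1, p.2 - t)%N.
pose X := fix X t := if t is t'.+1 then G t' (X t') else x.
have XE t p : p.2 != (m + t)%N -> X t.+1 p = X t p.
  move=> pm /=; rewrite /G; case: ltnP => // tp.
  rewrite (Hf _).1 /tw /=; first by case: p pm tp => a b /= _ tb; rewrite subnK.
  by move: pm tp; rewrite /=; lia.
have XS t s p : (p.2 < m + t)%N -> X (t + s)%N p = X t p.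
  move=> pm; elim: s => [|s IH]; rewrite ?addn0 // addnS XE ?IH //.
  by apply: contraTneq pm => ->; rewrite -leqNgt leq_add2l leq_addr.
have XP t : Phi (tw t (X t.+1)).
  apply: loc (Hf (tw t (X t))).2 => p _.
  by rewrite /tw /= /G /= ltnNge leq_addl /= addnK; case: p.
exists (fun p => X p.2.+1 p); split=> [p pm|t].
  by have := XS 0%N p.2.+1 p; rewrite add0n addn0 => ->.
apply: loc (XP t) => -[a b] bm; have {}bm : (b <= m)%N := bm.
suff: X t.+1 (a, b + t)%N = X (b + t).+1 (a, b + t)%N by [].
have -> : (b + t).+1 = (t.+1 + b)%N by rewrite addSn addnC.
by apply/esym/XS; rewrite /= addnS ltnS leq_add2r.
Qed.

Lemma herm_cv0 S F (x : nat -> I -> C) : herm S F ->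
  (forall p, S p -> cv0 (fun k => x k p)) -> cv0 (fun k => (F (x k))%:C%C).
Proof.
move=> [L [LS FE]] xc.
apply: (eq_cv0 (fun k => esym (FE (x k)))).
apply: (@eq_cv0 _ (fun k => \sum_(a <- L | a \in L) a.1.1 * x k a.1.2 * (x k a.2)^*)).
  by move=> k; rewrite [RHS]big_seq.
apply: cv0_sum => a /LS [a1 a2].
apply: cv0M; first by apply: cv0Z; exact: xc.
by apply: cv0J; exact: xc.
Qed.

Lemma cv0_nonneg (f : nat -> R) : (forall k, f k.+1 <= f k) ->
  cv0 (fun k => (f k)%:C%C) -> 0 <= f 0%N.
Proof.
move=> fd fc; rewrite leNgt; apply/negP => f0.
have fk k : f k <= f 0%N by elim: k => // k; apply: le_trans.
have [|N /(_ N (leqnn N))] := fc (- f 0%N)%:C%C; first by rewrite ltcR oppr_gt0.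
rewrite normc_def /= expr0n addr0 sqrtr_sqr ltcR ltNge.
by rewrite ler0_norm ?lerN2 ?fk // (le_trans (fk N)) // ltW.
Qed.

End Trajectory.

(** * Finite Fourier transform *)

Section Fourier.
Variable R : realType.
Local Notation C := R[i].

Lemma prim_root_exists K : (0 < K)%N -> exists z : C, K.-primitive_root z.
Proof.
move=> K0; pose p : {poly C} := 'X^K - 1.
have [r Dp] := closed_field_poly_normal p.
move: Dp; rewrite (monicP _) ?monicXnsubC // scale1r => Dp.
have rn1 : all K.-unity_root r by apply/allP=> z; rewrite -root_prod_XsubC -Dp.
have sr : size r = K by apply: succn_inj; rewrite -(size_prod_XsubC r id) -Dp size_XnsubC.
have ur : uniq r.
  by rewrite -separable_prod_XsubC -Dp; apply: separable_Xn_sub_1; rewrite pnatr_eq0 -lt0n.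
have /hasP[z _ prim_z] : has K.-primitive_root r by rewrite has_prim_root // sr.
by exists z.
Qed.

Variables (K : nat) (z : C).
Hypothesis zP : K.-primitive_root z.

Lemma prim_root_norm : `|z| = 1.
Proof.
have K0 := prim_order_gt0 zP.
apply/eqP; rewrite -(@pexpr_eq1 _ _ K) //.
by rewrite -normrX (prim_expr_order zP) normr1.
Qed.

Lemma unit_conj (w : C) : `|w| = 1 -> w * w^* = 1.
Proof. by move=> w1; rewrite -normCK w1 expr1n. Qed.

Lemma prim_root_orthogonal s t : (s < K)%N -> (t < K)%N ->
  \sum_(k < K) (z ^+ k) ^+ s * ((z ^+ k) ^+ t)^* = (if s == t then K%:R else 0).
Proof.
move=> sK tK; have zz := unit_conj prim_root_norm.
pose y := z ^+ s * z^* ^+ t.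
rewrite (eq_bigr (fun k : 'I_K => y ^+ k)); last first.
  by move=> k _; rewrite rmorphXn rmorphXn /= /y exprMn -!exprM mulnC [(k * t)%N]mulnC.
have yK : y ^+ K = 1.
  rewrite /y exprMn -!exprM mulnC exprM (prim_expr_order zP) expr1n mul1r mulnC.
  by rewrite exprM -rmorphXn (prim_expr_order zP) rmorph1 expr1n.
case: eqVneq => [st|st].
  rewrite (eq_bigr (fun=> 1)) ?sumr_const ?card_ord // => k _.
  by rewrite /y st -exprMn zz !expr1n.
have y1 : y - 1 != 0.
  rewrite subr_eq0; apply: contra_neq st => y1.
  have : z ^+ s = z ^+ t.
    have -> : z ^+ s = y * z ^+ t by rewrite /y mulrAC -mulrA -exprMn zz expr1n mulr1.
    by rewrite y1 mul1r.
  move/eqP; rewrite (eq_prim_root_expr zP) !modn_small //; exact: eqP.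
by apply: (mulfI y1); rewrite -subrX1 yK subrr mulr0.
Qed.

(** Averaging over the [K]-th roots of unity is the finite substitute for integration over the
    circle |w| = 1. *)
Lemma parseval (a b : nat -> C) :
  \sum_(k < K) (\sum_(t < K) a t * ((z ^+ k) ^+ t)^*) *
               (\sum_(t < K) b t * ((z ^+ k) ^+ t)^*)^* =
  K%:R * \sum_(t < K) a t * (b t)^*.
Proof.
under eq_bigr => k _ do rewrite rmorph_sum big_distrlr /=.
rewrite exchange_big big_distrr; apply: eq_bigr => t _ /=.
rewrite exchange_big (bigD1 t) //= [X in _ + X]big1 ?addr0 => [|s st].
  rewrite (eq_bigr (fun k : 'I_K => a t * (b t)^* * ((z ^+ k) ^+ t * ((z ^+ k) ^+ t)^*))).
    by rewrite -big_distrr /= prim_root_orthogonal // eqxx mulrC.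
  by move=> k _; rewrite rmorphM /= conjCK; ring.
rewrite (eq_bigr (fun k : 'I_K => a t * (b s)^* * ((z ^+ k) ^+ s * ((z ^+ k) ^+ t)^*))).
  by rewrite -big_distrr /= prim_root_orthogonal // (inj_eq val_inj) (negbTE st) mulr0.
by move=> k _; rewrite rmorphM /= conjCK; ring.
Qed.

(** The zeros of [a] below [m] and from [K] on prevent wraparound, so a shift by at most [m] loses
    no term and the cyclic transform behaves like one on the whole line. *)
Lemma fourier_shift m u (a : nat -> C) k : (u <= m)%N ->
  (forall j, (j < m)%N || (K <= j)%N -> a j = 0) ->
  (\sum_(j < K) a j * ((z ^+ k) ^+ j)^*) * (z ^+ k) ^+ u =
  \sum_(t < K) a (t + u)%N * ((z ^+ k) ^+ t)^*.
Proof.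
move=> um a0; set w := z ^+ k.
have ww : w * w^* = 1 by apply: unit_conj; rewrite normrX prim_root_norm expr1n.
pose f j := a j * (w ^+ j)^* * w ^+ u.
have fK N : (K <= N)%N -> \sum_(j < K) f j = \sum_(j < N) f j.
  move=> KN; rewrite (big_ord_widen N f KN) big_mkcond; apply: eq_bigr => j _.
  by case: ltnP => // Kj; rewrite /f a0 ?Kj ?orbT // !mul0r.
rewrite big_distrl /= -/(f _) (fK (K + u)%N) ?leq_addr // addnC big_split_ord /=.
rewrite big1 ?add0r => [|j _]; last first.
  by rewrite /f a0 ?(leq_trans (ltn_ord j)) // !mul0r.
apply: eq_bigr => t _; rewrite /f addnC exprD rmorphM /=.
by rewrite -!mulrA [_^* * _ ^+ _]mulrC (unit_conj (w := w ^+ u)) ?mulr1 // /w !normrX prim_root_norm !expr1n.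
Qed.

End Fourier.

(** * Stable polynomials *)

Section Stable.
Variable R : realType.
Local Notation C := R[i].
Local Notation I := (nat * nat)%type.

Section OneVariable.
Variables (N : nat) (f : nat -> C).
Hypothesis f_stable : forall z : C, `|z| <= 1 -> \sum_(i < N.+1) f i * z ^+ i != 0.

Let p : {poly C} := \poly_(i < N.+1) f i.
Let q : {poly C} := \poly_(i < N.+1) (f (N - i)%N)^*.

Lemma stable_const_neq0 : f 0%N != 0.
Proof.
have := @f_stable 0; rewrite normr0 ler01 => /(_ isT).
rewrite big_ord_recl expr0 mulr1 big1 ?addr0 // => i _.
by rewrite lift0 expr0n mulr0.
Qed.

Lemma revpoly_horner z : z != 0 ->
  q.[z] = z ^+ N * (\sum_(i < N.+1) f i * (z^-1)^* ^+ i)^*.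
Proof.
move=> z0; rewrite horner_poly rmorph_sum big_distrr (reindex_inj rev_ord_inj) /=.
apply: eq_bigr => i _; have iN : (i <= N)%N by rewrite -ltnS ltn_ord.
rewrite subSS subKn // rmorphM rmorphXn /= conjCK.
rewrite mulrCA; congr (_ * _).
rewrite -[in z ^+ N](subnK iN) exprD -mulrA exprVn divff ?mulr1 //.
by rewrite expf_neq0.
Qed.

Lemma revpoly_root z : root q z -> `|z| < 1.
Proof.
have [->|z0] := eqVneq z 0; first by rewrite normr0 ltr01.
rewrite /root revpoly_horner // mulf_eq0 expf_eq0 (negbTE z0) andbF /= conjC_eq0.
apply: contraTT; rewrite -real_leNgt ?real1 ?normr_real // => z1.
by apply: f_stable; rewrite norm_conjC normfV invf_le1 // normr_gt0.
Qed.

Lemma revpoly_neq0 : q != 0.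
Proof.
apply/eqP => /(congr1 (fun r : {poly C} => r`_N)).
rewrite coef0 coef_poly ltnSn subnn => /eqP.
by rewrite conjC_eq0 (negbTE stable_const_neq0).
Qed.

(** The roots of [p] lie outside the closed disk, those of its reversal [q] in the open disk. *)
Lemma revpoly_coprime : coprimep p q.
Proof.
apply/negPn/negP => /closed_rootP [z]; rewrite root_gcd => /andP[pz /revpoly_root z1].
by have := f_stable (ltW z1); rewrite -horner_poly => /negP; apply.
Qed.

Lemma pact_poly (h : nat -> C) y s :
  pact y (\poly_(i < N.+1) h i) s = \sum_(i < N.+1) h i * y (s + i)%N.
Proof.
rewrite (@pactE _ _ _ _ N.+1) ?size_poly //; apply: eq_bigr => i _.
by rewrite coef_poly ltn_ord.
Qed.

Lemma revpoly_decay y :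
  cv0 (fun s => \sum_(i < N.+1) (f (N - i)%N)^* * y (s + i)%N) -> cv0 y.
Proof.
move=> yc; apply: (pact_decay revpoly_neq0 revpoly_root).
by apply: (eq_cv0 _ yc) => s; rewrite pact_poly.
Qed.

(* Extending [y] by the recurrence of the reversed polynomial makes the form
   decrease by squares along the shifts, to the limit [0]. *)
Lemma schur_cohn (g : (nat -> C) -> R) :
  (forall y y', (forall i, (i < N)%N -> y i = y' i) -> g y = g y') ->
  (forall y, cv0 y -> cv0 (fun k => (g (fun i => y (k + i)%N))%:C%C)) ->
  (forall y, g y - g (fun i => y i.+1) =
     nsq (\sum_(i < N.+1) f i * y i) - nsq (\sum_(i < N.+1) (f (N - i)%N)^* * y i)) ->
  forall y, (exists2 i, (i < N)%N & y i != 0) -> 0 < g y.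
Proof.
move=> gloc glim gid y0 [i0 i0N y00].
pose Phi (x : I -> C) := \sum_(i < N.+1) (f (N - i)%N)^* * x (0, i : nat)%N = 0.
have [|x|x [xy0 xP]] := @trajectory R N Phi _ _ (fun r => y0 r.2).
- move=> x x' xx' xP; rewrite /Phi -[RHS]xP; apply: eq_bigr => i _.
  by congr (_ * _); apply/esym/xx'; rewrite /= -ltnS ltn_ord.
- pose h := \sum_(i < N) (f (N - i)%N)^* * x (0, i : nat)%N.
  exists (fun r => if r.2 == N then - (f 0%N)^*^-1 * h else x r); split.
    by move=> r /negbTE ->.
  rewrite /Phi big_ord_recr /= eqxx subnn mulNr mulrN mulVKf ?conjC_eq0 ?stable_const_neq0 //.
  rewrite (eq_bigr (fun i : 'I_N => (f (N - i)%N)^* * x (0, i : nat)%N)) ?subrr // => i _.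
  by rewrite ltn_eqF.
pose y s := x (0, s)%N.
have yP s : \sum_(i < N.+1) (f (N - i)%N)^* * y (s + i)%N = 0.
  by rewrite -[RHS](xP s); apply: eq_bigr => i _; rewrite /tw /= addnC.
have yc : cv0 y.
  by apply: revpoly_decay; apply: (eq_cv0 _ (@cv0_0 R)) => s; rewrite yP.
have yy0 i : (i < N)%N -> y i = y0 i by move=> iN; rewrite /y xy0.
rewrite -(gloc y y0 yy0).
pose e k := g (fun i => y (k + i)%N).
have eE k : e k - e k.+1 = nsq (\sum_(i < N.+1) f i * y (k + i)%N).
  have := gid (fun i => y (k + i)%N); rewrite yP nsq0 subr0 => <-; rewrite /e.
  by congr (_ - g _); apply/funext => i; rewrite addSnnS.
have ed k : e k.+1 <= e k by rewrite -subr_ge0 eE nsq_ge0.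
have e_ge0 k : 0 <= e k.
  rewrite -[k]addn0; apply: (@cv0_nonneg R (fun j => e (k + j)%N)).
    by move=> j; rewrite addnS.
  by apply: (@cv0_shift _ (fun j => (e j)%:C%C)); exact: glim.
have e0E : g y = e 0%N by congr g; apply/funext => i; rewrite add0n.
(* Strictness: if the energy starts at 0 it stays 0, so all squares in its decrease vanish, and [y]
   satisfies the recurrences of two coprime polynomials. *)
rewrite lt_def e0E e_ge0 andbT; apply/eqP => e00.
have ek k : e k = 0.
  elim: k => // k IH; apply/eqP; rewrite eq_le e_ge0 andbT -[leRHS]IH; exact: ed.
suff /(_ i0) /eqP : forall s, y s = 0 by rewrite yy0 // (negbTE y00).
apply: (pact_coprime revpoly_coprime) => s; rewrite pact_poly ?yP //.
by apply/eqP; rewrite -nsq_eq0 -eE !ek subrr.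
Qed.

End OneVariable.

Definition box a b : pred I := fun p => (p.1 < a)%N && (p.2 < b)%N.

(* Shifting an array corresponds to multiplying by [z], respectively [w]. *)
Definition sz (x : I -> C) : I -> C := fun p => x (p.1.+1, p.2).
Definition sw (x : I -> C) : I -> C := fun p => x (p.1, p.2.+1).

Definition pfun n m (c : nat -> nat -> C) (x : I -> C) : C :=
  \sum_(i < n.+1) \sum_(j < m.+1) c i j * x (i : nat, j : nat).

Definition refl_coef n m (c : nat -> nat -> C) i j : C := (c (n - i)%N (m - j)%N)^*.

Definition monom (z w : C) : I -> C := fun p => z ^+ p.1 * w ^+ p.2.

Definition stable n m c := forall z w : C,
  `|z| <= 1 -> `|w| <= 1 -> pfun n m c (monom z w) != 0.

(** On [monom z w] the two differences are (1 - |z|^2) [G0] and (1 - |w|^2) [Q0]. Positivity of the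
    forms is not part of the notion. *)
Definition split_form n m c (G0 Q0 : (I -> C) -> R) :=
  [/\ herm (box n m.+1) G0, herm (box n.+1 m) Q0 &
   forall x, G0 x - G0 (sz x) + (Q0 x - Q0 (sw x)) =
     nsq (pfun n m c x) - nsq (pfun n m (refl_coef n m c) x)].

Lemma pfun_lin n m c : lin (box n.+1 m.+1) (pfun n m c).
Proof.
apply: lin_sum => i _; apply: lin_sum => j _; apply: linZ.
by apply: lin_coord; rewrite /box /= !ltn_ord.
Qed.

Section Energy.
Variables (n m : nat) (c : nat -> nat -> C) (G0 Q0 : (I -> C) -> R).
Hypothesis cst : stable n m c.
Hypothesis base : split_form n m c G0 Q0.

Definition tens (y : nat -> C) (w : C) : I -> C := fun p => y p.1 * w ^+ p.2.

(** For |w| = 1 the shift [sw] multiplies the array by a unimodular number, so [Q0] cancels and the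
    Schur-Cohn situation remains for the polynomial in z with w frozen. *)
Lemma tens_pos (w : C) y : `|w| = 1 -> (exists2 i, (i < n)%N & y i != 0) ->
  0 < G0 (tens y w).
Proof.
case: base => hG hQ id w1.
pose f i := \sum_(j < m.+1) c i j * w ^+ j.
have ww : w * w^* = 1 by exact: unit_conj.
apply: (@schur_cohn n f _ (fun y => G0 (tens y w))).
- move=> z z1; have w1' : `|w| <= 1 by rewrite w1 lexx.
  have := cst z1 w1'; apply: contra_neq => <-; apply: eq_bigr => i _.
  rewrite big_distrl; apply: eq_bigr => j _ /=.
  by rewrite /monom /=; ring.
- move=> {}y y' yy'; apply: (herm_ext hG) => p /andP[p1 _].
  by rewrite /tens yy'.
- move=> {}y yc; apply: (herm_cv0 hG) => p _; rewrite /tens.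
  apply: (eq_cv0 (u := fun k => w ^+ p.2 * y (p.1 + k)%N)).
    by move=> k; rewrite mulrC addnC.
  by apply: cv0Z; apply: cv0_shift.
move=> {}y; have := id (tens y w).
have -> : Q0 (sw (tens y w)) = Q0 (tens y w).
  have -> : sw (tens y w) = (fun p => w * tens y w p).
    by apply/funext => p; rewrite /sw /tens /= exprS; ring.
  rewrite (herm_scale _ _ hQ) -[RHS]mul1r; congr (_ * _).
  by apply: (@complexI R); rewrite nsqE ww.
rewrite subrr addr0 => -> ; congr (_ - _).
  congr nsq; apply: eq_bigr => i _; rewrite big_distrl; apply: eq_bigr => j _ /=.
  by rewrite /tens /=; ring.
rewrite -[RHS]mul1r.
(* On |w| = 1, reversal in both variables is w^m times reversal in z alone. *)
have <- : nsq (w ^+ m) = 1.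
  by apply: (@complexI R); rewrite nsqE rmorphXn -exprMn ww expr1n.
rewrite -nsqM; congr nsq; rewrite big_distrr; apply: eq_bigr => i _ /=.
rewrite rmorph_sum big_distrl big_distrr /= (reindex_inj rev_ord_inj) /=.
apply: eq_bigr => j _; have jm : (j <= m)%N by rewrite -ltnS ltn_ord.
rewrite /refl_coef /tens /= subSS subKn //.
rewrite rmorphM rmorphXn /=.
have -> : w ^+ (m - j) = w ^+ m * w^* ^+ j.
  have -> : w ^+ m = w ^+ (m - j) * w ^+ j by rewrite -exprD subnK.
  by rewrite -mulrA -exprMn ww expr1n mulr1.
by ring.
Qed.

Lemma herm_ucv_tens S F (w : nat -> C) (y : nat -> nat -> C) w0 y0 :
  herm S F -> ucv w w0 -> (forall i, ucv (fun k => y k i) (y0 i)) ->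
  ucv (fun k => (F (tens (y k) (w k)))%:C%C) (F (tens y0 w0))%:C%C.
Proof.
move=> [L [_ FE]] wc yc; rewrite FE.
apply: (eq_ucv (fun k => esym (FE (tens (y k) (w k))))).
have tc p : ucv (fun k => tens (y k) (w k) p) (tens y0 w0 p).
  by apply: ucvM; [exact: yc|exact: ucvX].
apply: ucv_sum => a _; apply: ucvM; last exact: ucvJ.
by apply: ucvM => //; exact: ucv_cst.
Qed.

Lemma tens_unit_small : ~ (exists2 d : R, 0 < d & forall (w : C) (y : nat -> C), `|w| = 1 ->
    d * \sum_(i < n) nsq (y i) <= G0 (tens y w)) ->
  forall k : nat, exists wy : C * (nat -> C),
  [/\ `|wy.1| = 1, \sum_(i < n) nsq (wy.2 i) = 1, forall i, `|wy.2 i| <= 1 &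
      G0 (tens wy.2 wy.1) <= k.+1%:R^-1].
Proof.
case: base => hG hQ id H k; apply: contrapT => N; apply: H.
exists k.+1%:R^-1; first by rewrite invr_gt0 ltr0n.
move=> w y w1; rewrite leNgt; apply/negP; set s := \sum_(i < n) _ => Gs.
have s_ge0 : 0 <= s by apply: sumr_ge0 => i _; exact: nsq_ge0.
have [s0|s0] := eqVneq s 0.
  have y0 i : (i < n)%N -> y i = 0.
    move=> iN; move/eqP: s0; rewrite psumr_eq0 => [|? _]; last exact: nsq_ge0.
    by move=> /allP /(_ (Ordinal iN) (mem_index_enum _)) /=; rewrite nsq_eq0 => /eqP.
  have G00 : G0 (tens y w) = G0 (fun p => 0 * tens y w p).
    apply: (herm_ext hG) => p /andP[pn _].
    by rewrite mul0r /tens y0 // mul0r.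
  by move: Gs; rewrite G00 (herm_scale _ _ hG) nsq0 mul0r s0 mulr0 ltxx.
have s_gt0 : 0 < s by rewrite lt_def s0.
pose r := ((Num.sqrt s)^-1)%:C%C : C.
have rE : nsq r = s^-1.
  by rewrite /nsq /= expr0n addr0 exprVn sqr_sqrtr.
(* Rows from [n] on are invisible to [G0]; setting them to 0 keeps every entry bounded, so that all
   limits exist. *)
pose y' i := if (i < n)%N then r * y i else 0.
have y's : \sum_(i < n) nsq (y' i) = 1.
  rewrite -[RHS](mulVf s0) -rE big_distrr; apply: eq_bigr => i _.
  by rewrite /y' ltn_ord nsqM.
apply: N; exists (w, y'); split=> //= [i|].
- rewrite -(@expr_le1 _ 2) // -nsq_norm (_ : 1 = (1 : R)%:C%C) // lecR.
  case: (ltnP i n) => iN; last by rewrite /y' ltnNge iN nsq0 ler01.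
  rewrite -y's (bigD1 (Ordinal iN)) //= lerDl; apply: sumr_ge0 => j _.
  exact: nsq_ge0.
- have -> : G0 (tens y' w) = G0 (fun p => r * tens y w p).
    apply: (herm_ext hG) => p /andP[pn _].
    by rewrite /tens /y' pn mulrA.
  by rewrite (herm_scale _ _ hG) rE mulrC ler_pdivrMr // ltW.
Qed.

(** Compactness of the circle times the unit sphere: otherwise normalized near-minimizers would have
    a limit contradicting [tens_pos]. *)
Lemma tens_coercive : exists2 d : R, 0 < d & forall (w : C) (y : nat -> C), `|w| = 1 ->
  d * \sum_(i < n) nsq (y i) <= G0 (tens y w).
Proof.
apply: contrapT => /tens_unit_small /choice [f Hf].
have [w wc] : exists w, ucv (fun k => (f k).1) w.
  by apply: (@ucv_ex _ _ 1) => k; have [-> _ _ _] := Hf k.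
have /choice [y yc] i : exists y, ucv (fun k => (f k).2 i) y.
  by apply: (@ucv_ex _ _ 1) => k; have [_ _ -> _] := Hf k.
have w1 : `|w| = 1.
  apply/eqP; rewrite -(@pexpr_eq1 _ _ 2) // normCK; apply/eqP.
  apply: ucv_unique (ucvM wc (ucvJ wc)) _; apply: (eq_ucv _ (ucv_cst 1)) => k.
  by have [w1 _ _ _] := Hf k; rewrite unit_conj.
have y1 : \sum_(i < n) nsq (y i) = 1.
  apply: (@complexI R); rewrite rmorph_sum /=; under eq_bigr => i _ do rewrite nsqE.
  have yc2 (i : 'I_n) := ucvM (yc i) (ucvJ (yc i)).
  apply: ucv_unique (ucv_sum _ (fun i _ => yc2 i)) _.
  apply: (eq_ucv _ (ucv_cst 1)) => k; have [_ y1 _ _] := Hf k.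
  have -> : 1 = (1 : R)%:C%C :> C by [].
  rewrite -y1 rmorph_sum; apply: eq_bigr => i _; exact: nsqE.
have [hG hQ id] := base.
have Gc := herm_ucv_tens hG wc yc.
have : 0 < G0 (tens y w).
  apply: tens_pos => //; apply: contrapT => N.
  move/eqP: y1; rewrite big1 ?(eq_sym 0) ?oner_eq0 // => i _.
  apply/eqP; rewrite nsq_eq0; apply/negPn/negP => yi; apply: N.
  by exists (i : nat).
rewrite ltNge => /negP; apply; apply/ler_addgt0Pr => e e0; rewrite add0r.
have [N _ HN] := near_infty_natSinv_lt (PosNum e0).
apply: (ucv_le (N := N) Gc) => k Nk; have [_ _ _ Gk] := Hf k.
by apply: le_trans Gk (ltW _); exact: HN.
Qed.

(** A Fourier transform in the second index turns the sum over windows into an average of [G0] over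
    arrays [tens y w] with |w| = 1. There the pointwise bound applies, and Parseval's identity
    translates the norms back. *)
Lemma energy_coercive : exists2 d : R, 0 < d & forall (K : nat) (x : I -> C),
  (forall p, (p.2 < m)%N || (K <= p.2)%N -> x p = 0) ->
  d * \sum_(t < K) \sum_(i < n) nsq (x (i : nat, t : nat)) <= \sum_(t < K) G0 (tw t x).
Proof.
have [d d0 Hd] := tens_coercive; exists d => // K x x0.
case: (posnP K) => [K0|K0]; first by subst K; rewrite !big_ord0 mulr0.
have [z zP] := @prim_root_exists R _ K0.
case: base => -[L [LS GE]] hQ id.
pose y (k i : nat) : C := \sum_(j < K) x (i, j : nat) * ((z ^+ k) ^+ j)^*.
have K0' : K%:R != 0 :> C by rewrite pnatr_eq0 -lt0n.
have KR : 0 < K%:R :> R by rewrite ltr0n.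
have E1 : \sum_(k < K) G0 (tens (y k) (z ^+ k)) = K%:R * \sum_(t < K) G0 (tw t x).
  apply: (@complexI R); rewrite rmorphM rmorph_nat /= !rmorph_sum /=.
  under eq_bigr => k _ do rewrite GE.
  under [in RHS]eq_bigr => k _ do rewrite GE.
  rewrite exchange_big [in RHS]exchange_big /= big_distrr /= big_seq [RHS]big_seq.
  apply: eq_bigr => a /LS [/andP[_ a1] /andP[_ a2]].
  have xa i j : (j < m)%N || (K <= j)%N -> x (i, j) = 0 by move=> ?; rewrite x0.
  under eq_bigr => k _ do
    rewrite /tens /y (@fourier_shift R K z zP m a.1.2.2 (fun j => x (a.1.2.1, j)) k a1 (xa _))
      (@fourier_shift R K z zP m a.2.2 (fun j => x (a.2.1, j)) k a2 (xa _)) -mulrA.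
  rewrite -big_distrr /=.
  rewrite (parseval zP (fun t => x (a.1.2.1, (t + a.1.2.2)%N))
    (fun t => x (a.2.1, (t + a.2.2)%N))) mulrCA; congr (_ * _).
  by rewrite big_distrr; apply: eq_bigr => t _; rewrite /tw /= mulrA ![(t + _)%N]addnC.
have E2 : \sum_(k < K) \sum_(i < n) nsq (y k i) =
    K%:R * \sum_(t < K) \sum_(i < n) nsq (x (i : nat, t : nat)).
  apply: (@complexI R); rewrite rmorphM rmorph_nat /= exchange_big /= [in RHS]exchange_big /=.
  rewrite !rmorph_sum big_distrr; apply: eq_bigr => i _ /=; rewrite !rmorph_sum /=.
  under eq_bigr => k _ do rewrite nsqE.
  under [in RHS]eq_bigr => k _ do rewrite nsqE.
  exact: (parseval zP (fun t => x (i : nat, t)) (fun t => x (i : nat, t))).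
rewrite -(ler_pM2l KR) -E1 mulrCA -E2 big_distrr /=; apply: ler_sum => k _.
by apply: Hd; rewrite normrX (prim_root_norm zP) expr1n.
Qed.

End Energy.

End Stable.

(** * The Riccati recursion *)

Section Riccati.
Variable R : realType.
Local Notation C := R[i].
Local Notation I := (nat * nat)%type.
Implicit Types (x y z : I -> C) (X Y : (I -> C) -> R).

(** The support lies in columns [m] to [K - 1], so the windows of width [m + 1] starting at [t < K]
    include all those that meet it. *)
Definition coercive n m (d : R) (G0 : (I -> C) -> R) := forall (K : nat) (x : I -> C),
  (forall p, (p.2 < m)%N || (K <= p.2)%N -> x p = 0) ->
  d * \sum_(t < K) \sum_(i < n) nsq (x (i : nat, t : nat)) <= \sum_(t < K) G0 (tw t x).

Variables (n m : nat) (d : R) (G0 : (I -> C) -> R).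
Hypothesis hG : herm (box n m.+1) G0.
Hypothesis d_gt0 : 0 < d.
Hypothesis G0co : coercive n m d G0.

Definition trunc k x : I -> C := fun p => if (p.2 < k)%N then x p else 0.
Definition pad x : I -> C := fun p => if (m <= p.2)%N then x (p.1, p.2 - m)%N else 0.

(* The forms below are optimal costs of a linear control problem: the state is
   the window of columns [0 .. m - 1], the control is the column [m]. From
   [free_cost] on the controls are zero. *)
Definition free_cost x := \sum_(t < m) G0 (tw t (trunc m x)).
Definition cost k x := \sum_(t < k) G0 (tw t x) + free_cost (tw k x).
(* The energy of [x] preceded by zeros is nonnegative, which bounds the cost from
   below by minus the energy of the windows that meet these zeros. *)
Definition cost_bound x := - \sum_(t < m) G0 (tw t (pad (trunc m x))).

Lemma tw0 x : tw 0 x = x.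
Proof. by apply/funext => -[a b]; rewrite /tw /= addn0. Qed.

Lemma twS t x : tw t.+1 x = tw t (sw x).
Proof. by apply/funext => -[a b]; rewrite /tw /sw /= addnS. Qed.

Lemma tw_add s t x : tw s (tw t x) = tw (s + t) x.
Proof. by apply/funext => -[a b]; rewrite /tw /= addnA. Qed.

Lemma swE x : sw x = tw 1 x.
Proof. by apply/funext => -[a b]; rewrite /tw /sw /= addn1. Qed.

Lemma herm_sw a b X : herm (box a b) X -> herm (box a b.+1) (fun x => X (sw x)).
Proof. by apply: herm_comp => -[i j]; rewrite ?inE /box /= ltnS. Qed.

Lemma free_cost_herm : herm (box n m) free_cost.
Proof.
apply: herm_sum => t _; rewrite /trunc /tw.
apply: (herm_mask (S := box n m.+1) (g := fun p => (p.1, p.2 + t)%N)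
  (b := fun p => (p.2 + t < m)%N)) hG => -[i j].
by rewrite ?inE /box /= => /andP[-> _] ->.
Qed.

Lemma cost_bound_herm : herm (box n m) cost_bound.
Proof.
apply: hermN; apply: herm_sum => t _.
apply: (eq_herm _ (herm_mask (S := box n m.+1) (S' := box n m)
  (g := fun p => (p.1, p.2 + t - m)%N)
  (b := fun p => (m <= p.2 + t)%N && (p.2 + t - m < m)%N) _ hG)) => [x|[i j]].
  congr (G0 _); apply/funext => -[i j]; rewrite /tw /pad /trunc /=.
  by case: leqP => //= _; case: ltnP.
by rewrite ?inE /box /= => /andP[-> _] /andP[_ ->].
Qed.

Lemma costS k x : cost k.+1 x = G0 x + cost k (sw x).
Proof.
rewrite /cost big_ord_recl tw0 -addrA; congr (_ + (_ + _)).
  by apply: eq_bigr => t _; rewrite lift0 twS.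
by rewrite twS.
Qed.

Lemma cost_ge k x : cost_bound x + d * \sum_(t < k) \sum_(i < n) nsq (x (i : nat, (m + t)%N))
  <= cost k x.
Proof.
(* [m] zero columns, then [m + k] columns of [x], then zeros. The windows form blocks of lengths
   [m], [k], [m], with energies minus the cost bound, the cost of the first [k] steps, and the free
   cost. *)
pose z := pad (trunc (m + k) x).
have E1 (t : 'I_m) : G0 (tw t z) = G0 (tw t (pad (trunc m x))).
  apply: (herm_ext hG) => -[i j] /andP[_]; rewrite ltnS /= => jm.
  rewrite /tw /z /pad /trunc /=; case: (leqP m (j + t)%N) => // mj.
  have h : (j + t - m < m)%N by have := ltn_ord t; lia.
  by rewrite h (_ : (j + t - m < m + k)%N) //; lia.
have E2 (t : 'I_k) : G0 (tw (m + t)%N z) = G0 (tw t x).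
  apply: (herm_ext hG) => -[i j] /andP[_]; rewrite ltnS /= => jm.
  rewrite /tw /z /pad /trunc /= addnCA leq_addr addKn.
  by rewrite (_ : (j + t < m + k)%N) //; have := ltn_ord t; lia.
have E3 (t : 'I_m) : G0 (tw (m + (k + t))%N z) = G0 (tw t (trunc m (tw k x))).
  congr (G0 _); apply/funext => -[i j].
  rewrite /tw /z /pad /trunc /= addnCA leq_addr addKn.
  rewrite (_ : (j + (k + t) < m + k)%N = (j + t < m)%N); last by lia.
  by case: ifP => // _; congr (x (_, _)); lia.
have z0 p : (p.2 < m)%N || (m + (k + m) <= p.2)%N -> z p = 0.
  rewrite /z /pad /trunc; case: p => i j /= /orP[jm|jm]; first by rewrite leqNgt jm.
  by case: ifP => // mj; rewrite ifF //; lia.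
have := G0co z0.
have -> : \sum_(t < m + (k + m)) \sum_(i < n) nsq (z (i : nat, t : nat)) =
  \sum_(t < m + m) \sum_(i < n) nsq (z (i : nat, t : nat)) +
  \sum_(t < k) \sum_(i < n) nsq (x (i : nat, (m + t)%N)).
  have -> : (m + (k + m) = (m + m) + k)%N by rewrite addnAC addnA.
  rewrite big_split_ord; congr (_ + _); apply: eq_bigr => t _; apply: eq_bigr => i _.
  by rewrite /z /pad /trunc /= -addnA leq_addr addKn ltn_add2l ltn_ord.
have : 0 <= d * \sum_(t < m + m) \sum_(i < n) nsq (z (i : nat, t : nat)).
  apply: mulr_ge0; first exact: ltW.
  by apply: sumr_ge0 => t _; apply: sumr_ge0 => i _; exact: nsq_ge0.
rewrite !big_split_ord /= mulrDr.
rewrite (eq_bigr _ (fun t _ => E1 t)) (eq_bigr _ (fun t _ => E2 t)) (eq_bigr _ (fun t _ => E3 t)).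
rewrite /cost_bound /cost /free_cost; lra.
Qed.


Lemma free_cost_step x : (forall p, (m <= p.2)%N -> x p = 0) ->
  free_cost x = G0 x + free_cost (sw x).
Proof.
move=> x0.
have tx y : (forall p, (m <= p.2)%N -> y p = 0) -> trunc m y = y.
  move=> y0; apply/funext => p; rewrite /trunc.
  by case: ltnP => // mp; rewrite y0.
have sx0 p : (m <= p.2)%N -> sw x p = 0 by move=> mp; apply: x0; rewrite (leq_trans mp) /=.
rewrite /free_cost !tx //.
have : G0 (tw m x) = 0.
  rewrite -(herm_at0 hG); congr (G0 _); apply/funext => p.
  by apply: x0; rewrite leq_addl.
case: (m) => [|k]; first by rewrite !big_ord0 tw0 addr0.
move=> Gm; rewrite big_ord_recl [in RHS]big_ord_recr /= tw0 -twS Gm addr0.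
by congr (_ + _); apply: eq_bigr => t _; rewrite /bump /= add1n twS.
Qed.

(** [free_cost] already accounts for zero controls, so one explicit step with zero control adds
    nothing. Hence the optimal costs decrease with [k]. *)
Lemma cost_trunc k x : cost k.+1 (trunc (m + k) x) = cost k x.
Proof.
rewrite /cost big_ord_recr /= -addrA; congr (_ + _).
  apply: eq_bigr => t _; apply: (herm_ext hG) => -[i j] /andP[_]; rewrite ltnS /= => jm.
  by rewrite /tw /trunc /= ifT // -addnS leq_add.
have twt : tw k (trunc (m + k) x) = trunc m (tw k x).
  by apply/funext => -[i j]; rewrite /tw /trunc /= ltn_add2r.
rewrite -add1n -tw_add -swE twt -free_cost_step; last first.
  by move=> p mp; rewrite /trunc ltnNge mp.
have tt y : trunc m (trunc m y) = trunc m y.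
  by apply/funext => p; rewrite /trunc; case: ltnP.
by rewrite /free_cost tt.
Qed.

Lemma cost_bound0 x : (forall p, (p.2 < m)%N -> x p = 0) -> cost_bound x = 0.
Proof.
move=> x0; rewrite -(herm_at0 cost_bound_herm).
by apply: (herm_ext cost_bound_herm) => p /andP[_ pm]; rewrite x0.
Qed.

(** The minimal cost over all continuations of the initial window. Attainment is included so that
    bounds on costs become bounds on [X]. *)
Definition is_value k X := [/\ herm (box n m) X, forall x, X x <= cost k x &
  forall x, exists x', (forall p, (p.2 < m)%N -> x' p = x p) /\ X x = cost k x'].

Definition column : seq I := [seq (i, m) | i <- iota 0 n].

Lemma mem_column p : (p \in column) = (p.1 < n)%N && (p.2 == m).
Proof.
apply/mapP/andP => [[i +]|[pn /eqP pm]].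
  by rewrite mem_iota add0n => /= iN ->.
by exists p.1; rewrite ?mem_iota //; case: p pn pm => a b /= _ ->.
Qed.

Lemma box_column p : box n m p || (p \in column) = box n m.+1 p.
Proof. by rewrite mem_column /box; case: (p.1 < n)%N => //=; rewrite ltnS [in RHS]leq_eqVlt orbC. Qed.

(** Elimination of the control. Positivity of [W] on arrays with zero state makes the block of
    column [m] positive definite; its [n] entries are the source of the [n] squares. *)
Lemma minimize_column W : herm (box n m.+1) W ->
  (forall x, (forall p, (p.2 < m)%N -> x p = 0) ->
     d * \sum_(i < n) nsq (x (i : nat, m)) <= W x) ->
  exists X (l : 'I_n -> (I -> C) -> C), [/\ herm (box n m) X,
    forall i, lin (box n m.+1) (l i),
    forall x, W x = X x + \sum_(i < n) nsq (l i x) &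
    forall x, exists x', (forall p, p.2 != m -> x' p = x p) /\ forall i, l i x' = 0].
Proof.
move=> hW Wpos.
have sub1 : {subset box n m.+1 <= [pred p | box n m p || (p \in column)]}.
  by move=> p pb; rewrite inE /= box_column.
have [||p|||X [l [hX hl WE lz]]] := @herm_elim R (box n m) W column n.
- by rewrite size_map size_iota.
- by rewrite map_inj_uniq ?iota_uniq // => i j [].
- by rewrite mem_column /box => /andP[_ /eqP ->]; rewrite ltnn andbF.
- exact: herm_sub hW.
- move=> x x0 [p pc xp0]; apply: lt_le_trans (Wpos x _); last first.
    by move=> q qm; apply: x0; rewrite mem_column ltn_eqF // andbF.
  rewrite mulr_gt0 //; move: pc; rewrite mem_column => /andP[pn /eqP pm].
  rewrite (bigD1 (Ordinal pn)) //=; apply: ltr_pwDl.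
    by rewrite nsq_gt0 -pm; case: (p) xp0.
  by apply: sumr_ge0 => i _; exact: nsq_ge0.
exists X, l; split=> // [i|x].
  by apply: lin_sub (hl i) => p; rewrite inE /= box_column.
have [x' [xx' lx']] := lz x; exists x'; split=> // p pm.
by apply: xx'; rewrite mem_column negb_and pm orbT.
Qed.

Lemma value_exists k : exists X, is_value k X.
Proof.
elim: k => [|k [X [hX Xle Xat]]].
  exists free_cost; split; first exact: free_cost_herm.
    by move=> x; rewrite /cost big_ord0 add0r tw0.
  by move=> x; exists x; split=> //; rewrite /cost big_ord0 add0r tw0.
(* Bellman's equation: the next value is the minimum of [W] over column [m]. The required positivity
   follows from [cost_ge], since the cost bound vanishes at zero state. *)
pose W x := G0 x + X (sw x).
have hW : herm (box n m.+1) W by apply: hermD => //; exact: herm_sw.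
have Wat x : exists x', (forall p, (p.2 <= m)%N -> x' p = x p) /\ W x = cost k.+1 x'.
  have [y [yx Xy]] := Xat (sw x).
  exists (fun p => if p.2 is j.+1 then y (p.1, j) else x p); split.
    by case=> i [|j] //= jm; rewrite yx.
  rewrite costS /W Xy; congr (_ + cost k _); last by apply/funext => -[].
  apply: (herm_ext hG) => -[i [|j]] //= /andP[_ /= jm].
  by rewrite yx.
have [|X' [l [hX' hl WE lz]]] := minimize_column hW.
  move=> x x0; have [x' [xx' ->]] := Wat x.
  apply: le_trans (cost_ge _ _); rewrite cost_bound0 => [|p pm]; last first.
    by rewrite xx' ?x0 // ltnW.
  rewrite add0r ler_pM2l // big_ord_recl /= addn0.
  under eq_bigr => i _ do rewrite -xx' //.
  by rewrite lerDl; apply: sumr_ge0 => t _; apply: sumr_ge0 => i _; exact: nsq_ge0.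
have X'W x : X' x <= W x.
  by rewrite WE lerDl; apply: sumr_ge0 => i _; exact: nsq_ge0.
exists X'; split=> // x.
  by apply: le_trans (X'W x) _; rewrite costS lerD2l.
have [x1 [x1x lx1]] := lz x; have [x' [x'x1 Wx']] := Wat x1.
exists x'; split.
  by move=> p pm; rewrite x'x1 1?ltnW // x1x // ltn_eqF.
rewrite -Wx' WE big1 => [|i _]; last by rewrite lx1 nsq0.
rewrite addr0; apply: (herm_ext hX') => p /andP[_ pm].
by rewrite x1x // ltn_eqF.
Qed.

End Riccati.

(** * The largest solution of the matrix inequality *)

Section Limit.
Variable R : realType.
Local Notation C := R[i].
Local Notation I := (nat * nat)%type.
Implicit Types (x y z : I -> C) (X Y : (I -> C) -> R).

Definition boxs a b : seq I := [seq (i, j) | i <- iota 0 a, j <- iota 0 b].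

Lemma boxs_uniq a b : uniq (boxs a b).
Proof.
apply: allpairs_uniq; rewrite ?iota_uniq // => -[i j] [i' j'] _ _ /= [-> ->].
by [].
Qed.

Lemma mem_boxs a b p : (p \in boxs a b) = box a b p.
Proof.
apply/allpairsP/andP => [[[i j] /= []]|[pa pb]].
  by rewrite !mem_iota !add0n => /= ? ? ->.
by exists p; rewrite !mem_iota; split=> //; case: (p).
Qed.

Lemma herm_boxs a b X : herm (box a b) X -> herm (mem (boxs a b)) X.
Proof. by apply: herm_sub => p pb; rewrite inE /= mem_boxs. Qed.

Lemma boxs_herm a b X : herm (mem (boxs a b)) X -> herm (box a b) X.
Proof. by apply: herm_sub => p; rewrite inE /= mem_boxs. Qed.

Variables (n m : nat) (d : R) (G0 : (I -> C) -> R).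
Hypothesis hG : herm (box n m.+1) G0.
Hypothesis d_gt0 : 0 < d.
Hypothesis G0co : coercive n m d G0.

(* The linear matrix inequality of the Kalman-Yakubovich-Popov lemma. *)
Definition lmi X := herm (box n m) X /\ forall x, 0 <= G0 x + X (sw x) - X x.

Lemma lmi_le_cost Y k x : lmi Y -> Y x <= \sum_(t < k) G0 (tw t x) + Y (tw k x).
Proof.
move=> [_ hY]; elim: k => [|k IH]; first by rewrite big_ord0 add0r tw0.
apply: le_trans IH _; rewrite big_ord_recr /= -addrA lerD2l -add1n -tw_add -swE.
by have := hY (tw k x); lra.
Qed.

Lemma lmi_le_free_cost Y x : lmi Y -> Y x <= free_cost m G0 x.
Proof.
move=> lY; have [hY _] := lY.
have -> : Y x = Y (trunc m x).
  by apply: (herm_ext hY) => p /andP[_ pm]; rewrite /trunc pm.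
apply: le_trans (lmi_le_cost m _ lY) _.
rewrite [X in _ + X](_ : _ = 0) ?addr0 // -(herm_at0 hY); congr (Y _).
by apply/funext => p; rewrite /tw /trunc /= ltnNge leq_addl.
Qed.

(** Summing the inequality along an optimal trajectory bounds [Y] by its cost. So every solution
    lies below all optimal costs, hence below their limit. *)
Lemma lmi_le_value Y k X x : lmi Y -> is_value n m G0 k X -> Y x <= X x.
Proof.
move=> lY [hX _ /(_ x) [x' [x'x ->]]]; have [hY _] := lY.
have -> : Y x = Y x' by apply: (herm_ext hY) => p /andP[_ pm]; rewrite x'x.
apply: le_trans (lmi_le_cost k _ lY) _.
by rewrite lerD2l; apply: lmi_le_free_cost.
Qed.

Lemma value_le k X X' x : is_value n m G0 k X -> is_value n m G0 k.+1 X' -> X' x <= X x.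
Proof.
move=> [_ _ /(_ x) [x' [x'x ->]]] [hX' X'le _].
rewrite -(cost_trunc hG k x'); apply: le_trans (X'le _).
have -> // : X' x = X' (trunc (m + k) x').
by apply: (herm_ext hX') => p /andP[_ pm]; rewrite /trunc ltn_addr // x'x.
Qed.

Lemma value_step k X X' x : is_value n m G0 k X -> is_value n m G0 k.+1 X' ->
  X' x <= G0 x + X (sw x).
Proof.
move=> [_ _ /(_ (sw x)) [y [yx ->]]] [hX' X'le _].
pose x' : I -> C := fun p => if p.2 is j.+1 then y (p.1, j) else x p.
have -> : X' x = X' x'.
  apply: (herm_ext hX') => -[i [|j]] //= /andP[_ /= jm].
  by rewrite /x' /= yx // ltnW.
apply: le_trans (X'le _) _; rewrite costS.
have -> : sw x' = y by apply/funext => -[].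
rewrite lerD2r le_eqVlt; apply/orP; left; apply/eqP.
by apply: (herm_ext hG) => -[i [|j]] //= /andP[_ /= jm]; rewrite /x' /= yx.
Qed.

Theorem riccati : exists X (l : 'I_n -> (I -> C) -> C),
  [/\ lmi X, (forall Y, lmi Y -> forall x, Y x <= X x),
      forall i, lin (box n m.+1) (l i),
      forall x, G0 x + X (sw x) - X x = \sum_(i < n) nsq (l i x) &
      forall x, exists x', (forall p, p.2 != m -> x' p = x p) /\ forall i, l i x' = 0].
Proof.
have [V hV] : exists V, forall k, is_value n m G0 k (V k).
  have H k := value_exists hG d_gt0 G0co k.
  by have [V hV] := choice H; exists V.
have V_ge k x : cost_bound m G0 x <= V k x.
  have [_ _ /(_ x) [x' [x'x ->]]] := hV k.
  apply: le_trans (cost_ge hG d_gt0 G0co _ _).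
  have -> : cost_bound m G0 x = cost_bound m G0 x'.
    by apply: (herm_ext (cost_bound_herm hG)) => p /andP[_ pm]; rewrite x'x.
  rewrite lerDl; apply: mulr_ge0; first exact: ltW.
  by apply: sumr_ge0 => t _; apply: sumr_ge0 => i _; exact: nsq_ge0.
have V_mono x k j : V (k + j)%N x <= V k x.
  elim: j => [|j IH]; rewrite ?addn0 // addnS.
  exact: le_trans (value_le x (hV _) (hV _)) IH.
have Vlim x : exists r : R, ucv (fun k => (V k x)%:C%C) r%:C%C.
  have [|l lE] := @ucv_ex R (fun k => (V k x)%:C%C) (`|V 0%N x| + `|cost_bound m G0 x|)%:C%C.
    move=> k; rewrite normc_def /= expr0n addr0 sqrtr_sqr lecR ler_norml.
    have := V_ge k x; have := V_mono x 0%N k; rewrite add0n.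
    have := ler_norm (V 0%N x); have := ler_norm (- cost_bound m G0 x); rewrite normrN.
    have := normr_ge0 (V 0%N x); have := normr_ge0 (cost_bound m G0 x).
    by move=> ? ? ? ? ? ?; apply/andP; split; lra.
  by have [E _] := ucv_real lE; exists (complex.Re l); rewrite -E.
have [X XV] := choice Vlim.
have hX : herm (box n m) X.
  apply: boxs_herm; apply: (herm_ucv (boxs_uniq n m) (Fk := V)) => [k|//].
  by apply: herm_boxs; have [] := hV k.
have XleV k x : X x <= V k x.
  by apply: (ucv_le (N := k) (XV x)) => j kj; rewrite -(subnKC kj).
have lX : lmi X.
  split=> // x; suff : X x - G0 x <= X (sw x) by lra.
  apply: (ucv_ge (XV _)) => k.
  have := XleV k.+1 x; have := value_step x (hV k) (hV k.+1); lra.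
have Xmax Y : lmi Y -> forall x, Y x <= X x.
  by move=> lY x; apply: (ucv_ge (XV _)) => k; apply: lmi_le_value (hV k).
pose W x := G0 x + X (sw x).
have hW : herm (box n m.+1) W by apply: hermD => //; exact: herm_sw.
have [|F [l [hF hl WE lz]]] := minimize_column d_gt0 hW.
  move=> x x0; rewrite /W.
  suff : d * \sum_(i < n) nsq (x (i : nat, m)) - G0 x <= X (sw x) by lra.
  apply: (ucv_ge (XV _)) => k.
  have [_ _ /(_ (sw x)) [y [yx ->]]] := hV k.
  pose x' : I -> C := fun p => if p.2 is j.+1 then y (p.1, j) else x p.
  have x'E p : (p.2 <= m)%N -> x' p = x p by case: p => i [|j] //= jm; rewrite /x' /= yx.
  have -> : G0 x = G0 x'.
    by apply: (herm_ext hG) => p /andP[_ pm]; rewrite x'E.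
  have := cost_ge hG d_gt0 G0co k.+1 x'; rewrite costS.
  have -> : sw x' = y by apply/funext => -[].
  rewrite (cost_bound0 hG) // => [|p pm]; last by rewrite x'E ?x0 // ltnW.
  rewrite big_ord_recl /= addn0 mulrDr add0r.
  have -> : \sum_(i < n) nsq (x' (i : nat, m)) = \sum_(i < n) nsq (x (i : nat, m)).
    by apply: eq_bigr => i _; rewrite x'E.
  set s := d * \sum_(t < k) _.
  suff : 0 <= s by lra.
  apply: mulr_ge0; first exact: ltW.
  by apply: sumr_ge0 => t _; apply: sumr_ge0 => i _; exact: nsq_ge0.
(* [F] is the Schur complement of [W]. No limit of Schur complements is taken: X <= F is the
   inequality satisfied by [X], evaluated where all [l i] vanish, and [F] satisfies the same
   inequality, so maximality of [X] gives F <= X. The defect is then exactly [n] squares. *)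
have XF y : X y <= F y.
  have [y' [y'y ly']] := lz y.
  have Ey Z : herm (box n m) Z -> Z y = Z y'.
    by move=> hZ; apply: (herm_ext hZ) => p /andP[_ pm]; rewrite y'y // ltn_eqF.
  rewrite (Ey X) // (Ey F) // -[F y']addr0.
  have <- : \sum_(i < n) nsq (l i y') = 0 by rewrite big1 // => i _; rewrite ly' nsq0.
  by rewrite -WE /W; have := lX.2 y'; lra.
have FX : F = X.
  apply/funext => x; apply/le_anti/andP; split; last exact: XF.
  apply: Xmax => {x}; split=> // x.
  have := XF (sw x); have := WE x; rewrite /W.
  have : 0 <= \sum_(i < n) nsq (l i x) by apply: sumr_ge0 => i _; exact: nsq_ge0.
  by lra.
by exists X, l; split=> // x; have := WE x; rewrite FX /W => ->; rewrite addrC addKr.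
Qed.

End Limit.

(** * Positivity of the second form at the largest solution *)

Section SplitPositive.
Variable R : realType.
Local Notation C := R[i].
Local Notation I := (nat * nat)%type.
Implicit Types (x y z : I -> C) (X Y : (I -> C) -> R).

Lemma cv0_telescope (a : nat -> R) (u : nat -> C) (e : R) : 0 < e ->
  (forall t, 0 <= a t) -> (forall t, e * nsq (u t) <= a t - a t.+1) -> cv0 u.
Proof.
move=> e0 a0 ua.
have ad t : a t.+1 <= a t.
  by rewrite -subr_ge0; apply: le_trans (ua t); rewrite mulr_ge0 ?nsq_ge0 // ltW.
have ac : cvgn a.
  apply: nonincreasing_is_cvgn; first by apply/nonincreasing_seqP.
  by exists 0 => _ [t _ <-].
move=> eps eps0; pose r := complex.Re eps.
have rE : r%:C%C = eps by apply: RRe_real; apply: gtr0_real.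
have r0 : 0 < r by rewrite -ltcR rE.
have h0 : 0 < e * r ^+ 2 / 2 by rewrite divr_gt0 // mulr_gt0 // exprn_gt0.
have /cvgrPdist_lt /(_ _ h0) [N _ HN] := ac.
exists N => k Nk; suff: nsq (u k) < r ^+ 2.
  rewrite -ltcR nsq_norm rmorphXn /= rE ltr_pXn2r // nnegrE //; exact: ltW.
rewrite -(ltr_pM2l e0); apply: le_lt_trans (ua k) _.
have := HN k Nk; have := HN k.+1 (leqW Nk); rewrite /= !ltr_norml.
by move=> /andP[? ?] /andP[? ?]; lra.
Qed.

Lemma lin_solve S (l : (I -> C) -> C) p x : lin S l -> l (unitv R p) != 0 ->
  exists v, l (fun r => x r + v * unitv R p r) = 0.
Proof.
move=> hl lp; exists (- l x / l (unitv R p)).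
by rewrite (lin_add _ _ _ hl) divfK // subrr.
Qed.

Lemma pfun_unitv n m c p : box n.+1 m.+1 p -> pfun n m c (unitv R p) = c p.1 p.2.
Proof.
move=> /andP[p1 p2]; rewrite /pfun (bigD1 (Ordinal p1)) //= (bigD1 (Ordinal p2)) //=.
rewrite /unitv; case: p p1 p2 => a b /= p1 p2; rewrite eqxx mulr1 !big1 ?addr0 //.
  move=> i ia; apply: big1 => j _; rewrite xpair_eqE.
  by rewrite -(inj_eq val_inj) in ia; rewrite (negbTE ia) mulr0.
move=> j jb; rewrite xpair_eqE eqxx /=.
by rewrite -(inj_eq val_inj) in jb; rewrite (negbTE jb) mulr0.
Qed.

Section Data.
Variables (n m : nat) (c : nat -> nat -> C) (G0 Q0 : (I -> C) -> R).
Hypothesis cst : stable n m c.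
Hypothesis base : split_form n m c G0 Q0.
Local Notation c' := (refl_coef n m c).

Lemma stable_row0 (w : C) : `|w| <= 1 -> \sum_(j < m.+1) c 0 j * w ^+ j != 0.
Proof.
move=> w1; have := @cst 0 w; rewrite normr0 ler01 => /(_ isT w1).
rewrite /pfun big_ord_recl [X in _ + X]big1 => [|i _]; last first.
  by apply: big1 => j _; rewrite /monom /= /bump /= expr0n mul0r mulr0.
by rewrite addr0; under eq_bigr => j _ do rewrite /monom expr0 mul1r.
Qed.

(** Each column is column [m] of at most one window, so half of the energy bound pays for the
    penalty. *)
Lemma coercive_penalty d : 0 < d -> coercive n m d G0 ->
  coercive n m (d / 2) (fun x => G0 x - d / 2 * \sum_(i < n) nsq (x (i : nat, m))).
Proof.
move=> d0 co K x x0; have := co K x x0.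
rewrite big_split /= sumrN -big_distrr /=.
pose f t := \sum_(i < n) nsq (x (i : nat, t)).
have f0 t : 0 <= f t by apply: sumr_ge0 => i _; exact: nsq_ge0.
have : \sum_(t < K) f (m + t)%N <= \sum_(t < K) f t.
  apply: (@le_trans _ _ (\sum_(t < m + K) f t)).
    by rewrite big_split_ord lerDr sumr_ge0.
  rewrite addnC big_split_ord /= [X in _ + X]big1 ?addr0 // => t _.
  by apply: big1 => i _; rewrite x0 ?nsq0 //= leq_addr orbT.
have -> : \sum_(t < K) f (m + t)%N = \sum_(t < K) \sum_(i < n) nsq (tw t x (i : nat, m)).
  by [].
rewrite -/(f _); set s1 := \sum_(t < K) _; set s2 := \sum_(t < K) _; set s3 := \sum_(t < K) _.
move=> h1 h2; have : d / 2 * s1 <= d / 2 * s2 by rewrite ler_pM2l // divr_gt0.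
lra.
Qed.

(* Penalizing the control shows that the optimal trajectories decay. Along the one
   on which also the reflected polynomial vanishes, [Q0 + X - X sz] decreases by
   squares to [0]. *)
Theorem split_positive : exists X (l : 'I_n -> (I -> C) -> C),
  [/\ lmi n m G0 X, (forall Y, lmi n m G0 Y -> forall x, Y x <= X x),
      forall i, lin (box n m.+1) (l i),
      forall x, G0 x + X (sw x) - X x = \sum_(i < n) nsq (l i x) &
      forall x, 0 <= Q0 x + X x - X (sz x)].
Proof.
have [hG hQ id] := base.
have [d d0 co] := energy_coercive cst base.
have [X [l [lX Xmax hl Xl lz]]] := riccati hG d0 co.
exists X, l; split=> //.
have d20 : 0 < d / 2 by rewrite divr_gt0.
have hG' : herm (box n m.+1) (fun x => G0 x - d / 2 * \sum_(i < n) nsq (x (i : nat, m))).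
  apply: hermB => //; apply: hermZ; apply: herm_sum => i _; apply: herm_nsq.
  by apply: lin_coord; rewrite /box /= ltn_ord ltnSn.
(* Along a trajectory with all [l i] zero, [X - Y] is nonnegative and drops at each step by at least
   the penalty, which forces the rows below [n] to decay. *)
have [Y [_ [[hY lY] _ _ _ _]]] := riccati hG' d20 (coercive_penalty d0 co).
have lY' : lmi n m G0 Y.
  split=> // x; have := lY x.
  suff : 0 <= d / 2 * \sum_(i < n) nsq (x (i : nat, m)) by lra.
  by apply: mulr_ge0; [exact: ltW|apply: sumr_ge0 => i _; exact: nsq_ge0].
have [hX _] := lX.
have hP' := pfun_lin n m c'.
pose Phi x := (forall i, l i x = 0) /\ pfun n m c' x = 0.
move=> x0.
have [x y xy [lx Px]|x|x [xx0 xP]] := @trajectory R m Phi _ _ x0.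
- split=> [i|].
    by rewrite -(lx i); apply/esym/(lin_ext (hl i)) => p /andP[_ pm]; exact: xy.
  by rewrite -Px; apply/esym/(lin_ext hP') => p /andP[_ pm]; exact: xy.
- have [x1 [x1x lx1]] := lz x.
  (* The forms [l i] see only rows below [n], so the entry at (n, m) is free to solve the reflected
     equation. Its coefficient there is the conjugate of [c 0 0], nonzero by stability. *)
  have [|v Pv] := @lin_solve _ _ (n, m) x1 hP'.
    rewrite pfun_unitv /box /= ?ltnSn // /refl_coef !subnn conjC_eq0.
    have := stable_row0 (w := 0); rewrite normr0 ler01 => /(_ isT).
    rewrite big_ord_recl expr0 mulr1 big1 ?addr0 // => j _.
    by rewrite lift0 expr0n mulr0.
  exists (fun r => x1 r + v * unitv R (n, m) r); split=> [p pm|].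
    by rewrite x1x // /unitv; case: (p =P (n, m)) pm => [->|_ _]; rewrite ?eqxx // mulr0 addr0.
  split=> // i; rewrite -(lx1 i); apply: (lin_ext (hl i)) => p /andP[pn _].
  by rewrite /unitv; case: (p =P (n, m)) pn => [->|_ _]; rewrite ?ltnn // mulr0 addr0.
have xl t i : l i (tw t x) = 0 by have [] := xP t.
have xp t : pfun n m c' (tw t x) = 0 by have [] := xP t.
have stab i : (i < n)%N -> cv0 (fun t => x (i, t)).
  move=> iN; apply: (@cv0_unshift R (fun t => x (i, t)) m).
  apply: (@cv0_telescope (fun t => X (tw t x) - Y (tw t x)) _ (d / 2) d20) => t.
    by rewrite subr_ge0; exact: Xmax.
  have := Xl (tw t x); rewrite big1 => [|j _]; last by rewrite xl nsq0.
  have := lY (tw t x).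
  rewrite swE tw_add add1n (bigD1 (Ordinal iN)) //= mulrDr.
  have -> : tw t x (i, m) = x (i, (m + t)%N) by [].
  set s := \sum_(j < n | _) _.
  have : 0 <= d / 2 * s.
    by apply: mulr_ge0; [exact: ltW|apply: sumr_ge0 => j _; exact: nsq_ge0].
  set u := d / 2 * s; set v := d / 2 * nsq _; lra.
(* Row [n] of the reflected coefficients is the reversal of the stable row [c 0]; the other rows
   contribute a forcing term that already decays. *)
have stabn : cv0 (fun t => x (n, t)).
  apply: (@revpoly_decay R m (c 0) stable_row0).
  pose h (i : 'I_n) (j : 'I_m.+1) t := - c' i j * x (i : nat, (j + t)%N).
  apply: (@eq_cv0 _ (fun t => \sum_(i < n) \sum_(j < m.+1) h i j t)); last first.
    apply: cv0_sum => i _; apply: cv0_sum => j _; apply: cv0Z.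
    by apply: (@cv0_shift _ (fun t => x (i : nat, t))); exact: stab.
  move=> t; have := xp t; rewrite /pfun big_ord_recr /= => /eqP.
  rewrite addrC addr_eq0 => /eqP E.
  transitivity (\sum_(j < m.+1) c' n j * tw t x (n, j : nat)).
    rewrite E -sumrN; apply: eq_bigr => i _; rewrite -sumrN; apply: eq_bigr => j _.
    by rewrite /h mulNr.
  by apply: eq_bigr => j _; rewrite /refl_coef subnn /tw /= addnC.
pose Q x := Q0 x + X x - X (sz x).
have hQ' : herm (box n.+1 m) Q.
  apply: hermB; first apply: hermD => //.
    by apply: herm_sub hX => p /andP[p1 p2]; apply/andP; split=> //; exact: ltnW.
  by apply: herm_comp hX => p /andP[p1 p2]; rewrite /box /= ltnS p1.
have -> : Q0 x0 + X x0 - X (sz x0) = Q (tw 0 x).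
  by rewrite tw0; apply: (herm_ext hQ') => p /andP[_ pm]; rewrite xx0.
apply: (@cv0_nonneg R (fun t => Q (tw t x))).
  (* The split identity at [y] and the equations of [X] at [y] and [sz y] give: [Q y - Q (sw y)] is
     |P y|^2 plus the sum of the |l i (sz y)|^2. *)
  move=> t; rewrite -add1n -tw_add -swE; set y := tw t x.
  have := id y; rewrite xp nsq0 subr0.
  have := Xl y; rewrite big1 => [|i _]; last by rewrite xl nsq0.
  have := Xl (sz y).
  have : 0 <= \sum_(i < n) nsq (l i (sz y)) by apply: sumr_ge0 => i _; exact: nsq_ge0.
  have := nsq_ge0 (pfun n m c y).
  rewrite /Q (_ : sw (sz y) = sz (sw y)) //.
  by set s := \sum_(i < n) _; move: (nsq _) => r ? ? ? ? ?; lra.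
apply: (herm_cv0 hQ') => -[i j] /andP[/= iN _].
apply: (eq_cv0 (u := fun t => x (i, (j + t)%N))) => //.
apply: (@cv0_shift _ (fun t => x (i, t))).
by move: iN; rewrite ltnS leq_eqVlt => /orP[/eqP ->|]; [exact: stabn|exact: stab].
Qed.

End Data.
End SplitPositive.

(** * Sums of squares for stable polynomials *)

Section BaseForm.
Variable R : realType.
Local Notation C := R[i].
Local Notation I := (nat * nat)%type.
Implicit Types (x y z : I -> C) (X Y : (I -> C) -> R).

(** Complex-valued forms allow dividing one monomial at a time; taking real parts at the end yields
    a Hermitian form. *)
Definition sesq (S : pred I) (g : (I -> C) -> C) := exists L : seq (C * I * I),
  (forall a, a \in L -> S a.1.2 /\ S a.2) /\
  forall x, g x = \sum_(a <- L) a.1.1 * x a.1.2 * (x a.2)^*.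

Lemma sesq_Re S g : sesq S g -> herm S (fun x => complex.Re (g x)).
Proof.
move=> [L [LS gE]].
exists ([seq (a.1.1 / 2, a.1.2, a.2) | a <- L] ++
        [seq ((a.1.1)^* / 2, a.2, a.1.2) | a <- L]); split=> [a|x].
  by rewrite mem_cat => /orP[] /mapP [b /LS [b1 b2] ->].
rewrite big_cat !big_map /= ReJ_add.
have -> : (g x)^*%C = (g x)^* by [].
rewrite mulrDl; congr (_ + _); rewrite gE ?rmorph_sum big_distrl; apply: eq_bigr => a _ /=.
  by ring.
by rewrite !rmorphM /= conjCK; ring.
Qed.

Lemma sesq_sum S (T : Type) (s : seq T) (P : pred T) (g : T -> (I -> C) -> C) :
  (forall t, P t -> sesq S (g t)) -> sesq S (fun x => \sum_(t <- s | P t) g t x).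
Proof.
move=> gs; elim: s => [|t s [L [LS LE]]].
  by exists [::]; split=> // x; rewrite !big_nil.
have [Pt|Pt] := boolP (P t); last first.
  by exists L; split=> // x; rewrite big_cons (negbTE Pt).
have [L' [LS' LE']] := gs t Pt; exists (L' ++ L); split=> [a|x].
  by rewrite mem_cat => /orP[/LS'|/LS].
by rewrite big_cons Pt big_cat /= LE' LE.
Qed.

Lemma sesq_mono (S : pred I) (c : C) p r : S p -> S r -> sesq S (fun x => c * x p * (x r)^*).
Proof.
move=> Sp Sr; exists [:: (c, p, r)]; split=> [a|x]; first by rewrite inE => /eqP ->.
by rewrite big_seq1.
Qed.

Lemma sesqD S g h : sesq S g -> sesq S h -> sesq S (fun x => g x + h x).
Proof.
move=> [L [LS LE]] [L' [LS' LE']]; exists (L ++ L'); split=> [a|x].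
  by rewrite mem_cat => /orP[/LS|/LS'].
by rewrite big_cat /= LE' LE.
Qed.

Lemma sesqZ S (c : C) g : sesq S g -> sesq S (fun x => c * g x).
Proof.
move=> [L [LS LE]]; exists [seq (c * a.1.1, a.1.2, a.2) | a <- L]; split=> [a|x].
  by case/mapP => b /LS Sb ->.
by rewrite big_map LE big_distrr; apply: eq_bigr => a _; rewrite /= !mulrA.
Qed.

(* The quotient of [z^a z'^b - z^(N - b) z'^(N - a)] by [1 - z z'], where [f]
   replaces the monomials; one of the two sums is empty. *)
Definition tel N a b (f : nat -> nat -> C) : C :=
  \sum_(s < N - (a + b)) f (a + s)%N (b + s)%N
  - \sum_(s < a + b - N) f (N - b + s)%N (N - a + s)%N.

Lemma telE N a b (f : nat -> nat -> C) : (a <= N)%N -> (b <= N)%N ->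
  tel N a b f - tel N a b (fun i j => f i.+1 j.+1) = f a b - f (N - b)%N (N - a)%N.
Proof.
move=> aN bN.
have H k (h : nat -> C) : \sum_(s < k) h s - \sum_(s < k) h s.+1 = h 0%N - h k.
  by rewrite -sumrB -(big_mkord xpredT (fun s => h s - h s.+1)) -opprB
    -telescope_sumr // -sumrN; apply: eq_bigr => s _; rewrite opprB.
have H1 := H (N - (a + b))%N (fun s => f (a + s)%N (b + s)%N).
have H2 := H (a + b - N)%N (fun s => f (N - b + s)%N (N - a + s)%N).
have -> : tel N a b f - tel N a b (fun i j => f i.+1 j.+1) =
   (f (a + 0)%N (b + 0)%N - f (a + (N - (a + b)))%N (b + (N - (a + b)))%N)
  - (f (N - b + 0)%N (N - a + 0)%N - f (N - b + (a + b - N))%N (N - a + (a + b - N))%N).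
  rewrite -H1 -H2 /tel.
  have E1 : \sum_(s < N - (a + b)) f (a + s.+1)%N (b + s.+1)%N =
            \sum_(s < N - (a + b)) f (a + s).+1 (b + s).+1.
    by apply: eq_bigr => s _; rewrite !addnS.
  have E2 : \sum_(s < a + b - N) f (N - b + s.+1)%N (N - a + s.+1)%N =
            \sum_(s < a + b - N) f (N - b + s).+1 (N - a + s).+1.
    by apply: eq_bigr => s _; rewrite !addnS.
  rewrite E1 E2.
  by ring.
rewrite !addn0; have [ab|ab] := leqP (a + b) N.
  have -> : (a + b - N = 0)%N by lia.
  rewrite !addn0 subrr subr0; congr (_ - f _ _); lia.
have -> : (N - (a + b) = 0)%N by lia.
rewrite !addn0 subrr sub0r opprB; congr (f _ _ - _); lia.
Qed.

Lemma tel_sesq (S : pred I) N a b (c : C) (pq : nat -> nat -> I * I) : (a <= N)%N -> (b <= N)%N ->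
  (forall i j, (i < N)%N -> (j < N)%N -> S (pq i j).1 /\ S (pq i j).2) ->
  sesq S (fun x => tel N a b (fun i j => c * x (pq i j).1 * (x (pq i j).2)^*)).
Proof.
move=> aN bN Spq; apply: sesqD; first apply: sesq_sum => s _.
  have sN := ltn_ord s; have [||S1 S2] := Spq (a + s)%N (b + s)%N; try lia.
  exact: sesq_mono.
rewrite (_ : (fun x => _) = (fun x => -1 * \sum_(s < a + b - N)
  c * x (pq (N - b + s)%N (N - a + s)%N).1 * (x (pq (N - b + s)%N (N - a + s)%N).2)^*)).
  apply: sesqZ; apply: sesq_sum => s _.
  have sN := ltn_ord s; have [||S1 S2] := Spq (N - b + s)%N (N - a + s)%N; try lia.
  exact: sesq_mono.
by apply/funext => x; rewrite mulN1r.
Qed.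

Lemma pfun_nsq n m (c : nat -> nat -> C) x : (nsq (pfun n m c x))%:C%C =
  \sum_(i < n.+1) \sum_(j < m.+1) \sum_(k < n.+1) \sum_(l < m.+1)
    (c i j * (c k l)^*) * x (i : nat, j : nat) * (x (k : nat, l : nat))^*.
Proof.
rewrite nsqE /pfun big_distrl; apply: eq_bigr => i _ /=.
rewrite big_distrl; apply: eq_bigr => j _ /=.
rewrite rmorph_sum big_distrr; apply: eq_bigr => k _ /=.
rewrite rmorph_sum big_distrr; apply: eq_bigr => l _ /=.
by rewrite rmorphM; ring.
Qed.

Lemma pfun_refl_nsq n m (c : nat -> nat -> C) x :
  (nsq (pfun n m (refl_coef n m c) x))%:C%C =
  \sum_(i < n.+1) \sum_(j < m.+1) \sum_(k < n.+1) \sum_(l < m.+1)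
    (c i j * (c k l)^*) * x ((n - k)%N, (m - l)%N) * (x ((n - i)%N, (m - j)%N))^*.
Proof.
have sn N (i : 'I_N.+1) : (N - (N.+1 - i.+1) = i)%N by rewrite subSS subKn // -ltnS ltn_ord.
rewrite pfun_nsq.
transitivity (\sum_(k < n.+1) \sum_(l < m.+1) \sum_(i < n.+1) \sum_(j < m.+1)
  (c i j * (c k l)^*) * x ((n - k)%N, (m - l)%N) * (x ((n - i)%N, (m - j)%N))^*).
  rewrite (reindex_inj rev_ord_inj); apply: eq_bigr => k _ /=.
  rewrite (reindex_inj rev_ord_inj); apply: eq_bigr => l _ /=.
  rewrite (reindex_inj rev_ord_inj); apply: eq_bigr => i _ /=.
  rewrite (reindex_inj rev_ord_inj); apply: eq_bigr => j _ /=.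
  by rewrite /refl_coef !sn !subSS conjCK [c i j * _]mulrC.
transitivity (\sum_(k < n.+1) \sum_(i < n.+1) \sum_(l < m.+1) \sum_(j < m.+1)
  (c i j * (c k l)^*) * x ((n - k)%N, (m - l)%N) * (x ((n - i)%N, (m - j)%N))^*).
  by apply: eq_bigr => k _; rewrite exchange_big.
rewrite exchange_big; apply: eq_bigr => i _ /=.
transitivity (\sum_(k < n.+1) \sum_(j < m.+1) \sum_(l < m.+1) 
  (c i j * (c k l)^*) * x ((n - k)%N, (m - l)%N) * (x ((n - i)%N, (m - j)%N))^*).
  by apply: eq_bigr => k _; rewrite exchange_big.
by rewrite exchange_big.
Qed.

(** Each monomial of |P|^2 has a counterpart in |P~|^2 with the same coefficient. Passing to it by
    reflecting first the z-exponents and then the w-exponents gives differences divisible by 1 -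
    |z|^2 and by 1 - |w|^2. *)
Theorem split_form_exists n m c : exists G0 Q0, @split_form R n m c G0 Q0.
Proof.
pose g x := \sum_(i < n.+1) \sum_(j < m.+1) \sum_(k < n.+1) \sum_(l < m.+1)
  tel n i k (fun u v => (c i j * (c k l)^*) * x (u, j : nat) * (x (v, l : nat))^*).
pose h x := \sum_(i < n.+1) \sum_(j < m.+1) \sum_(k < n.+1) \sum_(l < m.+1)
  tel m j l (fun u v => (c i j * (c k l)^*) * x ((n - k)%N, u) * (x ((n - i)%N, v))^*).
have ordle N (i : 'I_N.+1) : (i <= N)%N by rewrite -ltnS.
exists (fun x => complex.Re (g x)), (fun x => complex.Re (h x)); split.
- apply: sesq_Re; do 4 (apply: sesq_sum => ? _).
  apply: (@tel_sesq _ _ _ _ _ (fun u v => ((u, _), (v, _)))) => // u v un vn.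
  by rewrite /box /= un vn !ltn_ord.
- apply: sesq_Re; do 4 (apply: sesq_sum => ? _).
  apply: (@tel_sesq _ _ _ _ _ (fun u v => ((_, u), (_, v)))) => // u v un vn.
  by rewrite /box /= un vn !ltnS !leq_subr.
move=> x; apply: (@complexI R).
have gh : (g x - g (sz x)) + (h x - h (sw x)) =
  (nsq (pfun n m c x))%:C%C - (nsq (pfun n m (refl_coef n m c) x))%:C%C.
  rewrite pfun_nsq pfun_refl_nsq /g /h -!sumrB -big_split; apply: eq_bigr => i _ /=.
  rewrite -!sumrB -big_split; apply: eq_bigr => j _ /=.
  rewrite -!sumrB -big_split; apply: eq_bigr => k _ /=.
  rewrite -!sumrB -big_split; apply: eq_bigr => l _ /=.
  rewrite (telE (fun u v => c i j * (c k l)^* * x (u, j : nat) * (x (v, l : nat))^*)) //.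
  rewrite (telE (fun u v => c i j * (c k l)^* * x ((n - k)%N, u) * (x ((n - i)%N, v))^*)) //.
  by rewrite addrA subrK.
apply/eqP; rewrite eq_complex; apply/andP; split; apply/eqP => //.
have := congr1 (@complex.Re R) gh; rewrite !raddfD !raddfN /=.
by [].
Qed.

End BaseForm.

(** * Exchange of the two variables *)

Section StableSplit.
Variable R : realType.
Local Notation C := R[i].
Local Notation I := (nat * nat)%type.
Implicit Types (x y z : I -> C) (X Y : (I -> C) -> R).

(** Transposition alone would turn the second inequality for [X] into the first one for [- X], and
    so compare a largest with a smallest solution. Reversing the array changes the sign of the shift
    differences; interchanging the polynomial and its reflection compensates it. *)
Definition flip (a b : nat) x : I -> C := fun p => (x ((a - p.2)%N, (b - p.1)%N))^*.

Lemma pfun_flip n m (c : nat -> nat -> C) x :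
  pfun n m c (flip m n x) = (pfun m n (fun i j => (c (n - j)%N (m - i)%N)^*) x)^*.
Proof.
have sn N (i : 'I_N.+1) : (N - (N.+1 - i.+1) = i)%N by rewrite subSS subKn // -ltnS ltn_ord.
rewrite /pfun rmorph_sum /= exchange_big (reindex_inj rev_ord_inj); apply: eq_bigr => j _ /=.
rewrite rmorph_sum (reindex_inj rev_ord_inj); apply: eq_bigr => i _ /=.
by rewrite /flip /= !sn !subSS rmorphM /= conjCK.
Qed.

Lemma split_form_flip n m c (G0 Q0 : (I -> C) -> R) : split_form n m c G0 Q0 ->
  split_form m n (fun i j => c j i) (fun x => Q0 (sw (flip m n x))) (fun x => G0 (sz (flip m n x))).
Proof.
move=> [hG hQ id]; split.
- apply: (@herm_compJ R (box n.+1 m) _ Q0 (fun p => (m - p.2.+1, n - p.1)%N)) hQ => -[i j] /andP[/= p1 p2].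
  by rewrite /box /= ltnS leq_subr andbT; lia.
- apply: (@herm_compJ R (box n m.+1) _ G0 (fun p => (m - p.2, n - p.1.+1)%N)) hG => -[i j] /andP[/= p1 p2].
  by rewrite /box /= ltnS leq_subr /=; lia.
move=> x.
have -> : Q0 (sw (flip m n (sz x))) = Q0 (flip m n x).
  apply: (herm_ext hQ) => -[i j] /andP[/= p1 p2].
  by rewrite /sw /flip /sz /=; congr (x (_, _))^*; lia.
have -> : G0 (sz (flip m n (sw x))) = G0 (flip m n x).
  apply: (herm_ext hG) => -[i j] /andP[/= p1 p2].
  by rewrite /sw /flip /sz /=; congr (x (_, _))^*; lia.
have := id (flip m n x); rewrite !pfun_flip !nsqJ.
have -> : pfun m n (fun i j => (c (n - j)%N (m - i)%N)^*) x =
          pfun m n (refl_coef m n (fun i j => c j i)) x by [].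
have -> : pfun m n (fun i j => (refl_coef n m c (n - j) (m - i))^*) x =
          pfun m n (fun i j => c j i) x.
  apply: eq_bigr => i _; apply: eq_bigr => j _.
  by rewrite /refl_coef conjCK !subKn // -ltnS.
lra.
Qed.

Lemma stable_flip n m (c : nat -> nat -> C) : stable n m c -> stable m n (fun i j => c j i).
Proof.
move=> cst z w z1 w1; have := cst w z w1 z1; apply: contra_neq.
rewrite /pfun exchange_big => E; rewrite -[RHS]E.
by apply: eq_bigr => i _; apply: eq_bigr => j _; rewrite /monom /= [w ^+ _ * _]mulrC.
Qed.

(* The largest solutions of the inequalities [G0 + X sw - X >= 0] and
   [Q0 + X - X sz >= 0] each solve the other one, hence they coincide; so both
   forms are sums of the minimal number of squares. *)
Theorem stable_sos n m (c : nat -> nat -> C) : stable n m c ->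
  exists (A : 'I_n -> (I -> C) -> C) (B : 'I_m -> (I -> C) -> C),
  [/\ forall i, lin (box n m.+1) (A i), forall j, lin (box n.+1 m) (B j) &
    forall x, nsq (pfun n m c x) - nsq (pfun n m (refl_coef n m c) x) =
      (\sum_(i < n) nsq (A i x) - \sum_(i < n) nsq (A i (sz x))) +
      (\sum_(j < m) nsq (B j x) - \sum_(j < m) nsq (B j (sw x)))].
Proof.
move=> cst; have [G0 [Q0 base]] := split_form_exists n m c.
have [hG hQ id] := base.
have [X1 [A [l1 X1max hA A1 Q1]]] := split_positive cst base.
have [X' [l' [[hX' _] X'max hl' l'E Q']]] :=
  split_positive (stable_flip cst) (split_form_flip base).
have [hX1 _] := l1.
(* The analogue of [flip] on the smaller box [box n m] of the solutions; it makes [X'] comparable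
   with [X1]. *)
pose T y : I -> C := fun p => (y ((n - p.2.+1)%N, (m - p.1.+1)%N))^*.
pose X2 y := X' (T y).
have hX2 : herm (box n m) X2.
  by apply: (herm_compJ _ hX') => -[i j] /andP[/= p1 p2]; rewrite /box /=; lia.
have l2 : lmi n m G0 X2.
  split=> // x.
  pose z : I -> C := fun p => (x ((n - p.2.+1)%N, (m - p.1)%N))^*.
  have := Q' z.
  have -> : G0 (sz (flip m n z)) = G0 x.
    apply: (herm_ext hG) => -[i j] /andP[/= p1 p2].
    rewrite /sz /flip /z /= conjCK; congr (x (_, _)); lia.
  have -> : X' z = X2 (sw x).
    apply: (herm_ext hX') => -[i j] /andP[/= p1 p2].
    by rewrite /z /T /sw /=; congr (x (_, _))^*; lia.
  by have -> : X' (sz z) = X2 x by [].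
have X2max Y : herm (box n m) Y -> (forall x, 0 <= Q0 x + Y x - Y (sz x)) ->
    forall x, Y x <= X2 x.
  move=> hY QY x.
  pose T' u : I -> C := fun p => (u ((m - p.2.+1)%N, (n - p.1.+1)%N))^*.
  have lY' : lmi m n (fun x => Q0 (sw (flip m n x))) (fun u => Y (T' u)).
    split=> [|u].
      by apply: (herm_compJ _ hY) => -[i j] /andP[/= p1 p2]; rewrite /box /=; lia.
    have := QY (sw (flip m n u)).
    have -> : Y (sw (flip m n u)) = Y (T' (sw u)).
      apply: (herm_ext hY) => -[i j] /andP[/= p1 p2].
      by rewrite /T' /sw /flip /=; congr (u (_, _))^*; lia.
    by have -> : Y (sz (sw (flip m n u))) = Y (T' u) by [].
  have -> : Y x = Y (T' (T x)).
    apply: (herm_ext hY) => -[i j] /andP[/= p1 p2].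
    rewrite /T' /T /= conjCK; congr (x (_, _)); lia.
  exact: (X'max _ lY').
have XE x : X1 x = X2 x.
  by apply/le_anti/andP; split; [exact: X2max|exact: X1max].
pose W x : I -> C := fun p => (x ((n - p.2)%N, (m - p.1.+1)%N))^*.
exists A, (fun j x => (l' j (W x))^*); split=> //.
  move=> j; apply: (lin_compJ _ (hl' j)) => -[a b] /andP[/= p1 p2].
  by rewrite /box /=; lia.
have B1 x : Q0 x + X1 x - X1 (sz x) = \sum_(j < m) nsq (l' j (W x))^*.
  under eq_bigr => j _ do rewrite nsqJ.
  rewrite -l'E !XE.
  have -> : Q0 (sw (flip m n (W x))) = Q0 x.
    apply: (herm_ext hQ) => -[i j] /andP[/= p1 p2].
    rewrite /sw /flip /W /= conjCK; congr (x (_, _)); lia.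
  have -> : X' (sw (W x)) = X2 x by [].
  have -> // : X' (W x) = X2 (sz x).
  apply: (herm_ext hX') => -[i j] /andP[/= p1 p2].
  by rewrite /W /T /sz /=; congr (x (_, _))^*; lia.
move=> x; rewrite -id -!B1 -!A1 (_ : sw (sz x) = sz (sw x)) //; lra.
Qed.

End StableSplit.

(** * From the closed to the open bidisk *)

Section Dilation.
Variable R : realType.
Local Notation C := R[i].
Local Notation I := (nat * nat)%type.
Implicit Types (x y z : I -> C).

Lemma lin_at0 S (l : (I -> C) -> C) : lin S l -> l (fun=> 0) = 0.
Proof. by move=> [L [_ lE]]; rewrite lE big1 // => a _; rewrite mulr0. Qed.

Lemma sz_unitv i j : sz (unitv R (i.+1, j)) = unitv R (i, j).
Proof. by apply/funext => -[a b]; rewrite /sz /unitv /= !xpair_eqE eqSS. Qed.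

Lemma sw_unitv i j : sw (unitv R (i, j.+1)) = unitv R (i, j).
Proof. by apply/funext => -[a b]; rewrite /sw /unitv /= !xpair_eqE eqSS. Qed.

Lemma sz_unitv0 j : sz (unitv R (0, j)%N) = fun=> 0.
Proof. by apply/funext => -[a b]; rewrite /sz /unitv; case: eqP => // -[]. Qed.

Lemma sw_unitv0 i : sw (unitv R (i, 0)%N) = fun=> 0.
Proof. by apply/funext => -[a b]; rewrite /sw /unitv; case: eqP => // -[]. Qed.

Definition is_sos n m (c : nat -> nat -> C) (A : 'I_n -> (I -> C) -> C)
    (B : 'I_m -> (I -> C) -> C) :=
  [/\ forall i, lin (box n m.+1) (A i), forall j, lin (box n.+1 m) (B j) &
    forall x, nsq (pfun n m c x) - nsq (pfun n m (refl_coef n m c) x) =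
      (\sum_(i < n) nsq (A i x) - \sum_(i < n) nsq (A i (sz x))) +
      (\sum_(j < m) nsq (B j x) - \sum_(j < m) nsq (B j (sw x)))].

(* The identity at unit vectors bounds the coefficients recursively. *)
Lemma sos_bound n m c A B (M : R) : @is_sos n m c A B ->
  (forall i j, (i <= n)%N -> (j <= m)%N -> nsq (c i j) <= M) ->
  forall i j, (i <= n)%N -> (j <= m)%N ->
  \sum_(k < n) nsq (A k (unitv R (i, j))) + \sum_(k < m) nsq (B k (unitv R (i, j)))
    <= M * 3 ^+ (i + j).
Proof.
move=> [hA hB id] cM.
have M0 : 0 <= M by apply: le_trans (nsq_ge0 _) (cM 0%N 0%N isT isT).
pose g p := \sum_(k < n) nsq (A k (unitv R p)).
pose h p := \sum_(k < m) nsq (B k (unitv R p)).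
have g0 p : 0 <= g p by apply: sumr_ge0 => k _; exact: nsq_ge0.
have h0 p : 0 <= h p by apply: sumr_ge0 => k _; exact: nsq_ge0.
move=> i j; have [s] := ubnP (i + j); elim: s i j => // s IH i j ijs iN jm.
rewrite -/(g (i, j)) -/(h (i, j)).
pose gi : R := if i is i'.+1 then g (i', j) else 0.
pose hj : R := if j is j'.+1 then h (i, j') else 0.
have := id (unitv R (i, j)).
rewrite pfun_unitv ?/box /= ?ltnS ?iN ?jm //.
have := nsq_ge0 (pfun n m (refl_coef n m c) (unitv R (i, j))).
have := cM i j iN jm.
have ge1 k : 1 <= 3 ^+ k :> R by rewrite exprn_ege1 // ler1n.
have Mge k : M <= M * 3 ^+ k by rewrite ler_peMr.
have -> : \sum_(k < n) nsq (A k (unitv R (i, j))) = g (i, j) by [].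
have -> : \sum_(k < m) nsq (B k (unitv R (i, j))) = h (i, j) by [].
have -> : \sum_(k < n) nsq (A k (sz (unitv R (i, j)))) = gi.
  rewrite /gi; case: (i) => [|i']; last by rewrite sz_unitv.
  by rewrite sz_unitv0 big1 // => k _; rewrite (lin_at0 (hA k)) nsq0.
have -> : \sum_(k < m) nsq (B k (sw (unitv R (i, j)))) = hj.
  rewrite /hj; case: (j) => [|j']; last by rewrite sw_unitv.
  by rewrite sw_unitv0 big1 // => k _; rewrite (lin_at0 (hB k)) nsq0.
(* Each of the two preceding terms is at most M 3^t, and M + 2 M 3^t <= M 3^(t+1); hence the base
   3. *)
have H1 : gi <= (if (i + j)%N is t.+1 then M * 3 ^+ t else 0).
  rewrite /gi; case: (i) ijs iN => [|i'] ijs' iN'; first by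
    rewrite add0n; case: (j) => // t; rewrite mulr_ge0 ?exprn_ge0 ?ler0n.
  have := IH i' j ijs' (ltnW iN') jm; rewrite -/(g _) -/(h _) addSn; have := h0 (i', j); lra.
have H2 : hj <= (if (i + j)%N is t.+1 then M * 3 ^+ t else 0).
  rewrite /hj; case: (j) ijs jm => [|j'] ijs' jm'; first by
    rewrite addn0; case: (i) => // t; rewrite mulr_ge0 ?exprn_ge0 ?ler0n.
  rewrite addnS in ijs' *.
  have := IH i j' ijs' iN (ltnW jm'); rewrite -/(g _) -/(h _); have := g0 (i, j'); lra.
clearbody gi hj.
case: (i + j)%N H1 H2 => [|t] H1 H2 h1 h2 h3; first by rewrite expr0; lra.
rewrite exprS mulrCA; have := Mge t; lra.
Qed.

Lemma stable_dilate n m (c : nat -> nat -> C) (r : C) : `|r| < 1 ->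
  (forall z w : C, `|z| < 1 -> `|w| < 1 -> pfun n m c (monom z w) != 0) ->
  stable n m (fun i j => c i j * r ^+ (i + j)).
Proof.
move=> r1 cn z w z1 w1.
have H (u : C) : `|u| <= 1 -> `|r * u| < 1.
  by move=> u1; rewrite normrM; apply: le_lt_trans r1; rewrite ler_piMr.
have := cn _ _ (H z z1) (H w w1); apply: contra_neq => E; rewrite -[RHS]E.
apply: eq_bigr => i _; apply: eq_bigr => j _.
by rewrite /monom /= !exprMn exprD; ring.
Qed.

Lemma norm_le_of_nsq (u : C) (M : R) : nsq u <= M -> `|u| <= (M + 1)%:C%C.
Proof.
move=> uM; have M0 : 0 <= M by apply: le_trans uM; exact: nsq_ge0.
rewrite -(@ler_pXn2r _ 2) ?nnegrE ?normr_ge0 // ?lecR; last by exact: addr_ge0.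
rewrite -nsq_norm -rmorphXn /= lecR; apply: le_trans uM _; rewrite expr2.
by have := mulr_ge0 M0 M0; lra.
Qed.

(** The number of squares and the bound on their coefficients do not depend on the dilation, so the
    coefficients have limits as the radius tends to 1, and the identity persists. *)
Theorem nonvanishing_sos n m (c : nat -> nat -> C) :
  (forall z w : C, `|z| < 1 -> `|w| < 1 -> pfun n m c (monom z w) != 0) ->
  exists A B, @is_sos n m c A B.
Proof.
move=> cn.
pose r k : R := 1 - k.+2%:R^-1.
have r01 k : 0 <= r k < 1.
  rewrite /r subr_ge0 invf_le1 ?ltr0n // ler1n /= ltrBlDr ltrDl invr_gt0 ltr0n.
  by [].
pose ck k i j := c i j * (r k)%:C%C ^+ (i + j).
have rn k : `|(r k)%:C%C : C| < 1.
  have /andP[r0 r1] := r01 k.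
  by rewrite ger0_norm ?ler0c // ltcR.
have /choice [AB HAB] k : exists AB, @is_sos n m (ck k) AB.1 AB.2.
  have [A [B H]] := stable_sos (stable_dilate (rn k) cn).
  by exists (A, B).
pose M : R := \sum_(i < n.+1) \sum_(j < m.+1) nsq (c i j).
have cM k i j : (i <= n)%N -> (j <= m)%N -> nsq (ck k i j) <= M.
  move=> iN jm; apply: (@le_trans _ _ (nsq (c i j))).
    rewrite nsqM ler_piMr ?nsq_ge0 //.
    have /andP[r0 r1] := r01 k.
    by rewrite -rmorphXn /nsq /= expr0n addr0 -exprM exprn_ile1 // ltW.
  have iN' : (i < n.+1)%N by []. have jm' : (j < m.+1)%N by [].
  rewrite /M (bigD1 (Ordinal iN')) //= (bigD1 (Ordinal jm')) //= -addrA lerDl.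
  by apply: addr_ge0; apply: sumr_ge0 => ? _; [|apply: sumr_ge0 => ? _]; exact: nsq_ge0.
have bnd k := sos_bound (HAB k) (cM k).
have Abnd k i p : box n m.+1 p ->
   `|(AB k).1 i (unitv R p)| <= (M * 3 ^+ (p.1 + p.2) + 1)%:C%C.
  case: p => a b /andP[/= an bm]; apply: norm_le_of_nsq.
  apply: le_trans (bnd k a b (ltnW an) bm); rewrite (bigD1 i) //= -addrA lerDl.
  by apply: addr_ge0; apply: sumr_ge0 => ? _; exact: nsq_ge0.
have Bbnd k j p : box n.+1 m p ->
   `|(AB k).2 j (unitv R p)| <= (M * 3 ^+ (p.1 + p.2) + 1)%:C%C.
  case: p => a b /andP[/= an bm]; apply: norm_le_of_nsq.
  apply: le_trans (bnd k a b an (ltnW bm)); rewrite addrC (bigD1 j) //= -addrA lerDl.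
  by apply: addr_ge0; apply: sumr_ge0 => ? _; exact: nsq_ge0.
have /choice [a Ha] (ip : 'I_n * I) : exists l,
    box n m.+1 ip.2 -> ucv (fun k => (AB k).1 ip.1 (unitv R ip.2)) l.
  have [pb|pb] := boolP (box n m.+1 ip.2); last by exists 0.
  by have [l Hl] := ucv_ex (fun k => Abnd k ip.1 ip.2 pb); exists l.
have /choice [b Hb] (ip : 'I_m * I) : exists l,
    box n.+1 m ip.2 -> ucv (fun k => (AB k).2 ip.1 (unitv R ip.2)) l.
  have [pb|pb] := boolP (box n.+1 m ip.2); last by exists 0.
  by have [l Hl] := ucv_ex (fun k => Bbnd k ip.1 ip.2 pb); exists l.
pose A i x := \sum_(p <- boxs n m.+1 | p \in boxs n m.+1) a (i, p) * x p.
pose B j x := \sum_(p <- boxs n.+1 m | p \in boxs n.+1 m) b (j, p) * x p.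
have cvA i x : ucv (fun k => (AB k).1 i x) (A i x).
  have E k : (AB k).1 i x =
      \sum_(p <- boxs n m.+1 | p \in boxs n m.+1) (AB k).1 i (unitv R p) * x p.
    rewrite -big_seq; apply: lin_unitv; first exact: boxs_uniq.
    by have [hA _ _] := HAB k; apply: lin_sub (hA i) => p; rewrite inE /= mem_boxs.
  apply: (eq_ucv (fun k => esym (E k))); apply: ucv_sum => p pb.
  by apply: ucvM; [apply: (Ha (i, p)); rewrite -mem_boxs|exact: ucv_cst].
have cvB j x : ucv (fun k => (AB k).2 j x) (B j x).
  have E k : (AB k).2 j x =
      \sum_(p <- boxs n.+1 m | p \in boxs n.+1 m) (AB k).2 j (unitv R p) * x p.
    rewrite -big_seq; apply: lin_unitv; first exact: boxs_uniq.
    by have [_ hB _] := HAB k; apply: lin_sub (hB j) => p; rewrite inE /= mem_boxs.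
  apply: (eq_ucv (fun k => esym (E k))); apply: ucv_sum => p pb.
  by apply: ucvM; [apply: (Hb (j, p)); rewrite -mem_boxs|exact: ucv_cst].
have ucvr : ucv (fun k => (r k)%:C%C) 1.
  have -> : 1 = 1 - 0 :> C by rewrite subr0.
  apply: (eq_ucv (u := fun k => 1 - (k.+2%:R^-1)%:C%C)).
    by move=> k; rewrite /r rmorphB.
  apply: ucvB (ucv_cst 1) _; apply: ucv_tail => e e0.
  have eE : (complex.Re e)%:C%C = e by apply: RRe_real; apply: gtr0_real.
  have e0' : 0 < complex.Re e by rewrite -ltcR eE.
  have [N _ HN] := near_infty_natSinv_lt (PosNum e0').
  exists N => k Nk; rewrite ger0_norm ?ler0c ?invr_ge0 ?ler0n // -eE ltcR.
  by apply: (HN k.+1); rewrite /= leqW.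
have ucvc i j : ucv (fun k => ck k i j) (c i j).
  have -> : c i j = c i j * 1 ^+ (i + j) by rewrite expr1n mulr1.
  by apply: ucvM; [exact: ucv_cst|exact: ucvX].
have cvN u l : ucv u l -> ucv (fun k => (nsq (u k))%:C%C) (nsq l)%:C%C.
  move=> ul; rewrite nsqE; apply: (eq_ucv (fun k => esym (nsqE (u k)))).
  by apply: ucvM => //; exact: ucvJ.
have ucvP (d : nat -> nat -> nat -> C) (e : nat -> nat -> C) x :
    (forall i j, ucv (fun k => d k i j) (e i j)) ->
    ucv (fun k => (nsq (pfun n m (d k) x))%:C%C) (nsq (pfun n m e x))%:C%C.
  move=> de; apply: cvN; apply: ucv_sum => i _; apply: ucv_sum => j _.
  by apply: ucvM => //; exact: ucv_cst.
have ucvS q (u : 'I_q -> nat -> C) (l : 'I_q -> C) : (forall i, ucv (u i) (l i)) ->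
    ucv (fun k => (\sum_(i < q) nsq (u i k))%:C%C) (\sum_(i < q) nsq (l i))%:C%C.
  move=> ul; rewrite rmorph_sum.
  apply: (eq_ucv (u := fun k => \sum_(i < q) (nsq (u i k))%:C%C)).
    by move=> k; rewrite rmorph_sum.
  by apply: ucv_sum => i _; exact: cvN.
exists A, B; split=> [i|j|x].
- apply: lin_sum => p; rewrite mem_boxs => pb; apply: linZ; exact: lin_coord.
- apply: lin_sum => p; rewrite mem_boxs => pb; apply: linZ; exact: lin_coord.
apply: (@complexI R); rewrite [RHS]rmorphD !rmorphB /=.
apply: ucv_unique.
  apply: ucvB; first by apply: (ucvP ck) => i j; exact: ucvc.
  apply: (ucvP (fun k => refl_coef n m (ck k))) => i j; apply: ucvJ; exact: ucvc.
apply: (eq_ucv (u := fun k =>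
  ((\sum_(i < n) nsq ((AB k).1 i x))%:C%C - (\sum_(i < n) nsq ((AB k).1 i (sz x)))%:C%C) +
  ((\sum_(j < m) nsq ((AB k).2 j x))%:C%C - (\sum_(j < m) nsq ((AB k).2 j (sw x)))%:C%C))).
  by move=> k; have [_ _ id] := HAB k; rewrite -!rmorphB -rmorphD /= -id.
apply: ucvD; apply: ucvB; apply: ucvS => i; first exact: cvA.
- exact: cvA.
- exact: cvB.
- exact: cvB.
Qed.

End Dilation.

(** * Symmetric polynomials *)

Section Coefficients.
Variable R : realType.
Local Notation C := R[i].
Local Notation I := (nat * nat)%type.
Implicit Types (q u : {poly {poly C}}) (z w : C).

Lemma horner2E u N M z w : (size u <= N)%N -> (sizeY u <= M)%N ->
  u.[z, w] = \sum_(i < N) \sum_(j < M) u`_i`_j * (z ^+ i * w ^+ j).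
Proof.
move=> uN uM; rewrite (horner_coef_wide _ uN) horner_sum; apply: eq_bigr => i _.
rewrite -polyC_exp hornerM hornerC.
rewrite (horner_coef_wide _ (leq_trans (max_size_coefXY u i) uM)) big_distrl.
by apply: eq_bigr => j _ /=; rewrite -mulrA [w ^+ _ * _]mulrC.
Qed.

Lemma horner_deriv_z u N M z w : (size u <= N)%N -> (sizeY u <= M)%N ->
  z * (deriv_z u).[z, w] = \sum_(i < N) \sum_(j < M) i%:R * u`_i`_j * (z ^+ i * w ^+ j).
Proof.
move=> uN uM.
transitivity ('X * deriv_z u).[z, w]; first by rewrite hornerM hornerX hornerM hornerC.
have cE i j : ('X * deriv_z u)`_i`_j = i%:R * u`_i`_j.
  rewrite coefXM; case: i => [|i] /=; first by rewrite coef0 mul0r.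
  by rewrite coef_deriv coefMn mulr_natl.
have sN : (size ('X * deriv_z u)%R <= N)%N.
  apply/leq_sizeP => i Ni; apply/polyP => j.
  by rewrite cE (nth_default _ (leq_trans uN Ni)) coef0 mulr0.
have sM : (sizeY ('X * deriv_z u)%R <= M)%N.
  apply/bigmax_leqP => i _; apply/leq_sizeP => j Mj.
  by rewrite cE (nth_default _ (leq_trans (max_size_coefXY u i) (leq_trans uM Mj))) mulr0.
rewrite (horner2E _ _ sN sM); apply: eq_bigr => i _; apply: eq_bigr => j _.
by rewrite cE.
Qed.

Lemma coef_deriv_w u i : (deriv_w u)`_i = (u`_i)^`().
Proof. by rewrite coef_map_id0 // deriv0. Qed.

Lemma horner_deriv_w u N M z w : (size u <= N)%N -> (sizeY u <= M)%N ->
  w * (deriv_w u).[z, w] = \sum_(i < N) \sum_(j < M) j%:R * u`_i`_j * (z ^+ i * w ^+ j).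
Proof.
move=> uN uM.
transitivity ('Y * deriv_w u).[z, w]; first by rewrite hornerM hornerC hornerM hornerX.
have cE i j : ('Y * deriv_w u)`_i`_j = j%:R * u`_i`_j.
  rewrite coefCM coef_deriv_w coefXM; case: j => [|j] /=; first by rewrite mul0r.
  by rewrite coef_deriv mulr_natl.
have sN : (size ('Y * deriv_w u)%R <= N)%N.
  apply/leq_sizeP => i Ni; apply/polyP => j.
  by rewrite cE (nth_default _ (leq_trans uN Ni)) coef0 mulr0.
have sM : (sizeY ('Y * deriv_w u)%R <= M)%N.
  apply/bigmax_leqP => i _; apply/leq_sizeP => j Mj.
  by rewrite cE (nth_default _ (leq_trans (max_size_coefXY u i) (leq_trans uM Mj))) mulr0.
rewrite (horner2E _ _ sN sM); apply: eq_bigr => i _; apply: eq_bigr => j _.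
by rewrite cE.
Qed.

Lemma poly_eq0_of_nonzero (p : {poly C}) : (forall z, z != 0 -> p.[z] = 0) -> p = 0.
Proof.
move=> p0; apply/eqP; apply: contraT => pn0.
(* A nonroot of ['X * p] is nonzero, hence falls under the assumption. *)
have : 'X * p != 0 by rewrite mulf_neq0 // polyX_eq0.
case/closed_nonrootP => z /negP; case; rewrite rootE hornerM hornerX mulf_eq0.
by case: (eqVneq z 0) => //= /p0 ->.
Qed.

Lemma poly2_eq0_of_nonzero u :
  (forall z w, z != 0 -> w != 0 -> u.[z, w] = 0) -> u = 0.
Proof.
move=> u0; apply/polyP => i; rewrite coef0; apply: poly_eq0_of_nonzero => w w0.
have : map_poly (horner_eval w) u = 0.
  apply: poly_eq0_of_nonzero => z z0.
  by rewrite -[z in LHS](hornerC z w) horner_map; exact: u0.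
by move=> /(congr1 (fun p : {poly C} => p`_i)); rewrite coef_map coef0.
Qed.

Lemma T2_symmetric_coef n m q i j : (size q <= n.+1)%N -> (sizeY q <= m.+1)%N ->
  T2_symmetric n m q -> (i <= n)%N -> (j <= m)%N -> q`_i`_j = (q`_(n - i)`_(m - j))^*.
Proof.
move=> qn qm qs iN jm.
pose r : {poly {poly C}} := \poly_(i < n.+1) \poly_(j < m.+1) (q`_(n - i)`_(m - j))^*.
suff : q - r = 0.
  move=> /(congr1 (fun u : {poly {poly C}} => u`_i`_j)).
  by rewrite !coef0 !coefB !coef_poly !ltnS iN coef_poly ltnS jm => /eqP; rewrite subr_eq0 => /eqP.
apply: poly2_eq0_of_nonzero => z w z0 w0.
rewrite !hornerD !hornerN qs //; apply/eqP; rewrite subr_eq0; apply/eqP.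
have rn : (size r <= n.+1)%N by exact: size_poly.
have rm : (sizeY r <= m.+1)%N.
  apply/bigmax_leqP => k _; rewrite coef_poly; case: ifP => _; last by rewrite size_poly0.
  exact: size_poly.
have sn N (k : 'I_N.+1) : (N.+1 - k.+1 = N - k)%N by rewrite subSS.
have kn N (k : 'I_N.+1) : (k <= N)%N by rewrite -ltnS.
rewrite /reflection (horner2E _ _ qn qm) (horner2E _ _ rn rm).
rewrite rmorph_sum big_distrr (reindex_inj rev_ord_inj); apply: eq_bigr => k _ /=.
rewrite rmorph_sum big_distrr (reindex_inj rev_ord_inj); apply: eq_bigr => l _ /=.
rewrite !coef_poly !ltn_ord coef_poly ltn_ord !sn !rmorphM /= !rmorphXn /=.
rewrite !fmorphV /= !conjCK mulrCA; congr (_ * _).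
have H N (k' : 'I_N.+1) (v : C) : v != 0 -> v ^+ N * v^-1 ^+ (N - k') = v ^+ k'.
  by move=> v0; rewrite exprVn -{1}(subnKC (kn _ k')) exprD mulfK // expf_neq0.
by rewrite mulrACA !H.
Qed.

(* For a factor [X - r] with [|r| >= 1] the inequality is
   [2 Re (z / (z - r)) <= 1]. *)
Lemma half_degree_roots (rs : seq C) z : (forall r, r \in rs -> 1 <= `|r|) -> `|z| < 1 ->
  let p := \prod_(r <- rs) ('X - r%:P) in
  2 * complex.Re (z * (p^`()).[z] * (p.[z])^*) <= (size rs)%:R * nsq p.[z].
Proof.
move=> + z1; elim: rs => [|r rs IH] rs1 /=.
  by rewrite big_nil derivC horner0 mulr0 mul0r /= mulr0 mul0r.
rewrite big_cons derivM derivXsubC mul1r.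
set p := \prod_(r <- rs) _; rewrite !hornerE /=.
have {}IH : 2 * complex.Re (z * (p^`()).[z] * (p.[z])^*) <= (size rs)%:R * nsq p.[z].
  by apply: IH => s srs; apply: rs1; rewrite inE srs orbT.
have r1 : nsq z <= nsq r.
  rewrite -lecR !nsq_norm ler_pXn2r ?nnegrE ?normr_ge0 //.
  by apply: le_trans (ltW z1) (rs1 r _); rewrite mem_head.
move: (p^`()).[z] p.[z] IH => d v IH.
have -> : z * (v + (z - r) * d) * ((z - r) * v)^* =
  (nsq v)%:C%C * (z * (z - r)^*) + (nsq (z - r))%:C%C * (z * d * v^*).
  by rewrite !nsqE !rmorphM /=; ring.
have ReM (t : R) (u : C) : complex.Re (t%:C%C * u) = t * complex.Re u.
  by case: u => u1 u2 /=; rewrite mul0r subr0.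
rewrite raddfD /= !ReM nsqM mulrDr [size _]/= -natr1 mulrDl mul1r.
(* The right side minus the left side is |r|^2 - |z|^2. *)
have H1 : 2 * complex.Re (z * (z - r)^*) <= nsq (z - r).
  move: r1; rewrite /nsq; case: (z) => z1' z2'; case: (r) => r1' r2' /=; nra.
have H2 : nsq v * (2 * complex.Re (z * (z - r)^*)) <= nsq v * nsq (z - r).
  by apply: ler_wpM2l => //; exact: nsq_ge0.
have H3 : nsq (z - r) * (2 * complex.Re (z * d * v^*)) <=
          nsq (z - r) * ((size rs)%:R * nsq v).
  by apply: ler_wpM2l => //; exact: nsq_ge0.
move: (complex.Re _) (complex.Re _) (nsq (z - r)) (nsq v) H2 H3 => x1 x2 x3 x4.
by set t := (size rs)%:R; nra.
Qed.

Lemma half_degree N (f : nat -> C) z :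
  (forall z, `|z| < 1 -> \sum_(i < N.+1) f i * z ^+ i != 0) -> `|z| < 1 ->
  2 * complex.Re ((\sum_(i < N.+1) i%:R * f i * z ^+ i) * (\sum_(i < N.+1) f i * z ^+ i)^*)
    <= N%:R * nsq (\sum_(i < N.+1) f i * z ^+ i).
Proof.
move=> f0 z1; pose p : {poly C} := \poly_(i < N.+1) f i.
have pE w : p.[w] = \sum_(i < N.+1) f i * w ^+ i by rewrite horner_poly.
have dpE : z * (p^`()).[z] = \sum_(i < N.+1) i%:R * f i * z ^+ i.
  have -> : z * (p^`()).[z] = ('X * p^`()).[z] by rewrite hornerM hornerX.
  rewrite (@horner_coef_wide _ N.+1); last first.
    apply/leq_sizeP => i Ni; rewrite coefXM; case: i Ni => // i Ni /=.
    by rewrite coef_deriv coef_poly ltnNge Ni mul0rn.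
  apply: eq_bigr => i _; rewrite coefXM; case: i => -[|i] iN /=; first by rewrite !mul0r.
  by rewrite coef_deriv coef_poly iN mulr_natl.
rewrite -dpE -pE; have [rs Ep] := closed_field_poly_normal p.
have lp : lead_coef p != 0.
  rewrite lead_coef_eq0; apply: contraNneq (f0 z z1) => p0.
  by rewrite -pE p0 horner0.
have rs1 r : r \in rs -> 1 <= `|r|.
  move=> rr; rewrite real_leNgt ?real1 ?normr_real //; apply/negP => /f0.
  by rewrite -pE Ep hornerZ (rootP _) ?mulr0 ?eqxx // root_prod_XsubC.
have sp : (size rs <= N)%N.
  have := size_poly N.+1 f; rewrite -/p Ep size_scale // (size_prod_XsubC rs id).
  by rewrite ltnS.
have := half_degree_roots rs1 z1; rewrite Ep derivZ !hornerZ /=.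
set P := \prod_(r <- rs) _; set k := lead_coef p => H.
have -> : z * (k * (P^`()).[z]) * (k * P.[z])^* = (nsq k)%:C%C * (z * (P^`()).[z] * (P.[z])^*).
  by rewrite nsqE rmorphM /=; ring.
have ReM (t : R) (u : C) : complex.Re (t%:C%C * u) = t * complex.Re u.
  by case: u => u1 u2 /=; rewrite mul0r subr0.
rewrite ReM nsqM mulrCA [leRHS]mulrCA; apply: ler_wpM2l; first exact: nsq_ge0.
apply: le_trans H _; apply: ler_wpM2r; first exact: nsq_ge0.
by rewrite ler_nat.
Qed.

End Coefficients.

(** * The auxiliary polynomial P and its squares *)

Section Identity.
Variable R : realType.
Local Notation C := R[i].
Local Notation I := (nat * nat)%type.
Variables (n m : nat) (q : {poly {poly C}}).
Hypothesis hdeg : has_degree q n m.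
Hypothesis hsym : T2_symmetric n m q.
Hypothesis hq : nonvanishing_on_bidisk q.
Variables (a b : R).
Hypothesis (ha : 0 <= a) (hb : 0 <= b).

Let d : R := a *+ n + b *+ m.

Definition qcoef i j : C := q`_i`_j.
(** Coefficients of g = a z q_z + b w q_w, which multiplies each monomial by its weight. *)
Definition ecoef i j : C := (a *+ i + b *+ j)%:C%C * q`_i`_j.
Definition pcoef i j : C := ((1 + d) / 2)%:C%C * qcoef i j - ecoef i j.

Let eval2 (c : nat -> nat -> C) z w := pfun n m c (monom z w).

Lemma size_q : (size q <= n.+1)%N. Proof. by case: hdeg => -> _. Qed.
Lemma sizeY_q : (sizeY q <= m.+1)%N. Proof. by case: hdeg => _ ->. Qed.

Lemma eval_qcoef z w : eval2 qcoef z w = q.[z, w].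
Proof. by rewrite (horner2E z w size_q sizeY_q). Qed.

Lemma ecoefE i j : ecoef i j = (a%:C%C * i%:R + b%:C%C * j%:R) * q`_i`_j.
Proof.
rewrite /ecoef rmorphD !rmorphMn /=.
by rewrite -[a%:C%C *+ i]mulr_natr -[b%:C%C *+ j]mulr_natr.
Qed.

Lemma eval_ecoef z w : eval2 ecoef z w =
  a%:C%C * z * (deriv_z q).[z, w] + b%:C%C * w * (deriv_w q).[z, w].
Proof.
rewrite -!mulrA (horner_deriv_z z w size_q sizeY_q) (horner_deriv_w z w size_q sizeY_q) !big_distrr -big_split.
apply: eq_bigr => i _ /=; rewrite !big_distrr -big_split; apply: eq_bigr => j _ /=.
rewrite ecoefE /monom /=.
by move: (a%:C%C : C) (b%:C%C : C) q`_i`_j (i%:R : C) (j%:R : C) (z ^+ i) (w ^+ j) => *; ring.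
Qed.

Lemma pfun_pcoef x : pfun n m pcoef x =
  ((1 + d) / 2)%:C%C * pfun n m qcoef x - pfun n m ecoef x.
Proof.
rewrite /pfun big_distrr -sumrB; apply: eq_bigr => i _ /=.
rewrite big_distrr -sumrB; apply: eq_bigr => j _ /=.
by rewrite /pcoef mulrBl mulrA.
Qed.

(** The weights at (i, j) and (n - i, m - j) add up to [d], so by symmetry of [q] the reflection of
    g is d q - g. *)
Lemma pfun_refl_pcoef x : pfun n m (refl_coef n m pcoef) x =
  ((1 - d) / 2)%:C%C * pfun n m qcoef x + pfun n m ecoef x.
Proof.
rewrite /pfun big_distrr -big_split; apply: eq_bigr => i _ /=.
rewrite big_distrr -big_split; apply: eq_bigr => j _ /=.
rewrite mulrA -mulrDl; congr (_ * _).
have iN : (i <= n)%N by rewrite -ltnS.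
have jm : (j <= m)%N by rewrite -ltnS.
rewrite /refl_coef /pcoef /ecoef /qcoef (T2_symmetric_coef size_q sizeY_q hsym iN jm).
rewrite -mulrBl rmorphM /= -mulrDl; congr (_ * _).
rewrite -rmorphB -rmorphD /=.
have conjR (r : R) : (r%:C%C : C)^* = r%:C%C by exact: conjc_real.
rewrite conjR; congr (_%:C%C).
by rewrite !mulrnBr // /d; field.
Qed.

Lemma pcoef_difference x :
  nsq (pfun n m pcoef x) - nsq (pfun n m (refl_coef n m pcoef) x) =
  d * nsq (pfun n m qcoef x)
   - 2 * complex.Re (pfun n m ecoef x * (pfun n m qcoef x)^*).
Proof.
rewrite pfun_pcoef pfun_refl_pcoef.
move: (pfun n m qcoef x) (pfun n m ecoef x) => [u1 u2] [v1 v2].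
by rewrite /nsq /=; field.
Qed.

(** Freezing one variable in the disk leaves a polynomial in the other without zeros there; the two
    one-variable bounds are added with weights [a] and [b]. *)
Lemma eval_ecoef_le z w : `|z| < 1 -> `|w| < 1 ->
  2 * complex.Re (eval2 ecoef z w * (eval2 qcoef z w)^*) <= d * nsq (eval2 qcoef z w).
Proof.
move=> z1 w1.
pose f i := \sum_(j < m.+1) qcoef i j * w ^+ j.
pose g j := \sum_(i < n.+1) qcoef i j * z ^+ i.
have fE u : \sum_(i < n.+1) f i * u ^+ i = q.[u, w].
  rewrite -eval_qcoef; apply: eq_bigr => i _; rewrite big_distrl; apply: eq_bigr => j _ /=.
  by rewrite /monom /=; ring.
have gE u : \sum_(j < m.+1) g j * u ^+ j = q.[z, u].
  rewrite -eval_qcoef [RHS]exchange_big; apply: eq_bigr => j _ /=.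
  by rewrite big_distrl; apply: eq_bigr => i _ /=; rewrite /monom /=; ring.
have H1 : 2 * complex.Re ((\sum_(i < n.+1) i%:R * f i * z ^+ i) * (q.[z, w])^*) <=
    n%:R * nsq q.[z, w].
  by rewrite -fE; apply: half_degree => // u u1; rewrite fE; exact: hq.
have H2 : 2 * complex.Re ((\sum_(j < m.+1) j%:R * g j * w ^+ j) * (q.[z, w])^*) <=
    m%:R * nsq q.[z, w].
  by rewrite -gE; apply: half_degree => // u u1; rewrite gE; exact: hq.
have -> : eval2 ecoef z w =
   a%:C%C * (\sum_(i < n.+1) i%:R * f i * z ^+ i) + b%:C%C * (\sum_(j < m.+1) j%:R * g j * w ^+ j).
  transitivity (\sum_(i < n.+1) \sum_(j < m.+1)
    (a%:C%C * (i%:R * qcoef i j * w ^+ j * z ^+ i) + b%:C%C * (j%:R * qcoef i j * z ^+ i * w ^+ j))).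
    apply: eq_bigr => i _; apply: eq_bigr => j _.
    rewrite ecoefE /qcoef /monom /=.
    by move: (a%:C%C : C) (b%:C%C : C) q`_i`_j (i%:R : C) (j%:R : C) (z ^+ i) (w ^+ j) => *; ring.
  under eq_bigr => i _ do rewrite big_split /=.
  rewrite big_split /=; congr (_ + _).
    rewrite big_distrr; apply: eq_bigr => i _ /=; rewrite /f big_distrr big_distrl big_distrr /=.
    by apply: eq_bigr => j _; rewrite !mulrA.
  rewrite exchange_big big_distrr; apply: eq_bigr => j _ /=.
  rewrite /g big_distrr big_distrl big_distrr /=.
  by apply: eq_bigr => i _; rewrite !mulrA.
rewrite eval_qcoef [_ * (_^*)]mulrDl raddfD /= -!mulrA.
have ReM (t : R) (u : C) : complex.Re (t%:C%C * u) = t * complex.Re u.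
  by case: u => u1 u2 /=; rewrite mul0r subr0.
rewrite !ReM /d -mulr_natr -[b *+ m]mulr_natr.
have := ler_wpM2l ha H1; have := ler_wpM2l hb H2.
move: (complex.Re _) (complex.Re _) (nsq _) => t1 t2 t3; lra.
Qed.

(** At a zero of P, g = (1 + d) / 2 q, so 2 Re (g conj(q)) = (1 + d) |q|^2 would exceed d |q|^2. *)
Lemma eval_pcoef_neq0 z w : `|z| < 1 -> `|w| < 1 -> eval2 pcoef z w != 0.
Proof.
move=> z1 w1; apply/eqP; rewrite /eval2 pfun_pcoef => /eqP; rewrite subr_eq0 => /eqP E.
have := eval_ecoef_le z1 w1; rewrite /eval2 -E.
have : 0 < nsq (pfun n m qcoef (monom z w)).
  by rewrite nsq_gt0 -/(eval2 _ _ _) eval_qcoef hq.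
move: (pfun n m qcoef (monom z w)) => [u1 u2]; rewrite /nsq /=.
nra.
Qed.

Lemma monom_sz (z w : C) : sz (monom z w) = (fun p => z * monom z w p).
Proof. by apply/funext => p; rewrite /sz /monom /= exprS mulrA. Qed.

Lemma monom_sw (z w : C) : sw (monom z w) = (fun p => w * monom z w p).
Proof. by apply/funext => p; rewrite /sw /monom /= exprS; ring. Qed.

Section Squares.
Variables (A : 'I_n -> (I -> C) -> C) (B : 'I_m -> (I -> C) -> C).
Hypothesis AB : is_sos pcoef A B.

Lemma sos_identity z w :
  d%:C%C * `|q.[z, w]| ^+ 2
   - 2 * 'Re ((a%:C%C * z * (deriv_z q).[z, w] + b%:C%C * w * (deriv_w q).[z, w]) * (q.[z, w])^*)
  = (1 - `|z| ^+ 2) * (\sum_(i < n) `|A i (monom z w)| ^+ 2)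
    + (1 - `|w| ^+ 2) * (\sum_(j < m) `|B j (monom z w)| ^+ 2).
Proof.
have [hA hB id] := AB.
rewrite -eval_ecoef -eval_qcoef /eval2 -nsq_norm.
set u := pfun n m ecoef _ * _.
have -> : 'Re u = (complex.Re u)%:C%C by rewrite ReE ReJ_add.
have -> : 2 * (complex.Re u)%:C%C = (2 * complex.Re u)%:C%C :> C by rewrite rmorphM rmorph_nat.
rewrite -rmorphM -rmorphB /= -pcoef_difference id monom_sz monom_sw.
under [X in _ - X + _]eq_bigr => i _ do rewrite (lin_scale _ _ (hA i)) nsqM.
under [X in _ + (_ - X)]eq_bigr => j _ do rewrite (lin_scale _ _ (hB j)) nsqM.
rewrite -!big_distrr /=.
have E k (F : 'I_k -> C) : \sum_(i < k) `|F i| ^+ 2 = (\sum_(i < k) nsq (F i))%:C%C.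
  by rewrite rmorph_sum; apply: eq_bigr => i _; rewrite -nsq_norm.
by rewrite !E -!nsq_norm !mulrBl !mul1r -!rmorphM -!rmorphB -rmorphD.
Qed.

(* Polarization against the point [(0, 0)], where [q] does not vanish and
   [a z q_z + b w q_w] does. *)
Lemma common_zero z w : q.[z, w] = 0 ->
  (forall i, A i (monom z w) = 0) -> (forall j, B j (monom z w) = 0) ->
  eval2 ecoef z w = 0.
Proof.
move=> q0 A0 B0; have [hA hB id] := AB.
(* Since 0 ^ 0 = 1, [e] is the unit array at (0, 0), and both of its shifts vanish. *)
pose e := monom (0 : C) (0 : C).
pose q1 := pfun n m qcoef e.
have q1_neq0 : q1 != 0 by rewrite /q1 -/(eval2 _ _ _) eval_qcoef; apply: hq; rewrite normr0 ltr01.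
have e0 : pfun n m ecoef e = 0.
  by rewrite -/(eval2 _ _ _) eval_ecoef !mulr0 !mul0r addr0.
set g := eval2 ecoef z w.
pose K := \sum_(i < n) nsq (A i e) + \sum_(j < m) nsq (B j e) - d * nsq q1.
(* The identity at [monom z w] plus [s] times [e]: one side is odd in [s], the other even, so both
   vanish. The values [t] and [- t] are tested below. *)
have key (s : C) : - (2 * complex.Re (g * (s * q1)^*)) = nsq s * K.
  pose x p := monom z w p + s * e p.
  have := id x; rewrite pcoef_difference.
  rewrite !(lin_add _ _ _ (pfun_lin n m _)) e0 mulr0 addr0.
  rewrite -/(eval2 _ _ _) eval_qcoef q0 add0r -/g -/q1.
  have szx : sz x = fun p => z * monom z w p.
    apply/funext => -[i j]; rewrite /sz /x /e /monom /= expr0n /= mul0r mulr0 addr0.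
    by rewrite exprS mulrA.
  have swx : sw x = fun p => w * monom z w p.
    apply/funext => -[i j]; rewrite /sw /x /e /monom /= [0 ^+ j.+1]expr0n /= !mulr0 addr0.
    by rewrite exprS; ring.
  rewrite szx swx.
  under eq_bigr => i _ do rewrite (lin_add _ _ _ (hA i)) A0 add0r nsqM.
  under [X in _ = _ - X + _]eq_bigr => i _ do rewrite (lin_scale _ _ (hA i)) A0 mulr0 nsq0.
  under [X in _ = _ + (X - _)]eq_bigr => i _ do rewrite (lin_add _ _ _ (hB i)) B0 add0r nsqM.
  under [X in _ = _ + (_ - X)]eq_bigr => i _ do rewrite (lin_scale _ _ (hB i)) B0 mulr0 nsq0.
  rewrite !big1_eq -!big_distrr /= !subr0 nsqM /K.
  by move: (complex.Re _) (nsq s) (nsq q1) (\sum_(i < n) _) (\sum_(j < m) _) => *; lra.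
pose t := g * q1^*.
have kt (s : C) : - (2 * complex.Re (t * s^*)) = nsq s * K.
  by rewrite -key rmorphM /t [s^* * _]mulrC mulrA.
have ReM (u : C) : complex.Re (u * u^*) = nsq u by rewrite -nsqE.
have := kt t; have := kt (- t); rewrite rmorphN mulrN raddfN /= ReM.
have -> : nsq (- t) = nsq t by rewrite -[- t]mulN1r nsqM /nsq /= oppr0 expr0n addr0 sqrrN expr1n mul1r.
move=> K1 K2; have : nsq t = 0 by lra.
move/eqP; rewrite nsq_eq0 /t mulf_eq0 conjC_eq0 (negbTE q1_neq0) orbF => /eqP.
by [].
Qed.

End Squares.
End Identity.

(** * Common zeros *)

Section Bivariate.
Variable C : numClosedFieldType.
Implicit Types (c d r : {poly C}) (p q g h u v x y : {poly {poly C}}) (s z w : C).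

Local Notation linY s := (('X - s%:P)%:P : {poly {poly C}}).

Lemma unit_bipoly p : (p \is a GRing.unit) = (size p == 1%N) && (size p`_0 == 1%N).
Proof.
rewrite poly_unitE; case: eqP => //= /eqP /size_poly1P [c _ ->].
by rewrite coefC /= poly_unitE; case: eqP => //= /eqP /size_poly1P [k k0 ->]; rewrite coefC /= unitfE.
Qed.

Lemma lin_nonunit s : linY s \isn't a GRing.unit.
Proof. by rewrite unit_bipoly coefC /= size_XsubC andbF. Qed.

Lemma lin_neq0 s : linY s != 0.
Proof. by rewrite polyC_eq0 polyXsubC_eq0. Qed.

Lemma horner_map_eval p z w : (map_poly (horner_eval w) p).[z] = p.[z, w].
Proof. by rewrite -[z in LHS](hornerC z w) horner_map. Qed.

Lemma dvd_lin p s : map_poly (horner_eval s) p = 0 -> exists h, p = linY s * h.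
Proof.
move=> ps; exists (map_poly (fun c => c %/ ('X - s%:P)) p).
apply/polyP => i; rewrite coefCM coef_map_id0 ?div0p // mulrC divpK //.
rewrite dvdp_XsubCl; apply/rootP.
by move/(congr1 (fun r : {poly C} => r`_i)): ps; rewrite coef_map coef0.
Qed.

Lemma irreducible_factor p u v : irreducible_elt p -> p = u * v ->
  u \isn't a GRing.unit -> v \is a GRing.unit.
Proof. by move=> [_ _ H] /H [->|]. Qed.

(* Gauss's lemma, one linear factor of [c] at a time. *)
Lemma gauss_cancel c g x y : c != 0 -> c%:P * g = x * y ->
  exists c1 c2 x' y', [/\ x = c1%:P * x', y = c2%:P * y' & g = x' * y'].
Proof.
have [k] := ubnP (size c); elim: k c g x y => // k IH c g x y ck c0 E.
have [sc|/closed_rootP [s /factor_theorem [c' Ec]]] := eqVneq (size c) 1%N.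
  have /size_poly1P [e e0 ce] : size c == 1%N by rewrite sc.
  exists c, 1, ((e^-1)%:P%:P * x), y; split; last first.
  - by rewrite -mulrA -E ce mulrA -!polyCM mulVf // mul1r.
  - by rewrite mul1r.
  - by rewrite ce mulrA -!polyCM mulfV // mul1r.
have c'0 : c' != 0 by apply: contraNneq c0; rewrite Ec => ->; rewrite mul0r.
have c'k : (size c' < k)%N.
  by move: ck; rewrite Ec size_Mmonic ?monicXsubC // size_XsubC addn2.
have {}E : linY s * (c'%:P * g) = x * y.
  by rewrite -E Ec mulrA polyCM [c'%:P * _]mulrC.
have : map_poly (horner_eval s) x * map_poly (horner_eval s) y = 0.
  by rewrite -rmorphM -E rmorphM /= map_polyC /= /horner_eval hornerXsubC subrr polyC0 mul0r.
move/eqP; rewrite mulf_eq0 => /orP[] /eqP /dvd_lin [h Eh].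
  have /(IH _ _ _ _ c'k c'0) [c1 [c2 [x' [y' [E1 E2 E3]]]]] : c'%:P * g = h * y.
    by apply: (mulfI (lin_neq0 s)); rewrite E Eh mulrA.
  exists (('X - s%:P) * c1), c2, x', y'; split=> //.
  by rewrite Eh E1 polyCM mulrA.
have /(IH _ _ _ _ c'k c'0) [c1 [c2 [x' [y' [E1 E2 E3]]]]] : c'%:P * g = x * h.
  by apply: (mulfI (lin_neq0 s)); rewrite E Eh mulrCA.
exists c1, (('X - s%:P) * c2), x', y'; split=> //.
by rewrite Eh E2 polyCM mulrA.
Qed.

Definition bidvd p g := exists h, g = p * h.

Lemma gauss_dvd p c g y : irreducible_elt p -> (1 < size p)%N -> c != 0 ->
  c%:P * g = p * y -> bidvd p g.
Proof.
move=> pi ps c0 /(gauss_cancel c0) [c1 [c2 [p' [y' [Ep Ey Eg]]]]].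
have c10 : c1%:P != 0 :> {poly {poly C}}.
  by case: pi => p0 _ _; apply: contraNneq p0; rewrite Ep => ->; rewrite mul0r.
have p'n : p' \isn't a GRing.unit.
  apply: contraTN ps; rewrite unit_bipoly => /andP[/eqP p's _].
  by rewrite polyC_eq0 in c10; rewrite Ep mul_polyC size_scale ?p's.
have c1u : (c1%:P : {poly {poly C}}) \is a GRing.unit.
  by apply: (irreducible_factor pi _ p'n); rewrite mulrC.
by exists (c1%:P^-1 * y'); rewrite Ep Eg mulrA [c1%:P * _]mulrC mulrK // .
Qed.

(** Elimination of z: the resultant lies in the ideal of [p] and [g]. If it vanished, they would
    share a factor of positive degree in z, and Gauss's lemma would make [p] divide [g]. *)
Lemma irreducible_elim p g : irreducible_elt p -> (1 < size p)%N -> ~ bidvd p g ->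
  exists r u v, r != 0 /\ r%:P = u * p + v * g.
Proof.
move=> pi ps pg; have [p0 pn pirr] := pi.
have g0 : g != 0.
  by apply/eqP => g0; apply: pg; exists 0; rewrite mulr0.
have [gs|gs] := leqP (size g) 1.
  exists g`_0, 0, 1; rewrite mul0r add0r mul1r -size1_polyC //; split=> //.
  by rewrite -polyC_eq0 -size1_polyC.
have [[u v] /= _ E] := resultant_in_ideal ps gs.
have [r0|r0] := eqVneq (resultant p g) 0; last by exists (resultant p g), u, v.
move/eqP: r0; rewrite resultant_eq0 => dn; exfalso.
set d := gcdp p g in dn.
have /Pdiv.Idomain.dvdpP [[c1 e] /= c10 Ep] : d %| p by exact: dvdp_gcdl.
have /Pdiv.Idomain.dvdpP [[c2 f] /= c20 Eg] : d %| g by exact: dvdp_gcdr.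
have {}Ep : c1%:P * p = (d : {poly {poly C}}) * e by rewrite mul_polyC Ep mulrC.
have [k1 [k2 [d' [e' [Ed' Ee Ep']]]]] := gauss_cancel c10 Ep.
have d'n : d' \isn't a GRing.unit.
  apply: contraTN dn; rewrite unit_bipoly => /andP[/eqP d's _].
  rewrite Ed' mul_polyC -leqNgt -d's; exact: size_scale_leq.
have e'u := irreducible_factor pi Ep' d'n.
apply: pg; apply: (@gauss_dvd p c2 g (k1%:P * e'^-1 * f)) => //.
rewrite mul_polyC Eg Ed' Ep'.
have -> : d' * e' * (k1%:P * e'^-1 * f) = f * (k1%:P * d') * (e' / e') by ring.
by rewrite divrr ?mulr1.
Qed.

Lemma irreducible_lin p : irreducible_elt p -> (size p <= 1)%N ->
  exists s v, v \is a GRing.unit /\ p = linY s * v.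
Proof.
move=> pi ps; have [p0 pn pirr] := pi.
have Ep := size1_polyC ps.
have [/closed_rootP [s /factor_theorem [c Ec]]] : size p`_0 != 1%N.
  apply: contraNneq pn => s1; rewrite unit_bipoly s1 eqxx andbT.
  by rewrite eqn_leq ps lt0n size_poly_eq0.
exists s, c%:P; split; last by rewrite Ep Ec polyCM mulrC.
apply: (irreducible_factor pi _ (lin_nonunit s)).
by rewrite Ep Ec polyCM mulrC.
Qed.

(** Euclid's argument: if [p] does not divide [x], some nonzero r(w) is u p + v x, so [p] divides r
    y, and Gauss's lemma removes r. A [p] free of z is linear in w up to a unit and is treated by
    evaluation. *)
Lemma irreducible_prime p x y : irreducible_elt p -> bidvd p (x * y) ->
  bidvd p x \/ bidvd p y.
Proof.
move=> pi [h Eh]; have [ps|ps] := leqP (size p) 1.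
  have [s [v [vu Ep]]] := irreducible_lin pi ps.
  have H g : map_poly (horner_eval s) g = 0 -> bidvd p g.
    by case/dvd_lin => k ->; exists (v^-1 * k); rewrite Ep mulrA mulrK.
  have : map_poly (horner_eval s) x * map_poly (horner_eval s) y = 0.
    rewrite -rmorphM Eh Ep !rmorphM /= map_polyC /= /horner_eval hornerXsubC subrr.
    by rewrite polyC0 !mul0r.
  by move/eqP; rewrite mulf_eq0 => /orP[] /eqP /H; [left|right].
have [px|px] := EM (bidvd p x); [by left|right].
have [r [u [v [r0 E]]]] := irreducible_elim pi ps px.
apply: (@gauss_dvd p r y (u * y + v * h)) => //.
by rewrite E mulrDl -mulrA -[v * x * y]mulrA Eh; ring.
Qed.

Lemma finite_roots (r : {poly C}) : r != 0 -> exists t : seq C, forall z, root r z -> z \in t.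
Proof.
move=> r0; have [t Et] := closed_field_poly_normal r; exists t => z.
by rewrite Et rootZ ?lead_coef_eq0 // root_prod_XsubC.
Qed.

(** Elimination leaves finitely many w. For each of them the slice of [p] is nonzero, since
    otherwise a linear factor in w would divide [p], and so z takes finitely many values. *)
Lemma finite_common_zeros p g : irreducible_elt p -> ~ bidvd p g ->
  finite_set [set zw : C * C | p.[zw.1, zw.2] = 0 /\ g.[zw.1, zw.2] = 0].
Proof.
move=> pi pg.
have section (h : {poly {poly C}}) w : map_poly (horner_eval w) h != 0 ->
    exists t : seq C, forall z, h.[z, w] = 0 -> z \in t.
  move=> /finite_roots [t Ht]; exists t => z hz.
  by apply: Ht; rewrite rootE horner_map_eval hz.
have fin (t : seq C) (T : C -> seq C) :
    (forall z w, p.[z, w] = 0 -> g.[z, w] = 0 -> w \in t /\ z \in T w) ->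
    finite_set [set zw : C * C | p.[zw.1, zw.2] = 0 /\ g.[zw.1, zw.2] = 0].
  move=> H; apply: (@sub_finite_set _ _ [set` [seq (z, w) | w <- t, z <- T w]]).
    move=> [z w] /= [pz gz]; have [wt zT] := H z w pz gz.
    by apply/allpairsPdep; exists w, z.
  exact: finite_seq.
have [ps|ps] := leqP (size p) 1.
  have [s [v [vu Ep]]] := irreducible_lin pi ps.
  have [|t Ht] := section g s.
    apply/eqP => /dvd_lin [k Ek]; apply: pg; exists (v^-1 * k).
    by rewrite Ep mulrA mulrK.
  apply: (fin [:: s] (fun=> t)) => z w pz gz.
  suff ws : w = s by rewrite ws mem_head; split=> //; apply: Ht; rewrite -ws.
  move: vu; rewrite unit_bipoly => /andP[/eqP v1 /eqP v2].
  have /size_poly1P [k k0 Ek] : size v`_0 == 1%N by rewrite v2.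
  have Ev : v = k%:P%:P by rewrite [v]size1_polyC ?v1 // Ek.
  move: pz; rewrite Ep Ev !hornerE => /eqP.
  by rewrite mulf_eq0 (negbTE k0) orbF subr_eq0 => /eqP.
have [r [u [v [r0 E]]]] := irreducible_elim pi ps pg.
have [t Ht] := finite_roots r0.
have pw w : exists t : seq C, forall z, p.[z, w] = 0 -> z \in t.
  apply: section; apply/eqP => /dvd_lin [k Ek].
  have := irreducible_factor pi Ek (lin_nonunit w).
  rewrite unit_bipoly => /andP[/eqP k1 _].
  by move: ps; rewrite Ek mul_polyC ltnNge (leq_trans (size_scale_leq _ _)) ?k1.
have [T HT] := choice pw.
apply: (fin t T) => z w pz gz; split; last exact: HT.
apply: Ht; rewrite rootE.
have := congr1 (fun h : {poly {poly C}} => h.[z, w]) E.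
by rewrite !hornerE pz gz !mulr0 addr0 => ->.
Qed.

End Bivariate.

(** * The weighted Euler derivation *)

Section WeightedDerivation.
Variable C : numClosedFieldType.
Implicit Types (p q g h u v : {poly {poly C}}) (s z w : C).
Variables a b : C.
Hypotheses (ha : 0 <= a) (hb : 0 <= b).

Definition wderiv p : {poly {poly C}} :=
  a%:P%:P * ('X * deriv_z p) + b%:P%:P * ('Y * deriv_w p).

Lemma wderiv_coef p i j : (wderiv p)`_i`_j = (a * i%:R + b * j%:R) * p`_i`_j.
Proof.
rewrite coefD !coefCM coefD !coefCM mulrDl -!mulrA; congr (a * _ + b * _).
  rewrite coefXM; case: i => [|i] /=; first by rewrite coef0 mul0r.
  by rewrite coef_deriv coefMn mulr_natl.
rewrite coef_map_id0 ?deriv0 // coefXM; case: j => [|j] /=; first by rewrite mul0r.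
by rewrite coef_deriv mulr_natl.
Qed.

Lemma deriv_wM p u : deriv_w (p * u) = deriv_w p * u + p * deriv_w u.
Proof.
apply/polyP => i; rewrite coefD coef_map_id0 ?deriv0 // !coefM raddf_sum -big_split.
apply: eq_bigr => k _ /=; rewrite derivM !coef_map_id0 ?deriv0 //.
Qed.

Lemma wderivM p u : wderiv (p * u) = wderiv p * u + p * wderiv u.
Proof. by rewrite /wderiv /deriv_z derivM deriv_wM; ring. Qed.

Lemma wderiv_eq0 p : p`_0`_0 != 0 -> bidvd p (wderiv p) -> wderiv p = 0.
Proof.
move=> p00 [h Eh].
have p0 : p != 0 by apply: contraNneq p00 => ->; rewrite !coef0.
have [h_eq0|h0] := eqVneq h 0; first by rewrite Eh h_eq0 mulr0.
have sD : (size (wderiv p) <= size p)%N.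
  apply/leq_sizeP => i pi; apply/polyP => j.
  by rewrite wderiv_coef (nth_default _ pi) coef0 mulr0.
have hs : (size h <= 1)%N.
  move: sD; rewrite Eh size_mul //.
  have : (0 < size p)%N by rewrite size_poly_gt0.
  by move: (size p) (size h) => ? ?; lia.
have Eh0 := size1_polyC hs; set c := h`_0 in Eh0.
have c0 : c != 0 by rewrite -polyC_eq0 -Eh0.
set k := (size p).-1; have lp : p`_k != 0 by rewrite -lead_coefE lead_coef_eq0.
have Ek : (wderiv p)`_k = p`_k * c by rewrite Eh Eh0 coefMC.
have cs : (size c <= 1)%N.
  have : (size ((wderiv p)`_k)%R <= size (p`_k)%R)%N.
    by apply/leq_sizeP => j pj; rewrite wderiv_coef (nth_default _ pj) mulr0.
  rewrite Ek size_mul //.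
  have : (0 < size (p`_k)%R)%N by rewrite size_poly_gt0.
  by move: (size p`_k) (size c) => ? ?; lia.
have Ec := size1_polyC cs.
have : (wderiv p)`_0`_0 = p`_0`_0 * c`_0 by rewrite Eh Eh0 coefMC Ec coefMC coefC.
rewrite wderiv_coef !mulr0 addr0 mul0r => /esym/eqP; rewrite mulf_eq0 (negbTE p00) /=.
by rewrite -polyC_eq0 -Ec (negbTE c0).
Qed.

Lemma weight_eq0 i j : a * i%:R + b * j%:R = 0 -> a * i%:R = 0 /\ b * j%:R = 0.
Proof.
move/eqP; rewrite paddr_eq0 ?mulr_ge0 ?ler0n // => /andP[/eqP -> /eqP ->].
by [].
Qed.

Hypothesis hab : ~ (a = 0 /\ b = 0).

(** Once [wderiv p] is 0, only monomials with a i + b j = 0 occur in [p]. As the weights are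
    nonnegative, [p] is constant or depends only on a variable whose weight is zero. *)
Lemma irreducible_not_dvd_wderiv q p u : irreducible_elt p -> p`_0`_0 != 0 ->
  q = p * u -> (a = 0 -> no_factor_in_z_only q) -> (b = 0 -> no_factor_in_w_only q) ->
  ~ bidvd p (wderiv p).
Proof.
move=> [p0 pn pirr] p00 Eq az bw pd.
have D0 i j : (a * i%:R + b * j%:R) * p`_i`_j = 0.
  by rewrite -wderiv_coef (wderiv_eq0 p00 pd) !coef0.
have const : ~ (p = (p`_0`_0)%:P%:P).
  move=> E; case/negP: pn; rewrite unit_bipoly E !coefC /= !size_polyC.
  by rewrite polyC_eq0 p00.
have [a0|a0] := eqVneq a 0.
  have b0 : b != 0 by apply/eqP => b0; apply: hab.
  pose r : {poly C} := map_poly (fun c : {poly C} => c`_0) p.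
  have Ep : p = r^:P.
    apply/polyP => i; rewrite coef_map coef_map_id0 ?coef0 //; apply/polyP => -[|j].
      by rewrite coefC.
    have := D0 i j.+1; rewrite a0 mul0r add0r coefC /= => /eqP.
    by rewrite !mulf_eq0 (negbTE b0) pnatr_eq0 => /eqP.
  have rs : (size r <= 1)%N by apply: (az a0 r u); rewrite -Ep.
  apply: const; rewrite {1}Ep (size1_polyC rs) map_polyC /=; congr (_%:P%:P).
  by rewrite coef_map_id0 ?coef0.
have Ep : p = (p`_0)%:P.
  apply/polyP => -[|i]; rewrite coefC //=; apply/polyP => j; rewrite coef0.
  have /eqP := D0 i.+1 j; rewrite mulf_eq0 => /orP[/eqP /weight_eq0 [/eqP]|/eqP //].
  by rewrite mulf_eq0 (negbTE a0) pnatr_eq0.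
have [b0|b0] := eqVneq b 0.
  have rs : (size (p`_0)%R <= 1)%N by apply: (bw b0 p`_0 u); rewrite -Ep.
  by apply: const; rewrite {1}Ep (size1_polyC rs) coefC.
apply: const; rewrite {1}Ep; congr (_%:P); apply/polyP => -[|j]; rewrite coefC //=.
have /eqP := D0 0%N j.+1; rewrite mulf_eq0 => /orP[/eqP /weight_eq0 [_ /eqP]|/eqP //].
by rewrite mulf_eq0 (negbTE b0) pnatr_eq0.
Qed.

Lemma prime_dvd_prod p (s : seq {poly {poly C}}) : irreducible_elt p ->
  bidvd p (\prod_(x <- s) x) -> exists2 x, x \in s & bidvd p x.
Proof.
move=> pi; have [_ pn _] := pi; elim: s => [|x s IH].
  rewrite big_nil => -[h Eh]; exfalso; case/negP: pn.
  by apply/unitrP; exists h; rewrite mulrC -Eh.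
rewrite big_cons => /(irreducible_prime pi) [px|/IH [y ys py]].
  by exists x; rewrite ?mem_head.
by exists y; rewrite // inE ys orbT.
Qed.

Lemma finite_zeros_wderiv q : q.[0, 0] != 0 -> product_of_distinct_irreducibles q ->
  (a = 0 -> no_factor_in_z_only q) -> (b = 0 -> no_factor_in_w_only q) ->
  finite_set [set zw : C * C | q.[zw.1, zw.2] = 0 /\ (wderiv q).[zw.1, zw.2] = 0].
Proof.
move=> q0 [c [s [cu si us sa Eq]]] az bw.
have cN z w : c.[z, w] != 0.
  move: cu; rewrite unit_bipoly => /andP[/eqP c1 /eqP c2].
  have /size_poly1P [k k0 Ek] : size c`_0 == 1%N by rewrite c2.
  by rewrite [c]size1_polyC ?c1 // Ek !hornerC.
apply: (@sub_finite_set _ _ (\bigcup_(p in [set` s])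
  [set zw : C * C | p.[zw.1, zw.2] = 0 /\ (wderiv q).[zw.1, zw.2] = 0])).
  move=> [z w] /= [qz dz].
  move/eqP: qz; rewrite {1}Eq !hornerM mulf_eq0 (negbTE (cN z w)) /=.
  rewrite !horner_prod => /eqP/eqP; rewrite prodf_seq_eq0 => /hasP [p ps /= /eqP pz].
  by exists p.
apply: bigcup_finite; first exact: finite_seq.
move=> p /= ps; have pi := si p ps.
apply: finite_common_zeros => // pd.
pose u := c * \prod_(x <- rem p s) x.
have Epu : q = p * u.
  by rewrite Eq (perm_big _ (perm_to_rem ps)) big_cons /= /u mulrCA.
have p00 : p`_0`_0 != 0.
  move: q0; rewrite Epu !hornerM mulf_eq0 negb_or => /andP[+ _].
  by rewrite polyC0 !horner_coef0.
(* By Leibniz's rule [p] divides [wderiv p * u]. Being prime, it would divide [u], that is, the unit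
   [c] or another of the distinct factors. *)
move: pd; rewrite Epu wderivM => -[h Eh].
have : bidvd p (wderiv p * u).
  by exists (h - wderiv u); rewrite mulrBr -Eh addrK.
case/(irreducible_prime pi); first by apply: (irreducible_not_dvd_wderiv pi p00 Epu).
case/(irreducible_prime pi) => [[k Ek]|].
  have [_ pn _] := pi; case/negP: pn.
  have E : p * (k * c^-1) = 1 by rewrite mulrA -Ek divrr.
  by apply/unitrP; exists (k * c^-1); rewrite mulrC E.
case/(prime_dvd_prod pi) => x xs [k Ek].
have xs' := mem_rem xs.
have ku := irreducible_factor (si x xs') Ek (let: And3 _ h _ := pi in h).
have xp : x = p by apply: sa => //; exists k => //; rewrite mulrC.
by move: xs; rewrite mem_rem_uniq // xp !inE eqxx.
Qed.

End WeightedDerivation.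

Section PolynomialOfFunctional.
Variable R : realType.
Local Notation C := R[i].
Local Notation I := (nat * nat)%type.

Definition lin_poly a b (l : (I -> C) -> C) : {poly {poly C}} :=
  \poly_(i < a) \poly_(j < b) l (unitv R (i, j)).

Lemma size_lin_poly a b l : (size (lin_poly a b l) <= a)%N.
Proof. exact: size_poly. Qed.

Lemma sizeY_lin_poly a b l : (sizeY (lin_poly a b l) <= b)%N.
Proof.
apply/bigmax_leqP => k _; rewrite coef_poly; case: ifP => _; last by rewrite size_poly0.
exact: size_poly.
Qed.

Lemma horner_lin_poly a b l z w : lin (box a b) l ->
  (lin_poly a b l).[z, w] = l (monom z w).
Proof.
move=> hl; rewrite (horner2E z w (size_lin_poly a b l) (sizeY_lin_poly a b l)).
rewrite (@lin_unitv _ (boxs a b)); first last.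
- by apply: lin_sub hl => p pb; rewrite inE /= mem_boxs.
- exact: boxs_uniq.
have iotaE k : iota 0 k = index_iota 0 k by rewrite /index_iota subn0.
rewrite /boxs big_allpairs_dep /= !iotaE big_mkord; apply: eq_bigr => i _.
rewrite big_mkord; apply: eq_bigr => j _.
by rewrite !coef_poly !ltn_ord coef_poly ltn_ord.
Qed.

End PolynomialOfFunctional.

Theorem theorem2p15 (R : realType) (n m : nat) (q : {poly {poly R[i]}})
    (hdeg : has_degree q n m) (hsym : T2_symmetric n m q)
    (hq : nonvanishing_on_bidisk q)
    (a b : R) (ha : 0 <= a) (hb : 0 <= b) (hab : ~ (a = 0 /\ b = 0)) :
  exists (A : 'I_n -> {poly {poly R[i]}}) (B : 'I_m -> {poly {poly R[i]}}),
    [/\ forall i, (size (A i) <= n)%N /\ (sizeY (A i) <= m.+1)%N,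
        forall j, (size (B j) <= n.+1)%N /\ (sizeY (B j) <= m)%N,
        forall z w : R[i],
          (a *+ n + b *+ m)%:C%C * `|q.[z, w]| ^+ 2
          - 2 * 'Re ((a%:C%C * z * (deriv_z q).[z, w]
                      + b%:C%C * w * (deriv_w q).[z, w]) * (q.[z, w])^*)
          = (1 - `|z| ^+ 2) * (\sum_(i < n) `|(A i).[z, w]| ^+ 2)
            + (1 - `|w| ^+ 2) * (\sum_(j < m) `|(B j).[z, w]| ^+ 2) &
        product_of_distinct_irreducibles q ->
        (a = 0 -> no_factor_in_z_only q) ->
        (b = 0 -> no_factor_in_w_only q) ->
        finite_set [set p : R[i] * R[i] |
          [/\ q.[p.1, p.2] = 0,
              forall i, (A i).[p.1, p.2] = 0 &
              forall j, (B j).[p.1, p.2] = 0]]].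
Proof.
have [A [B AB]] := nonvanishing_sos (@eval_pcoef_neq0 R n m q hdeg hq a b ha hb).
have [hA hB _] := AB.
exists (fun i => lin_poly n m.+1 (A i)), (fun j => lin_poly n.+1 m (B j)).
split=> [i|j|z w|qd az bw].
- by rewrite size_lin_poly sizeY_lin_poly.
- by rewrite size_lin_poly sizeY_lin_poly.
- under [in RHS]eq_bigr => i _ do rewrite horner_lin_poly //.
  under [X in _ = _ + _ * X]eq_bigr => j _ do rewrite horner_lin_poly //.
  exact: sos_identity.
have q00 : q.[0, 0] != 0 by apply: hq; rewrite normr0 ltr01.
have aC : a%:C%C = 0 -> a = 0 by move=> /(@complexI R).
have bC : b%:C%C = 0 -> b = 0 by move=> /(@complexI R).
have haC : 0 <= a%:C%C :> R[i] by rewrite ler0c.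
have hbC : 0 <= b%:C%C :> R[i] by rewrite ler0c.
have habC : ~ (a%:C%C = 0 :> R[i] /\ b%:C%C = 0 :> R[i]).
  by move=> [/aC a0 /bC b0]; apply: hab.
apply: sub_finite_set (finite_zeros_wderiv haC hbC habC q00 qd
  (fun h => az (aC h)) (fun h => bw (bC h))).
move=> [z w] /= [qz Az Bz]; split=> //.
rewrite /wderiv !hornerE.
have A0 i : A i (monom z w) = 0 by rewrite -(horner_lin_poly _ _ (hA i)).
have B0 j : B j (monom z w) = 0 by rewrite -(horner_lin_poly _ _ (hB j)).
have := common_zero hdeg hsym hq AB qz A0 B0.
by rewrite eval_ecoef // => E; rewrite -[RHS]E !mulrA.
Qed.
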